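(* Let $N\ge1$ be an integer, $\alpha>0$ and $-\min(2,N)<l$. Assume that $$\frac lN<\alpha<\frac{2+l}N .$$ Let $\omega\in L^\infty(\mathbb R^N)$ be homogeneous of degree $0$, $\omega\ge0$, $\omega\not\equiv0$. Let $0<\gamma<N$ be such that $\frac l\alpha<\gamma$, let $\epsilon>0$, $R>0$, and set $$\tilde\varphi(x)=\begin{cases}\omega(x)|x|^{-\gamma},&|x|\le\epsilon,\\0,&|x|>\epsilon,\end{cases}\qquad \tilde{\tilde\varphi}(x)=\begin{cases}0,&|x|<R,\\\omega(x)|x|^{-\gamma},&|x|\ge R.\end{cases}$$ Let $\varphi\in L^q_\gamma(\mathbb R^N)$, where $\frac N{N-\gamma}<q\le\infty$. Let $T_{\max}(\lambda\varphi)$ be the existence time of the maximal solution of $\partial_tu=\Delta u+|\cdot|^l|u|^\alpha u$ on $\mathbb R^N$ with $u(0)=\lambda\varphi$. Then there is a constant $C>0$ (independent of $\lambda$) such that the following hold. (i) If $\varphi\ge\tilde\varphi$, then $T_{\max}(\lambda\varphi)\le C\lambda^{-\left(\frac{2+l}{2\alpha}-\frac\gamma2\right)^{-1}}$ for all $\lambda>1$. (ii) If $\varphi\ge\tilde{\tilde\varphi}$, then $T_{\max}(\lambda\varphi)\le C\lambda^{-\left(\frac{2+l}{2\alpha}-\frac\gamma2\right)^{-1}}$ for all $0<\lambda<1$.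
   Context: $L^q_\gamma(\mathbb R^N)$ is the space of measurable $f:\mathbb R^N\to\mathbb R$ with $|\cdot|^\gamma f\in L^q(\mathbb R^N)$, normed by $\|f\|_{L^q_\gamma}=\||\cdot|^\gamma f\|_{L^q(\mathbb R^N)}$; $1/\infty=0$. Solutions are solutions of $u(t)=e^{t\Delta}u_0+\int_0^te^{(t-\sigma)\Delta}(|\cdot|^l|u(\sigma)|^\alpha u(\sigma))\,d\sigma$, with $e^{t\Delta}$ the heat semigroup on $\mathbb R^N$. Under the stated conditions this equation is locally well-posed in $L^q_\gamma(\mathbb R^N)$: one fixes $0<\nu<\gamma$ with $\frac{\gamma+l}{\alpha+1}<\nu<\frac{N+l}{\alpha+1}$ and $r>q$ with $\frac1{q(\alpha+1)}-\frac{\nu(\alpha+1)-l-\gamma}{N(\alpha+1)}<\frac1r<\frac{N-\nu(\alpha+1)+l}{N(\alpha+1)}$ (with $r=\infty$ if $q=\infty$), and sets $\tilde\beta_l=\frac N2\left(\frac1q-\frac1r\right)+\frac{\gamma-\nu}2$; then there is a unique solution in $C([0,T];L^q_\gamma)$ for which $t^{\tilde\beta_l}\|u(t)\|_{L^r_\nu}$ is bounded on $(0,T]$ (if $q=\infty$, $[0,T]$ is replaced by $(0,T]$ and $\lim_{t\to0}\|u(t)-e^{t\Delta}u_0\|_{L^\infty_\gamma}=0$). It extends to a maximal interval $[0,T_{\max}(u_0))$, and either $T_{\max}(u_0)=\infty$ or $\|u(t)\|_{L^q_\gamma}\to\infty$ as $t\to T_{\max}(u_0)$. *)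

(* Defs.v *)
From HB Require Import structures.
From mathcomp Require Import all_boot all_order all_algebra.
From mathcomp Require Import all_classical all_reals all_analysis.
Import Order.TTheory GRing.Theory Num.Theory.
Import numFieldNormedType.Exports.

Set Implicit Arguments.
Unset Strict Implicit.
Unset Printing Implicit Defensive.

Local Open Scope classical_set_scope.
Local Open Scope ring_scope.

Definition consRn (R : realType) (n : nat) (p : measurableTypeR R * n.-tuple R) :
  n.+1.-tuple R := [tuple of (p.1 : R) :: p.2].

Lemma measurable_consRn (R : realType) (n : nat) :
  measurable_fun setT (@consRn R n).
Proof. by apply: measurable_cons => //; exact: measurable_fst. Qed.

HB.instance Definition _ (R : realType) (n : nat) :=
  isMeasurableFun.Build _ _ _ _ (@consRn R n) (@measurable_consRn R n).

Section lebesgueRnS.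
Context (R : realType) (n : nat).
Variable mu : {sigma_finite_measure set (n.-tuple R) -> \bar R}.

Definition lebesgueRnS : set (n.+1.-tuple R) -> \bar R :=
  pushforward (lebesgue_measure \x mu)%E (@consRn R n).

Let lebesgueRnS0 : lebesgueRnS set0 = 0%E.
Proof. exact: measure0. Qed.

Let lebesgueRnS_ge0 A : (0 <= lebesgueRnS A)%E.
Proof. exact: measure_ge0. Qed.

Let lebesgueRnS_sigma_additive : semi_sigma_additive lebesgueRnS.
Proof. exact: measure_semi_sigma_additive. Qed.

HB.instance Definition _ := isMeasure.Build _ _ _ lebesgueRnS
  lebesgueRnS0 lebesgueRnS_ge0 lebesgueRnS_sigma_additive.

Let lebesgueRnS_sigma_finite : sigma_finite setT lebesgueRnS.
Proof.
have /sigma_finiteP[A [TA ndA Aoo]] :=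
  sigma_finiteT (lebesgue_measure : {measure set (measurableTypeR R) -> \bar R}).
have /sigma_finiteP[B [TB ndB Boo]] := sigma_finiteT mu.
pose F i := A i `*` B i.
have FT : setT = \bigcup_i F i.
  apply/esym; rewrite -subTset => -[x y] _.
  have [i _ Ax] : (\bigcup_i A i) x by rewrite -TA.
  have [j _ By] : (\bigcup_i B i) y by rewrite -TB.
  exists (maxn i j) => //; split => /=.
    exact: (subsetPset _ _ (ndA _ _ (leq_maxl i j))).
  exact: (subsetPset _ _ (ndB _ _ (leq_maxr i j))).
have Foo i : measurable (F i) /\ ((lebesgue_measure \x mu) (F i) < +oo)%E.
  have [mA Ai] := Aoo i; have [mB Bi] := Boo i; split; first exact: measurableX.
  by rewrite product_measure1E// lte_mul_pinfty// ge0_fin_numE.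
pose g (x : n.+1.-tuple R) : measurableTypeR R * n.-tuple R :=
  (thead x, [tuple of behead x]).
have mg : measurable_fun setT g.
  apply/measurable_fun_pairP; split => /=.
    exact: measurable_tnth.
  exact: measurable_behead.
have gK p : g (@consRn R n p) = p.
  by case: p => a t; rewrite /g /consRn/=; congr pair; exact/val_inj.
exists (fun i => g @^-1` F i).
  by rewrite -preimage_bigcup -FT preimage_setT.
move=> i; have [mF Fi] := Foo i; split.
  by rewrite -[X in measurable X]setTI; exact: mg.
rewrite /lebesgueRnS /pushforward -comp_preimage.
by rewrite (_ : g \o _ = id)//; apply/funext => p /=; rewrite gK.
Qed.

HB.instance Definition _ := Measure_isSigmaFinite.Build _ _ _ lebesgueRnS
  lebesgueRnS_sigma_finite.

End lebesgueRnS.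

Fixpoint lebesgueRn (R : realType) (n : nat) :
    {sigma_finite_measure set (n.-tuple R) -> \bar R} :=
  match n with
  | 0 => dirac ([tuple] : 0.-tuple R)
  | n'.+1 => lebesgueRnS (lebesgueRn R n')
  end.

Lemma lebesgueRn_box (R : realType) (n : nat) (A : 'I_n -> set R) :
  (forall i, measurable (A i)) ->
  lebesgueRn R n [set x | forall i, A i (tnth x i)] =
  (\prod_(i < n) (lebesgue_measure : set (measurableTypeR R) -> \bar R) (A i))%E.
Proof.
elim: n A => [|n IHn] A mA.
  rewrite big_ord0 /= diracE mem_set//= => i; by case: i.
rewrite big_ord_recl -IHn//= /lebesgueRnS /pushforward.
rewrite -product_measure1E//; last 2 first.
  exact: mA.
  rewrite (_ : mkset _ = \bigcap_(i in [set: 'I_n])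
      ((fun x : n.-tuple R => tnth x i) @^-1` A (lift ord0 i))).
    apply: fin_bigcap_measurable; first exact: finite_finset.
    move=> i _; rewrite -[X in measurable X]setTI.
    exact: (measurable_tnth i).
  by apply/seteqP; split => x /= h i; [move=> _|]; exact: h.
congr (product_measure1 _ _ _); apply/seteqP; split => -[a t] /= h.
  split; first by have := h ord0; rewrite tnth0.
  by move=> i; have := h (lift ord0 i); rewrite tnthS.
move=> i; case: h => h0 h; case: (unliftP ord0 i) => [j|] ->.
  by rewrite tnthS.
by rewrite tnth0.
Qed.

Definition enorm (R : realType) (n : nat) (x : n.-tuple R) : R :=
  Num.sqrt (\sum_(i < n) tnth x i ^+ 2).

Definition esub (R : realType) (n : nat) (x y : n.-tuple R) : n.-tuple R :=
  [tuple tnth x i - tnth y i | i < n].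

Definition escale (R : realType) (n : nat) (s : R) (x : n.-tuple R) :
  n.-tuple R := [tuple s * tnth x i | i < n].

Definition homogeneous0 (R : realType) (n : nat) (f : n.-tuple R -> R) :=
  forall s x, 0 < s -> f (escale s x) = f x.

Definition weighted (R : realType) (n : nat) (gamma : R) (f : n.-tuple R -> R)
  : n.-tuple R -> R := fun x => enorm x `^ gamma * f x.

Definition Lw (R : realType) (n : nat) (q : \bar R) (gamma : R) :
    set (n.-tuple R -> R) :=
  [set f | measurable_fun setT f /\
           weighted gamma f \in Lfun (lebesgueRn R n) q].

Definition Lwnorm (R : realType) (n : nat) (q : \bar R) (gamma : R)
    (f : n.-tuple R -> R) : \bar R :=
  'N[lebesgueRn R n]_q[EFin \o weighted gamma f].

Definition heat_kernel (R : realType) (n : nat) (t : R) (x : n.-tuple R) : R :=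
  (4 * pi * t) `^ (- (n%:R / 2)) * expR (- (enorm x ^+ 2 / (4 * t))).

Definition heat (R : realType) (n : nat) (t : R) (f : n.-tuple R -> R) :
    n.-tuple R -> R :=
  fun x => if 0 < t
           then \int[lebesgueRn R n]_y (heat_kernel t (esub x y) * f y)
           else f x.

Definition nonlin (R : realType) (n : nat) (l alpha : R) (v : n.-tuple R -> R) :
    n.-tuple R -> R :=
  fun x => enorm x `^ l * (`|v x| `^ alpha * v x).

(* [fine r^-1] is $1/r$ with $1/\infty = 0$. *)
Definition admissible_exponents (R : realType) (n : nat) (l alpha : R)
    (q : \bar R) (gamma : R) (r : \bar R) (nu : R) : Prop :=
  [/\ 0 < nu < gamma,
      (gamma + l) / (alpha + 1) < nu < (n%:R + l) / (alpha + 1),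
      if q == +oo%E then r = +oo%E else (q < r)%E &
      fine q^-1 / (alpha + 1)
        - (nu * (alpha + 1) - l - gamma) / (n%:R * (alpha + 1))
      < fine r^-1
      < (n%:R - nu * (alpha + 1) + l) / (n%:R * (alpha + 1))].

Definition betal (R : realType) (n : nat) (q : \bar R) (gamma : R)
    (r : \bar R) (nu : R) : R :=
  n%:R / 2 * (fine q^-1 - fine r^-1) + (gamma - nu) / 2.

Definition time_interval (R : realType) (q : \bar R) (T : R) : set R :=
  if q == +oo%E then `]0, T]%classic else `[0, T]%classic.

(* The integral equation is read in $L^q_\gamma$, i.e. almost everywhere in $x$
   for each $t$. The Duhamel term is computed pointwise; the integrability
   clause keeps it from taking the default value of a divergent integral. *)
Definition is_solution (R : realType) (n : nat) (l alpha : R)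
    (q : \bar R) (gamma : R) (r : \bar R) (nu : R)
    (u0 : n.-tuple R -> R) (T : R) (u : R -> n.-tuple R -> R) : Prop :=
  [/\ (forall t, time_interval q T t -> Lw q gamma (u t)),
      (forall t, time_interval q T t ->
        Lwnorm q gamma (u s \- u t)
          @[s --> within (time_interval q T) (nbhs t)] --> 0%E),
      (q = +oo%E -> Lwnorm q gamma (u t \- heat t u0) @[t --> 0^'+] --> 0%E),
      (exists M : R, forall t, 0 < t <= T -> Lw r nu (u t) /\
        ((t `^ betal n q gamma r nu)%:E * Lwnorm r nu (u t) <= M%:E)%E) &
      (forall t, time_interval q T t ->
        {ae lebesgueRn R n, forall x,
          lebesgue_measure.-integrable `[0, t]
            (fun s => (heat (t - s) (nonlin l alpha (u s)) x)%:E) /\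
          u t x = heat t u0 x +
            \int[lebesgue_measure]_(s in `[0, t])
              heat (t - s) (nonlin l alpha (u s)) x})].

(* By uniqueness and continuation, the existence time of the maximal solution
   is the supremum of the lengths of the intervals carrying a solution. *)
Definition Tmax (R : realType) (n : nat) (l alpha : R)
    (q : \bar R) (gamma : R) (r : \bar R) (nu : R)
    (u0 : n.-tuple R -> R) : \bar R :=
  ereal_sup [set T%:E | T in
    [set T | 0 < T /\ exists u, is_solution l alpha q gamma r nu u0 T u]].

Definition phi_inner (R : realType) (n : nat) (omega : n.-tuple R -> R)
    (gamma eps : R) (x : n.-tuple R) : R :=
  if enorm x <= eps then omega x * enorm x `^ (- gamma) else 0.

Definition phi_outer (R : realType) (n : nat) (omega : n.-tuple R -> R)
    (gamma rho : R) (x : n.-tuple R) : R :=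
  if enorm x < rho then 0 else omega x * enorm x `^ (- gamma).

(* Main.v *)
Require Import Defs.
From mathcomp Require Import all_boot all_order all_algebra.
From mathcomp Require Import all_classical all_reals all_analysis.
From mathcomp Require Import measurable_realfun ess_sup_inf ring lra.
Import Order.TTheory GRing.Theory Num.Theory.
Import numFieldNormedType.Exports.
Local Open Scope classical_set_scope.
Local Open Scope ring_scope.

Set Implicit Arguments.
Unset Strict Implicit.
Unset Printing Implicit Defensive.

(* Test a nonnegative solution on [0, T] against the backward heat kernel centred
   at the origin: Y(t) = \int G_{T-t}(y) u(t, y) dy.  By the semigroup property and
   Tonelli, Y(t) = Y(0) + \int_0^t Z with Z(s) = \int G_{T-s}(y) |y|^l u(s, y)^{alpha+1} dy,
   and Hoelder's inequality with the weight |y|^{-l/alpha}, integrable near 0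
   because l/alpha < N, gives Z(s) >= c (T-s)^{l/2} Y(s)^{alpha+1}.  Since Y(T/2) is
   finite, the differential inequality forces Y(0)^alpha <= C T^{-(2+l)/2}.
   Homogeneity of omega bounds Y(0) from below by lambda c rho^{N-gamma} T^{-N/2} as
   soon as the data dominate lambda omega |y|^{-gamma} on the annulus
   rho/2 <= |y| <= rho with rho^2 <= T.  For rho = sqrt T the two bounds combine to
   T <= K lambda^{-1/((2+l)/(2 alpha) - gamma/2)}; the remaining times use rho = eps
   in (i) and are bounded by a constant in (ii).

   Positivity of the solution is not assumed: its negative part satisfies a
   Volterra inequality in L^r_nu without source term, whose only solution in the
   class considered is 0. *)

(** * Integration on R^n and the heat kernel *)

(** [Tmax] is a supremum over all intervals carrying a solution, so the bound is proved for an
    arbitrary [u] satisfying [is_solution]: no joint measurability in (t, x) is given, and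
    real-valued integrals return a default value when they diverge. Both have to be repaired before
    Tonelli applies. The comparison stops at T/2 for two reasons. There the kernel has positive time
    T/2 left, so Y(T/2) is finite for u(T/2) in L^q_gamma as soon as q > N/(N - gamma). And T - s
    lies between T/2 and T, so (T - s)^{l/2} is comparable to T^{l/2} for either sign of l. The
    time-integrability conditions of the Volterra step all reduce to alpha (N/q + gamma) < 2 + l,
    which follows from N/q + gamma < N and alpha N < 2 + l. The inequality alpha N < 2 + l returns
    at the end: a fixed rho yields the exponent 1/((2+l)/(2 alpha) - N/2), which must be positive
    and, as gamma < N, decays faster in lambda > 1 than the exponent claimed. *)

Lemma integral_lebesgueRnS (R : realType) n (f : n.+1.-tuple R -> \bar R) :
  measurable_fun setT f -> (forall x, (0 <= f x)%E) ->
  (\int[lebesgueRn R n.+1]_x f x =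
   \int[lebesgue_measure]_(a in [set: measurableTypeR R]) \int[lebesgueRn R n]_t f (consRn (a, t)))%E.
Proof.
move=> mf f0.
rewrite [LHS](ge0_integral_pushforward (@measurable_consRn R n))//.
rewrite preimage_setT fubini_tonelli1//.
  by apply: measurableT_comp => //; exact: measurable_consRn.
by move=> x; exact: f0.
Qed.

(** Induction on n, splitting off the first coordinate by Tonelli. Gaussians and the majorants of
    the power weights used below are products over coordinates, so n-dimensional estimates reduce to
    integrals on the line. *)
Lemma lebesgueRn_prod (R : realType) n (f : 'I_n -> R -> R) :
  (forall i, measurable_fun setT (f i)) -> (forall i x, 0 <= f i x) ->
  (\int[lebesgueRn R n]_x (\prod_(i < n) f i (tnth x i))%:E =
   \prod_(i < n) \int[lebesgue_measure]_(a in [set: measurableTypeR R]) (f i a)%:E)%E.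
Proof.
elim: n f => [|n IHn] f mf f0.
  rewrite big_ord0 (eq_integral (cst 1%E)); last by move=> x _; rewrite big_ord0.
  by rewrite integral_cst//= diracT mul1e.
rewrite integral_lebesgueRnS; last 2 first.
- apply/measurable_EFinP; apply: measurable_prod => i _.
  by apply: measurableT_comp => //; exact: measurable_tnth.
- by move=> x; rewrite lee_fin prodr_ge0.
have mprod : measurable_fun setT
    (fun t : n.-tuple R => (\prod_(i < n) f (lift ord0 i) (tnth t i))%:E).
  apply/measurable_EFinP; apply: measurable_prod => i _.
  by apply: measurableT_comp => //; exact: measurable_tnth.
have prod0 (t : n.-tuple R) : (0 <= (\prod_(i < n) f (lift ord0 i) (tnth t i))%:E)%E.
  by rewrite lee_fin prodr_ge0.
rewrite big_ord_recl -(IHn (fun i => f (lift ord0 i)))//.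
rewrite -ge0_integralZr//; last 3 first.
- by apply/measurable_EFinP; exact: (mf ord0).
- by move=> x _; rewrite lee_fin.
- exact: integral_ge0.
apply: eq_integral => a _; rewrite -ge0_integralZl//; last by rewrite lee_fin.
apply: eq_integral => t _; rewrite big_ord_recl EFinM; congr (_ * (_)%:E)%E.
by apply: eq_bigr => i _; rewrite /consRn tnthS.
Qed.

Lemma powR_expR (R : realType) (a x : R) : 0 < a -> a `^ x = expR (x * ln a).
Proof. by move=> a0; rewrite /powR gt_eqF. Qed.

(** The smaller base must be positive: by convention 0 to a nonzero power is 0, so negative powers
    lose their singularity at 0. For the same reason points of norm 0 are set aside as a null set in
    many later proofs. *)
Lemma ger_powRN (R : realType) (b x y : R) : 0 <= b -> 0 < x -> x <= y ->
  y `^ (- b) <= x `^ (- b).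
Proof.
move=> b0 x0 xy; have y0 := lt_le_trans x0 xy.
by rewrite !powRN lef_pV2 ?posrE ?powR_gt0// ge0_ler_powR// nnegrE ltW.
Qed.

Lemma sum_geometric_le (R : realType) (x : R) n : 0 <= x < 1 ->
  \sum_(k < n) x ^+ k <= (1 - x)^-1.
Proof.
move=> /andP[x0 x1].
have d0 : 0 < 1 - x by rewrite subr_gt0.
rewrite -(@ler_pM2l _ (1 - x))// mulfV ?gt_eqF//.
have -> : (1 - x) * \sum_(k < n) x ^+ k = 1 - x ^+ n.
  by rewrite -opprB mulNr -subrX1 opprB.
by rewrite gerBl exprn_ge0.
Qed.

Lemma dyadic_bracket (R : realType) (z t : R) : 0 < z <= t ->
  exists k : nat, 2^-1 ^+ k.+1 * t < z <= 2^-1 ^+ k * t.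
Proof.
move=> /andP[z0 zt]; have t0 : 0 < t := lt_le_trans z0 zt.
have ex : exists k : nat, 2^-1 ^+ k.+1 * t < z.
  have h1 : `|2^-1 : R| < 1 by rewrite ger0_norm// invf_lt1// ltr1n.
  have := cvg_expr h1.
  have /[swap] /cvgrPdist_lt /(_ (z / t)) := divr_gt0 z0 t0.
  move=> /[apply] -[k _ /(_ k.+1 (leqnSn k))]/=.
  rewrite sub0r normrN ger0_norm ?exprn_ge0// ltr_pdivlMr// => h.
  by exists k.
exists (ex_minn ex); case: ex_minnP => -[|k] h1 h2; rewrite h1/= ?expr0 ?mul1r//.
by rewrite leNgt; apply/negP => /h2; rewrite ltnn.
Qed.

(** On the dyadic shell h^{k+1} t < |s - c| <= h^k t, with h = 1/2, the integrand is at most a_k =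
    (h^{k+1} t)^{-b}, and the interval [I k] containing the shell has length 2 h^k t. The products
    form a geometric series of ratio x = h^{1-b} < 1, whence the constant 2 h^{-b} / (1 - x). *)
Lemma integral_powR_near (R : realType) (b : R) : 0 <= b < 1 ->
  exists2 C : R, 0 < C & forall c t : R, 0 < t ->
   (\int[lebesgue_measure]_(s in `[(c - t)%R, (c + t)%R]) (`|s - c| `^ (- b))%:E
     <= (C * t `^ (1 - b))%:E)%E.
Proof.
move=> /andP[b0 b1].
pose h : R := 2^-1; pose x := h `^ (1 - b).
have h0 : 0 < h by rewrite invr_gt0.
have h1 : h < 1 by rewrite invf_lt1// ltr1n.
have x0 : 0 < x by exact: powR_gt0.
have x1 : x < 1.
  have -> : 1 = 1 `^ (1 - b) :> R by rewrite powR1.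
  by rewrite /x gt0_ltr_powR ?nnegrE ?subr_gt0// ltW.
exists (2 * h `^ (- b) * (1 - x)^-1).
  by rewrite !mulr_gt0 ?powR_gt0 ?invr_gt0 ?subr_gt0.
move=> c t t0.
pose I k : set R := `[c - h ^+ k * t, c + h ^+ k * t]%classic.
pose a k := (h ^+ k.+1 * t) `^ (- b).
have a0 k : 0 <= a k by exact: powR_ge0.
have hk0 k : 0 < h ^+ k * t by rewrite mulr_gt0 ?exprn_gt0.
have mI k : measurable (I k) by exact: measurable_itv.
have mt k : measurable_fun setT (fun s : R => (a k * \1_(I k) s)%:E).
  by apply/measurable_EFinP/measurable_funM => //; exact: measurable_indic.
apply: (@le_trans _ _ (\int[lebesgue_measure]_(s in `[(c - t)%R, (c + t)%R])
   \sum_(0 <= k <oo) (a k * \1_(I k) s)%:E)%E).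
  apply: ge0_le_integral => //.
  - apply/measurable_EFinP; apply: measurable_funTS.
    apply: (measurableT_comp (measurable_powR _)).
    by apply: measurableT_comp => //; exact: measurable_funB.
  - apply: ge0_emeasurable_sum => //.
      by move=> k s _ _; rewrite lee_fin mulr_ge0.
    by move=> k _; apply: measurable_funTS; exact: mt.
  move=> s /=; rewrite in_itv/= => /andP[s1 s2].
  have key k : (s \in I k) -> `|s - c| `^ (- b) <= a k ->
     ((`|s - c| `^ (- b))%:E <= \sum_(0 <= k <oo) (a k * \1_(I k) s)%:E)%E.
    move=> sI ak.
    rewrite (@nneseriesD1 _ _ k)//; last by move=> j _; rewrite lee_fin mulr_ge0.
    rewrite indicE sI mulr1 -[leLHS]adde0 leeD ?lee_fin//.
    by apply: nneseries_ge0 => j _ _; rewrite lee_fin mulr_ge0.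
  (* The centre lies in no shell. There the integrand is 0 to the power - b, that is 0 for b
     different from 0 and 1 for b = 0; the term k = 0 dominates in both cases. *)
  have [sc|sc] := eqVneq s c.
    apply: (key 0%N).
      by rewrite sc inE /I/= in_itv/= gerBl lerDl andbb ltW.
    rewrite sc subrr normr0; have [b00|bn0] := eqVneq b 0.
      by rewrite /a b00 oppr0 !powRr0.
    by rewrite powR0 ?oppr_eq0.
  have [|k /andP[k1 k2]] := @dyadic_bracket R `|s - c| t.
    by rewrite normr_gt0 subr_eq0 sc/= ler_norml; apply/andP; split; lra.
  apply: (key k).
    by rewrite inE /I/= in_itv/=; move: k2; rewrite -/h ler_norml => /andP[? ?]; apply/andP; split; lra.
  by apply: ger_powRN => //; exact: ltW.
rewrite integral_nneseries//; last 2 first.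
- by move=> k; apply: measurable_funTS; exact: mt.
- by move=> k s _; rewrite lee_fin mulr_ge0.
apply: lime_le.
  by apply: is_cvg_nneseries => k _ _; apply: integral_ge0 => s _; rewrite lee_fin mulr_ge0.
apply: nearW => n.
apply: (@le_trans _ _ (\sum_(0 <= k < n) (2 * h `^ (- b) * t `^ (1 - b) * x ^+ k)%:E)%E).
  apply: lee_sum => k _.
  under eq_integral do rewrite EFinM.
  rewrite ge0_integralZl//; last 2 first.
  - apply/measurable_EFinP; apply: measurable_funTS.
    exact: (measurable_indic (mI k)).
  - by rewrite lee_fin.
  rewrite integral_indic//; last exact: mI.
  apply: (@le_trans _ _ ((a k)%:E * lebesgue_measure (I k))%E).
    rewrite lee_pmul2l ?lee_fin//; last by rewrite lte_fin powR_gt0.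
    apply: le_measure; rewrite ?inE; [|exact: mI|by move=> ? []].
    by apply: (@measurableI _ (measurableTypeR R)); [exact: mI|exact: measurable_itv].
  rewrite /I lebesgue_measure_itv/= lte_fin ltrD2l gtrN//.
  rewrite -EFinD -EFinM lee_fin le_eqVlt; apply/orP; left; apply/eqP.
  rewrite /a /x -(powR_mulrn k (powR_ge0 _ _)) -!powRrM.
  rewrite powRM ?exprn_ge0 ?ltW// -powR_mulrn ?ltW// -[h ^+ k]powR_mulrn ?ltW//.
  rewrite -powRrM !powR_expR//.
  have -> : c + expR (k%:R * ln h) * t - (c - expR (k%:R * ln h) * t) = 2 * expR (k%:R * ln h) * t by ring.
  rewrite -[X in _ * (_ * X)](lnK)//; set lh := ln h; set lt_ := ln t.
  rewrite [LHS]mulrC -!mulrA; congr (_ * _).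
  rewrite -!expRD; congr expR; rewrite -natr1; ring.
rewrite sumEFin lee_fin big_mkord -mulr_sumr -!mulrA.
rewrite !ler_pM2l ?powR_gt0// mulrC ler_pM2r ?powR_gt0//.
by apply: sum_geometric_le; rewrite ltW.
Qed.

Lemma measurable_integral_param d1 d2 (T1 : measurableType d1) (T2 : measurableType d2)
    (R : realType) (m : {sigma_finite_measure set T2 -> \bar R}) (f : T1 * T2 -> \bar R) :
  measurable_fun setT f -> (forall p, (0 <= f p)%E) ->
  measurable_fun setT (fun x => \int[m]_y f (x, y))%E.
Proof. by move=> mf f0; exact: measurable_fun_fubini_tonelli_F. Qed.

(** The image of Lebesgue measure under x -> s x, multiplied by s, gives each interval ]a, b] its
    length, so it is Lebesgue measure by uniqueness. *)
Lemma ge0_integral_scale1 (R : realType) (s : R) (f : R -> \bar R) : 0 < s ->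
  measurable_fun setT f -> (forall x, (0 <= f x)%E) ->
  (\int[lebesgue_measure]_(x in [set: measurableTypeR R]) f (s * x)%R =
   (s^-1)%:E * \int[lebesgue_measure]_(x in [set: measurableTypeR R]) f x)%E.
Proof.
move=> s0 mf f0.
pose phi (x : measurableTypeR R) : measurableTypeR R := s * x.
have ms : measurable_fun setT phi by exact: measurable_funM.
rewrite [LHS](_ : _ = \int[pushforward lebesgue_measure phi]_x f x)%E; last first.
  by rewrite ge0_integral_pushforward// preimage_setT.
have sV0 : 0 <= s^-1 by rewrite invr_ge0 ltW.
rewrite -(@ge0_integral_mscale _ _ _ lebesgue_measure _ measurableT (NngNum sV0) f)//.
apply: eq_measure_integral => //= A mA _.
rewrite /mscale/= /pushforward.
pose m := mscale (NngNum (ltW s0)) (pushforward lebesgue_measure phi).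
pose m0 := m ms.
rewrite [in RHS](_ : lebesgue_measure A = m0 A); last first.
  apply: lebesgue_measure_unique => // _ [[a b]] _ <-.
  change (lebesgue_measure `]a, b]%classic = s%:E * lebesgue_measure (phi @^-1` `]a, b]))%E.
  rewrite (_ : _ @^-1` _ = `]a / s, b / s]%classic); last first.
    apply/seteqP; split => x /=; by rewrite /phi !in_itv/= ltr_pdivrMr// ler_pdivlMr// (mulrC x).
  rewrite !lebesgue_measure_itv/= !lte_fin ltr_pM2r ?invr_gt0//.
  case: ifPn; last by rewrite mule0.
  by move=> _; rewrite -!EFinB -EFinM -mulrBl mulrC divfK ?gt_eqF.
rewrite (_ : m0 A = s%:E * lebesgue_measure (phi @^-1` A))%E//.
by rewrite muleA -EFinM mulVf ?gt_eqF// mul1e.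
Qed.

Lemma ge0_integral_escale (R : realType) n (s : R) (f : n.-tuple R -> \bar R) : 0 < s ->
  measurable_fun setT f -> (forall x, (0 <= f x)%E) ->
  (\int[lebesgueRn R n]_x f (escale s x) =
   (s ^- n)%:E * \int[lebesgueRn R n]_x f x)%E.
Proof.
move=> s0; elim: n f => [|n IHn] f mf f0.
  rewrite expr0 invr1 mul1e; apply: eq_integral => x _; congr f.
  by apply: eq_from_tnth => -[].
have ms k : measurable_fun setT (@escale R k s).
  apply/measurable_fun_tnthP => i; rewrite /escale.
  rewrite (_ : _ \o _ = (fun x : k.-tuple R => s * tnth x i)).
    by apply: measurable_funM => //; exact: measurable_tnth.
  by apply/funext => x /=; rewrite tnth_mktuple.
have mfc : measurable_fun setT (f \o @consRn R n).
  by apply: measurableT_comp => //; exact: measurable_consRn.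
rewrite integral_lebesgueRnS//; last first.
  exact: (measurableT_comp mf (ms _)).
rewrite integral_lebesgueRnS//.
have h a t : escale s (consRn (a, t)) = consRn (s * a, escale s t).
  apply: eq_from_tnth => i; rewrite tnth_mktuple.
  by case: (unliftP ord0 i) => [j|] ->; rewrite ?tnthS ?tnth0 ?tnth_mktuple.
under eq_integral => a _.
  under eq_integral do rewrite h.
  rewrite (IHn (fun t => f (consRn (s * a, t)))%R)//; last first.
    exact: (measurableT_comp mfc (pair1_measurable _)).
  over.
rewrite ge0_integralZl//; last 3 first.
- apply: (measurableT_comp (f := fun b => \int[lebesgueRn R n]_t f (consRn (b, t)))%E).
    exact: (@measurable_integral_param _ _ (measurableTypeR R) (n.-tuple R) R
      (lebesgueRn R n) (f \o @consRn R n) mfc (fun p => f0 _)).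
  exact: measurable_funM.
- by move=> a _; apply: integral_ge0.
- by rewrite lee_fin invr_ge0 exprn_ge0 ?ltW.
rewrite (@ge0_integral_scale1 _ s (fun a => \int[lebesgueRn R n]_t f (consRn (a, t))))%E//; last 2 first.
- exact: (@measurable_integral_param _ _ (measurableTypeR R) (n.-tuple R) R
      (lebesgueRn R n) (f \o @consRn R n) mfc (fun p => f0 _)).
- by move=> a; apply: integral_ge0.
by rewrite muleA -EFinM -invfM -exprSr.
Qed.

Lemma enorm_ge0 (R : realType) n (x : n.-tuple R) : 0 <= enorm x.
Proof. exact: sqrtr_ge0. Qed.

Lemma enorm_sqr (R : realType) n (x : n.-tuple R) : enorm x ^+ 2 = \sum_(i < n) tnth x i ^+ 2.
Proof. by rewrite sqr_sqrtr// sumr_ge0// => i _; rewrite sqr_ge0. Qed.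

Lemma enorm_esub_sqr (R : realType) n (x y : n.-tuple R) :
  enorm (esub x y) ^+ 2 = \sum_(i < n) (tnth x i - tnth y i) ^+ 2.
Proof. by rewrite enorm_sqr; apply: eq_bigr => i _; rewrite tnth_mktuple. Qed.

Lemma enorm_esubC (R : realType) n (x y : n.-tuple R) : enorm (esub x y) = enorm (esub y x).
Proof.
rewrite /enorm; congr Num.sqrt; apply: eq_bigr => i _.
by rewrite !tnth_mktuple -sqrrN opprB.
Qed.

Lemma enorm_escale (R : realType) n (s : R) (x : n.-tuple R) : 0 <= s ->
  enorm (escale s x) = s * enorm x.
Proof.
move=> s0; apply/eqP; rewrite -(@eqrXn2 _ 2) ?mulr_ge0 ?enorm_ge0//.
rewrite exprMn !enorm_sqr mulr_sumr; apply/eqP/eq_bigr => i _.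
by rewrite tnth_mktuple exprMn.
Qed.

Lemma enorm_tnth_le (R : realType) n (x : n.-tuple R) i : `|tnth x i| <= enorm x.
Proof.
rewrite -(@ler_pXn2r _ 2) ?nnegrE ?enorm_ge0// enorm_sqr real_normK ?num_real//.
by rewrite (bigD1 i)//= lerDl sumr_ge0// => j _; rewrite sqr_ge0.
Qed.

(** Coordinatewise, (x_i - 2 y_i)^2 >= 0 is x_i^2 <= 2 (x_i - y_i)^2 + 2 y_i^2. This serves in place
    of the triangle inequality, as constants do not matter. *)
Lemma enorm_le_max (R : realType) n (x y : n.-tuple R) :
  enorm x <= 2 * Num.max (enorm (esub x y)) (enorm y).
Proof.
set m := Num.max _ _.
have m0 : 0 <= m by rewrite le_max enorm_ge0.
rewrite -(@ler_pXn2r _ 2) ?nnegrE ?enorm_ge0 ?mulr_ge0//.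
have h1 : enorm (esub x y) ^+ 2 <= m ^+ 2.
  by rewrite ler_pXn2r ?nnegrE ?enorm_ge0// le_max lexx.
have h2 : enorm y ^+ 2 <= m ^+ 2.
  by rewrite ler_pXn2r ?nnegrE ?enorm_ge0// le_max lexx orbT.
apply: (@le_trans _ _ (2 * (enorm (esub x y) ^+ 2 + enorm y ^+ 2))); last by lra.
rewrite enorm_esub_sqr !enorm_sqr -big_split mulr_sumr ler_sum//= => i _.
have := sqr_ge0 (tnth x i - 2 * tnth y i); nra.
Qed.

Lemma enorm_powR_le (R : realType) n (nu : R) (x y : n.-tuple R) : 0 <= nu ->
  enorm x `^ nu <= 2 `^ nu * (enorm (esub x y) `^ nu + enorm y `^ nu).
Proof.
move=> nu0; apply: (@le_trans _ _ ((2 * Num.max (enorm (esub x y)) (enorm y)) `^ nu)).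
  by rewrite ge0_ler_powR// ?nnegrE ?mulr_ge0 ?enorm_ge0 ?enorm_le_max// le_max enorm_ge0.
rewrite powRM// ?le_max ?enorm_ge0// ler_pM2l ?powR_gt0//.
by rewrite maxEle; case: ifP => _; rewrite ?lerDr ?lerDl powR_ge0.
Qed.

Lemma measurable_enorm (R : realType) n : measurable_fun setT (@enorm R n).
Proof.
rewrite (_ : @enorm R n = (fun x => (\sum_(i < n) tnth x i ^+ 2) `^ 2^-1)); last first.
  by apply/funext => x; rewrite powR12_sqrt// sumr_ge0// => i _; rewrite sqr_ge0.
apply: (measurableT_comp (measurable_powR _)).
apply: measurable_sum => i; apply: measurable_funX; exact: measurable_tnth.
Qed.

Lemma measurable_escale (R : realType) n (s : R) : measurable_fun setT (@escale R n s).
Proof.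
apply/measurable_fun_tnthP => i.
rewrite (_ : _ \o _ = (fun x : n.-tuple R => s * tnth x i)).
  by apply: measurable_funM => //; exact: measurable_tnth.
by apply/funext => x /=; rewrite tnth_mktuple.
Qed.

Lemma measurable_esub (R : realType) n :
  measurable_fun setT (fun p : n.-tuple R * n.-tuple R => esub p.1 p.2).
Proof.
apply/measurable_fun_tnthP => i.
rewrite (_ : _ \o _ = (fun p : n.-tuple R * n.-tuple R => tnth p.1 i - tnth p.2 i)).
  apply: measurable_funB; apply: (measurableT_comp (measurable_tnth i)).
    exact: measurable_fst.
  exact: measurable_snd.
by apply/funext => x /=; rewrite tnth_mktuple.
Qed.

Lemma lebesgueRn_point (R : realType) n (x : n.-tuple R) : (0 < n)%N ->
  lebesgueRn R n [set x] = 0%E.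
Proof.
case: n x => // n x _.
rewrite (_ : [set x] = [set y | forall i, [set tnth x i] (tnth y i)]).
  rewrite (lebesgueRn_box (A := fun i => [set tnth x i]))// big_ord_recl lebesgue_measure_set1.
  by rewrite mul0e.
apply/seteqP; split => y /= => [->//|h]; exact: eq_from_tnth.
Qed.

Lemma enorm_eq0 (R : realType) n (x : n.-tuple R) : enorm x = 0 -> x = [tuple of nseq n 0].
Proof.
move=> x0; apply: eq_from_tnth => i.
have := enorm_tnth_le x i; rewrite x0 normr_le0 => /eqP ->.
by rewrite tnth_nseq.
Qed.

(** Identities such as |y|^{-gamma} |y|^gamma = 1 fail at the origin under the convention for powers
    of 0; this lemma makes them available almost everywhere. *)
Lemma ae_enorm_gt0 (R : realType) n : (0 < n)%N ->
  {ae lebesgueRn R n, forall x, 0 < enorm x}.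
Proof.
move=> n0; exists (@enorm R n @^-1` [set 0]); split.
- by rewrite -[X in measurable X]setTI; exact: measurable_enorm.
- rewrite -[RHS](lebesgueRn_point [tuple of nseq n (0 : R)] n0); congr (lebesgueRn R n _).
  apply/seteqP; split => [x /enorm_eq0//|x /= ->].
  rewrite /enorm big1 ?sqrtr0// => i _.
  by rewrite tnth_nseq expr0n.
by move=> x /= /negP; rewrite lt_neqAle enorm_ge0 andbT negbK => /eqP/esym.
Qed.

(** The integrand is a multiple of the normal density of mean m and variance 1/(2c). *)
Lemma integral_gauss (R : realType) (c m : R) : 0 < c ->
  (\int[lebesgue_measure]_(x in [set: measurableTypeR R]) (expR (- (c * (x - m) ^+ 2)))%:E
   = ((pi / c) `^ 2^-1)%:E)%E.
Proof.
move=> c0; pose s := Num.sqrt (2 * c)^-1.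
have c2 : 0 < (2 * c)^-1 by rewrite invr_gt0 mulr_gt0.
have s0 : s != 0 by rewrite gt_eqF// sqrtr_gt0.
have s2 : s ^+ 2 = (2 * c)^-1 by rewrite sqr_sqrtr// ltW.
have p0 : 0 < pi / c :> R by rewrite divr_gt0// pi_gt0.
have q0 : (pi / c) `^ 2^-1 != 0 :> R by rewrite gt_eqF// powR_gt0.
have h x : expR (- (c * (x - m) ^+ 2)) = (pi / c) `^ 2^-1 * normal_pdf m s x.
  rewrite normal_pdfE//= /normal_fun/= /normal_peak s2.
  rewrite powR12_sqrt ?ltW//.
  have -> : (2 * c)^-1 * pi *+ 2 = pi / c :> R by rewrite -mulr_natr; field; rewrite gt_eqF.
  rewrite mulVKf ?gt_eqF ?sqrtr_gt0//.
  congr expR; rewrite -mulr_natr; field; rewrite gt_eqF//.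
under eq_integral do rewrite h EFinM.
rewrite ge0_integralZl ?integral_normal_pdf ?mule1//.
- by apply/measurable_EFinP; exact: measurable_normal_pdf.
- by move=> x _; rewrite lee_fin normal_pdf_ge0.
- by rewrite lee_fin powR_ge0.
Qed.

Lemma expR_enorm_prod (R : realType) n (c : R) (x y : n.-tuple R) :
  expR (- (c * enorm (esub x y) ^+ 2)) =
  \prod_(i < n) expR (- (c * (tnth x i - tnth y i) ^+ 2)).
Proof. by rewrite enorm_esub_sqr mulr_sumr -sumrN expR_sum. Qed.

Lemma measurable_sqr_diff_exp (R : realType) (c m : R) :
  measurable_fun setT (fun x : R => expR (- (c * (x - m) ^+ 2))).
Proof.
apply: (measurableT_comp (@measurable_expR R)); apply: measurableT_comp => //.
apply: measurable_funM => //; apply: measurable_funX; exact: measurable_funB.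
Qed.

Lemma integral_gauss_Rn (R : realType) n (c : R) (y : n.-tuple R) : 0 < c ->
  (\int[lebesgueRn R n]_x (expR (- (c * enorm (esub x y) ^+ 2)))%:E
   = ((pi / c) `^ (n%:R / 2))%:E)%E.
Proof.
move=> c0; under eq_integral do rewrite expR_enorm_prod.
rewrite (lebesgueRn_prod (f := fun i z => expR (- (c * (z - tnth y i) ^+ 2)))); last 2 first.
- by move=> i; exact: measurable_sqr_diff_exp.
- by move=> i z; exact: expR_ge0.
under eq_bigr do rewrite integral_gauss//.
by rewrite prodEFin prodr_const card_ord -powR_mulrn ?powR_ge0// -powRrM [2^-1 * _]mulrC.
Qed.

Lemma measurable_gauss_esub (R : realType) n (c : R) :
  measurable_fun setT (fun p : n.-tuple R * n.-tuple R =>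
    expR (- (c * enorm (esub p.1 p.2) ^+ 2))).
Proof.
apply: (measurableT_comp (@measurable_expR R)); apply: measurableT_comp => //.
apply: measurable_funM => //; apply: measurable_funX.
exact: (measurableT_comp (@measurable_enorm R n) (@measurable_esub R n)).
Qed.

Lemma heat_kernelE (R : realType) n (t : R) (x : n.-tuple R) :
  heat_kernel t x = (4 * pi * t) `^ (- (n%:R / 2)) * expR (- ((4 * t)^-1 * enorm x ^+ 2)).
Proof. by rewrite /heat_kernel mulrC [_^-1 * _]mulrC mulrC. Qed.

Lemma heat_kernel_ge0 (R : realType) n (t : R) (x : n.-tuple R) : 0 <= heat_kernel t x.
Proof. by rewrite mulr_ge0 ?powR_ge0 ?expR_ge0. Qed.

Lemma heat_kernel_esubC (R : realType) n (t : R) (x y : n.-tuple R) :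
  heat_kernel t (esub x y) = heat_kernel t (esub y x).
Proof. by rewrite /heat_kernel enorm_esubC. Qed.

(** Completing the square in each coordinate leaves a one-dimensional Gaussian integral and the
    factor exp(-D (z_i - y_i)^2). The normalisations agree because pi/(A + B) = (4 pi a)(4 pi b) /
    (4 pi (a + b)). *)
Lemma heat_kernel_semigroup (R : realType) n (a b : R) (z y : n.-tuple R) : 0 < a -> 0 < b ->
  (\int[lebesgueRn R n]_x (heat_kernel a (esub z x) * heat_kernel b (esub x y))%:E
   = (heat_kernel (a + b) (esub z y))%:E)%E.
Proof.
move=> a0 b0; have ab0 : 0 < a + b by rewrite addr_gt0.
have p0 := @pi_gt0 R.
pose A := (4 * a)^-1; pose B := (4 * b)^-1.
have A0 : 0 < A by rewrite invr_gt0 mulr_gt0.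
have B0 : 0 < B by rewrite invr_gt0 mulr_gt0.
pose ka := (4 * pi * a) `^ (- (n%:R / 2)); pose kb := (4 * pi * b) `^ (- (n%:R / 2)).
have hk (x : n.-tuple R) : heat_kernel a (esub z x) * heat_kernel b (esub x y) =
  ka * kb * \prod_(i < n) (expR (- (A * (tnth x i - tnth z i) ^+ 2)) * expR (- (B * (tnth x i - tnth y i) ^+ 2))).
  rewrite heat_kernel_esubC !heat_kernelE big_split/= -!expR_enorm_prod /ka /kb; ring.
under eq_integral do rewrite hk EFinM.
have mf (i : 'I_n) : measurable_fun setT (fun u : R =>
   expR (- (A * (u - tnth z i) ^+ 2)) * expR (- (B * (u - tnth y i) ^+ 2))).
  by apply: measurable_funM; exact: measurable_sqr_diff_exp.
rewrite ge0_integralZl//; last 3 first.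
- apply/measurable_EFinP; apply: measurable_prod => i _.
  exact: (measurableT_comp (mf i) (measurable_tnth i)).
- by move=> x _; rewrite lee_fin prodr_ge0// => i _; rewrite mulr_ge0 ?expR_ge0.
- by rewrite lee_fin mulr_ge0 ?powR_ge0.
rewrite (lebesgueRn_prod (f := fun i u => expR (- (A * (u - tnth z i) ^+ 2)) * expR (- (B * (u - tnth y i) ^+ 2))))//.
pose D := (4 * (a + b))^-1.
have h1 (i : 'I_n) : (\int[lebesgue_measure]_(u in [set: measurableTypeR R])
   (expR (- (A * (u - tnth z i) ^+ 2)) * expR (- (B * (u - tnth y i) ^+ 2)))%:E =
   (expR (- (D * (tnth z i - tnth y i) ^+ 2)) * (pi / (A + B)) `^ 2^-1)%:E)%E.
  (* The minimiser of A (u - z_i)^2 + B (u - y_i)^2, namely (A z_i + B y_i) / (A + B). *)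
  pose m := (b * tnth z i + a * tnth y i) / (a + b).
  have e u : expR (- (A * (u - tnth z i) ^+ 2)) * expR (- (B * (u - tnth y i) ^+ 2)) =
    expR (- (D * (tnth z i - tnth y i) ^+ 2)) * expR (- ((A + B) * (u - m) ^+ 2)).
    rewrite -!expRD; congr expR; rewrite /A /B /D /m; field.
    by rewrite !gt_eqF.
  under eq_integral do rewrite e EFinM.
  rewrite ge0_integralZl//; last first.
    by apply/measurable_EFinP; exact: measurable_sqr_diff_exp.
  by rewrite integral_gauss ?addr_gt0.
under eq_bigr do rewrite h1.
rewrite prodEFin -EFinM; congr EFin.
rewrite big_split/= prodr_const card_ord -expR_enorm_prod heat_kernelE -/D mulrCA mulrC.
congr (_ * _).
rewrite -powR_mulrn ?powR_ge0// -powRrM [2^-1 * _]mulrC /ka /kb.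
have -> : pi / (A + B) = 4 * pi * a * (4 * pi * b) * (4 * pi * (a + b))^-1.
  by rewrite /A /B; field; do ?[apply/andP; split]; rewrite gt_eqF //; lra.
have k0 (u : R) : 0 < u -> 0 < 4 * pi * u by move=> u0; rewrite !mulr_gt0.
have := k0 _ a0; have := k0 _ b0; have := k0 _ ab0.
move: (4 * pi * a) (4 * pi * b) (4 * pi * (a + b)) => X Y Z Z0 Y0 X0.
rewrite !powRM ?mulr_ge0 ?invr_ge0 ?ltW// -(powR_inv1 (ltW Z0)) -powRrM mulN1r !powRN.
by field; rewrite !gt_eqF ?powR_gt0.
Qed.

(** Split at |s| = d. Inside, the Gaussian is at most 1 and the weight is integrable; outside, the
    weight is at most d^{-sigma} and the Gaussian has integral a constant times d. Neither bound
    depends on the centre m. *)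
Lemma weighted_gauss_bound1 (R : realType) (sigma c : R) : 0 <= sigma < 1 -> 0 < c ->
  exists2 C : R, 0 < C & forall d m : R, 0 < d ->
   (\int[lebesgue_measure]_(s in [set: measurableTypeR R])
      (`|s| `^ (- sigma) * expR (- (c / d ^+ 2 * (s - m) ^+ 2)))%:E
     <= (C * d `^ (1 - sigma))%:E)%E.
Proof.
move=> s01 c0; have /andP[s0 s1] := s01.
have [C C0 hC] := integral_powR_near s01.
have pc0 : 0 < pi / c by rewrite divr_gt0 ?pi_gt0.
exists (C + (pi / c) `^ 2^-1); first by rewrite addr_gt0 ?powR_gt0.
move=> d m d0.
have mabs : measurable_fun setT (fun s : R => `|s| `^ (- sigma)).
  by apply: (measurableT_comp (measurable_powR _)); exact: normr_measurable.
have mI : measurable (`[- d, d] : set R) by exact: measurable_itv.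
pose f1 (s : R) := `|s| `^ (- sigma) * \1_(`[- d, d]%classic : set R) s.
pose f2 (s : R) := d `^ (- sigma) * expR (- (c / d ^+ 2 * (s - m) ^+ 2)).
have mf1 : measurable_fun setT f1 by apply: measurable_funM.
have mf2 : measurable_fun setT f2.
  by apply: measurable_funM => //; exact: measurable_sqr_diff_exp.
have f10 s : 0 <= f1 s by rewrite mulr_ge0 ?powR_ge0.
have f20 s : 0 <= f2 s by rewrite mulr_ge0 ?powR_ge0 ?expR_ge0.
apply: (@le_trans _ _ (\int[lebesgue_measure]_(s in [set: measurableTypeR R]) ((f1 s)%:E + (f2 s)%:E)%E)%E).
  apply: ge0_le_integral => //.
  - by apply/measurable_EFinP; apply: measurable_funM => //; exact: measurable_sqr_diff_exp.
  - by apply: emeasurable_funD; apply/measurable_EFinP; [exact: mf1|exact: mf2].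
  move=> s _; rewrite -EFinD lee_fin /f1 /f2 indicE.
  have [sd|sd] := boolP (s \in `[- d, d]%classic).
    rewrite mulr1 -[leLHS]addr0 lerD ?f20// -[leRHS]mulr1 ler_wpM2l ?powR_ge0//.
    rewrite -expR0 ler_expR oppr_le0 mulr_ge0 ?sqr_ge0 ?divr_ge0 ?sqr_ge0//; exact: ltW.
  rewrite mulr0 add0r ler_wpM2r ?expR_ge0// ger_powRN//.
  move: sd; rewrite notin_setE/= in_itv/= => /negP; rewrite -ler_norml -ltNge; exact: ltW.
rewrite ge0_integralD//; last 4 first.
- by move=> s _; rewrite lee_fin.
- by apply/measurable_EFinP; exact: mf1.
- by move=> s _; rewrite lee_fin.
- by apply/measurable_EFinP; exact: mf2.
rewrite mulrDl EFinD leeD//.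
  have := hC 0 d d0; rewrite sub0r add0r; apply: le_trans.
  rewrite [leRHS]integral_mkcond le_eqVlt; apply/orP; left; apply/eqP.
  apply: eq_integral => s _; rewrite /f1 patchE indicE.
  by case: ifP => sd; rewrite ?mulr1 ?mulr0 ?subr0.
under eq_integral do rewrite /f2 EFinM.
rewrite ge0_integralZl//; last 2 first.
- by apply/measurable_EFinP; exact: measurable_sqr_diff_exp.
- by rewrite lee_fin powR_ge0.
rewrite integral_gauss ?divr_gt0 ?exprn_gt0// -EFinM lee_fin le_eqVlt; apply/orP; left; apply/eqP.
have -> : pi / (c / d ^+ 2) = pi / c * d ^+ 2 by field; rewrite !gt_eqF.
rewrite powRM ?ltW// ?exprn_gt0// -powR_mulrn ?ltW// -powRrM.
have -> : 2%:R * 2^-1 = 1 :> R by rewrite mulfV.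
rewrite mulrCA; congr (_ * _).
by rewrite -powRD; [rewrite addrC|rewrite (gt_eqF d0) implybT].
Qed.

Lemma ae_tnth_neq0 (R : realType) n :
  {ae lebesgueRn R n, forall x, forall i, tnth x i != 0}.
Proof.
pose P (k : nat) (x : n.-tuple R) := forall kn : (k < n)%N, tnth x (Ordinal kn) != 0.
have : {ae lebesgueRn R n, forall x, forall k, P k x}.
  apply: ae_foralln => k; have [kn|nk] := ltnP k n; last first.
    by apply: nearW => x kn; move: nk; rewrite leqNgt kn.
  pose A (i : 'I_n) : set R := if i == Ordinal kn then [set 0] else setT.
  exists [set x | forall i : 'I_n, A i (tnth x i)]; split.
  - rewrite (_ : mkset _ = (fun x => tnth x (Ordinal kn)) @^-1` [set (0 : R)]).
      by rewrite -[X in measurable X]setTI; exact: measurable_tnth.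
    apply/seteqP; split => x /=; first by move=> /(_ (Ordinal kn)); rewrite /A eqxx.
    by move=> x0 i; rewrite /A; case: ifPn => // /eqP ->.
  - apply: etrans (lebesgueRn_box (A := A) _) _; last first.
      by rewrite (bigD1 (Ordinal kn))//= /A eqxx lebesgue_measure_set1 mul0e.
    by move=> i; rewrite /A; case: ifP.
  move=> x /= /existsNP[kn' /negP]; rewrite negbK => /eqP xk i.
  rewrite /A; case: ifPn => // /eqP ->; rewrite /= -[RHS]xk; congr tnth; exact: val_inj.
by apply: filterS => x h i; have := h i (ltn_ord i); congr (tnth x _ != 0); exact: val_inj.
Qed.

(** The singularity is shared equally among the coordinates, using |y_i| <= |y|. The majorant is a
    product, and sigma < n makes each exponent sigma/n smaller than 1, hence locally integrable on
    the line. *)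
Lemma enorm_powRN_le (R : realType) n (sigma : R) (x : n.-tuple R) : (0 < n)%N -> 0 <= sigma ->
  (forall i, tnth x i != 0) ->
  enorm x `^ (- sigma) <= \prod_(i < n) `|tnth x i| `^ (- (sigma / n%:R)).
Proof.
move=> n0 s0 x0.
have -> : - sigma = - (sigma / n%:R) * n%:R.
  by rewrite mulNr divfK// pnatr_eq0 -lt0n.
rewrite powRrM powR_mulrn ?powR_ge0// -[X in _ ^+ X]card_ord -prodr_const.
apply: ler_prod => i _; rewrite powR_ge0 ger_powRN ?divr_ge0 ?normr_gt0//.
exact: enorm_tnth_le.
Qed.

Lemma weighted_gauss_bound (R : realType) n (sigma c : R) : (0 < n)%N -> 0 <= sigma < n%:R ->
  0 < c -> exists2 C : R, 0 < C & forall (d : R) (m : n.-tuple R), 0 < d ->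
   (\int[lebesgueRn R n]_y
      (enorm y `^ (- sigma) * expR (- (c / d ^+ 2 * enorm (esub y m) ^+ 2)))%:E
     <= (C * d `^ (n%:R - sigma))%:E)%E.
Proof.
move=> n0 /andP[s0 sn] c0.
have nR : 0 < n%:R :> R by rewrite ltr0n.
have s1 : 0 <= sigma / n%:R < 1 by rewrite divr_ge0//= ltr_pdivrMr// mul1r.
have [C C0 hC] := weighted_gauss_bound1 s1 c0.
exists (C ^+ n); first exact: exprn_gt0.
move=> d m d0.
have mF (i : 'I_n) : measurable_fun setT (fun s : R =>
    `|s| `^ (- (sigma / n%:R)) * expR (- (c / d ^+ 2 * (s - tnth m i) ^+ 2))).
  apply: measurable_funM; last exact: measurable_sqr_diff_exp.
  by apply: (measurableT_comp (measurable_powR _)); exact: normr_measurable.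
apply: (@le_trans _ _ (\int[lebesgueRn R n]_y
  (\prod_(i < n) (`|tnth y i| `^ (- (sigma / n%:R)) * expR (- (c / d ^+ 2 * (tnth y i - tnth m i) ^+ 2))))%:E)%E).
  apply: ae_ge0_le_integral => //.
  - by move=> y _; rewrite lee_fin mulr_ge0 ?powR_ge0 ?expR_ge0.
  - apply/measurable_EFinP; apply: measurable_funM.
      by apply: (measurableT_comp (measurable_powR _)); exact: measurable_enorm.
    exact: (measurableT_comp (@measurable_gauss_esub R n _) (pair2_measurable m)).
  - by move=> y _; rewrite lee_fin prodr_ge0// => i _; rewrite mulr_ge0 ?powR_ge0 ?expR_ge0.
  - apply/measurable_EFinP; apply: measurable_prod => i _.
    exact: (measurableT_comp (mF i) (measurable_tnth i)).
  apply: filterS (@ae_tnth_neq0 R n) => y y0 _.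
  rewrite lee_fin big_split/= -expR_enorm_prod ler_wpM2r ?expR_ge0//.
  exact: enorm_powRN_le.
rewrite (lebesgueRn_prod (f := fun i s => `|s| `^ (- (sigma / n%:R)) * expR (- (c / d ^+ 2 * (s - tnth m i) ^+ 2))))//; last first.
apply: (@le_trans _ _ (\prod_(i < n) (C * d `^ (1 - sigma / n%:R))%:E)%E).
  apply: (proj2 (andP _)).
  apply: (big_ind2 (fun x y => (0 <= x) && (x <= y))%E) => [|x1 x2 y1 y2|i _].
  - by rewrite lexx lee01.
  - by move=> /andP[? ?] /andP[? ?]; rewrite mule_ge0// lee_pmul.
  rewrite (hC d _ d0) andbT.
  by apply: integral_ge0 => s _; rewrite lee_fin mulr_ge0 ?powR_ge0 ?expR_ge0.
rewrite prodEFin prodr_const card_ord exprMn -[(_ `^ _) ^+ n]powR_mulrn ?powR_ge0// -powRrM.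
by rewrite mulrBl mul1r divfK ?gt_eqF.
Qed.

Lemma ge0_integralZ_EFin d (T : measurableType d) (R : realType)
    (m : {measure set T -> \bar R}) (D : set T) (k : R) (f : T -> R) : measurable D ->
  measurable_fun D f -> (forall x, D x -> 0 <= f x) -> 0 <= k ->
  (\int[m]_(x in D) (k * f x)%:E = k%:E * \int[m]_(x in D) (f x)%:E)%E.
Proof.
move=> mD mf f0 k0; under eq_integral do rewrite EFinM.
by rewrite ge0_integralZl//; exact/measurable_EFinP.
Qed.

Lemma ge0_integralD_EFin d (T : measurableType d) (R : realType)
    (m : {measure set T -> \bar R}) (D : set T) (f g : T -> R) : measurable D ->
  measurable_fun D f -> (forall x, D x -> 0 <= f x) ->
  measurable_fun D g -> (forall x, D x -> 0 <= g x) ->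
  (\int[m]_(x in D) (f x + g x)%:E = \int[m]_(x in D) (f x)%:E + \int[m]_(x in D) (g x)%:E)%E.
Proof.
move=> mD mf f0 mg g0; under eq_integral do rewrite EFinD.
rewrite ge0_integralD//.
- exact/measurable_EFinP.
- exact/measurable_EFinP.
Qed.

Lemma ge0_le_integral_EFin d (T : measurableType d) (R : realType)
    (m : {measure set T -> \bar R}) (D : set T) (f g : T -> R) : measurable D ->
  measurable_fun D f -> (forall x, D x -> 0 <= f x) ->
  measurable_fun D g -> (forall x, D x -> f x <= g x) ->
  (\int[m]_(x in D) (f x)%:E <= \int[m]_(x in D) (g x)%:E)%E.
Proof.
move=> mD mf f0 mg fg; apply: ge0_le_integral => //.
- exact/measurable_EFinP.
- exact/measurable_EFinP.
Qed.

(** With delta = theta/(a + 1), (delta u)^a <= exp(a delta u) <= exp(theta u). Dividing by a + 1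
    rather than by a allows a = 0. *)
Lemma powR_le_expR (R : realType) (a theta : R) : 0 <= a -> 0 < theta ->
  exists2 C : R, 0 < C & forall u : R, 0 <= u -> u `^ a <= C * expR (theta * u).
Proof.
move=> a0 t0; have a1 : 0 < a + 1 by rewrite ltr_wpDl.
pose delta := theta / (a + 1); have d0 : 0 < delta by rewrite divr_gt0.
exists (delta `^ (- a)); first by rewrite powR_gt0.
move=> u u0; rewrite powRN mulrC ler_pdivlMr ?powR_gt0// -powRM//; last exact: ltW.
have h : u * delta <= expR (u * delta).
  by apply: le_trans (expR_ge1Dx _); rewrite lerDr.
have ud0 : 0 <= u * delta by rewrite mulr_ge0// ltW.
apply: (@le_trans _ _ (expR (u * delta) `^ a)).
  by rewrite ge0_ler_powR// ?nnegrE ?expR_ge0.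
rewrite powR_expR ?expR_gt0// expRK ler_expR /delta.
have -> : a * (u * (theta / (a + 1))) = theta * u * (a / (a + 1)) by field; rewrite gt_eqF.
by rewrite ler_piMr ?mulr_ge0 ?(ltW t0)// ler_pdivrMr// mul1r lerDl.
Qed.

Lemma powR_add_le (R : realType) (a b p : R) : 0 <= a -> 0 <= b -> 0 <= p ->
  (a + b) `^ p <= 2 `^ p * (a `^ p + b `^ p).
Proof.
move=> a0 b0 p0; apply: (@le_trans _ _ ((2 * Num.max a b) `^ p)).
  rewrite ge0_ler_powR ?nnegrE ?addr_ge0 ?mulr_ge0 ?le_max ?a0//.
  by rewrite maxEle; case: ifPn => [?|]; [|rewrite -ltNge => /ltW ?]; lra.
rewrite powRM ?le_max ?a0// ler_pM2l ?powR_gt0//.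
by rewrite maxEle; case: ifP => _; rewrite ?lerDr ?lerDl powR_ge0.
Qed.

(** Half of the Gaussian exponent pays for the power: [powR_le_expR] is applied to u = (z/d)^2 with
    rate theta/2. *)
Lemma powR_gauss_le (R : realType) (nu theta : R) : 0 <= nu -> 0 < theta ->
  exists2 C : R, 0 < C & forall d z : R, 0 < d -> 0 <= z ->
    z `^ nu * expR (- (theta / d ^+ 2 * z ^+ 2)) <=
    C * d `^ nu * expR (- (theta / 2 / d ^+ 2 * z ^+ 2)).
Proof.
move=> nu0 t0.
have [C C0 hC] := @powR_le_expR R (nu / 2) (theta / 2) (divr_ge0 nu0 (ltW (ltr0Sn _ 1))) (divr_gt0 t0 (ltr0Sn _ 1)).
exists C => // d z d0 z0.
have zd0 : 0 <= z / d by rewrite divr_ge0// ltW.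
have := hC _ (sqr_ge0 (z / d)).
have -> : ((z / d) ^+ 2) `^ (nu / 2) = z `^ nu * d `^ (- nu).
  rewrite -powR_mulrn// -powRrM.
  have -> : 2%:R * (nu / 2) = nu by field.
  by rewrite powRM ?invr_ge0 ?(ltW d0)// -(powR_inv1 (ltW d0)) -powRrM mulN1r.
rewrite powRN ler_pdivrMr ?powR_gt0// => h.
have e1 : expR (- (theta / d ^+ 2 * z ^+ 2)) = expR (- (theta / 2 / d ^+ 2 * z ^+ 2)) * expR (- (theta / 2 * (z / d) ^+ 2)).
  by rewrite -expRD; congr expR; field; rewrite gt_eqF.
rewrite e1; apply: le_trans (ler_wpM2r _ h) _; first by rewrite mulr_ge0 ?expR_ge0.
rewrite le_eqVlt; apply/orP; left; apply/eqP.
set E := expR (theta / 2 * _); set G := expR (- (theta / 2 / _ * _)).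
have EE : E * expR (- (theta / 2 * (z / d) ^+ 2)) = 1 by rewrite -expRD addrN expR0.
move: EE; set F := expR (- (theta / 2 * _)) => EE.
by rewrite -[RHS]mulr1 -[X in _ = _ * X]EE; ring.
Qed.

(** An equality for y > 0; the inequality absorbs the values at y = 0. *)
Lemma powR_subexp_le (R : realType) (y nu mu : R) : 0 <= y -> 0 <= nu -> nu <= mu ->
  y `^ nu * y `^ (- mu) <= y `^ (- (mu - nu)).
Proof.
move=> y0 nu0 numu; have [->|yn] := eqVneq y 0.
  have [mu00|mu0] := eqVneq mu 0.
    have -> : nu = 0 by apply/eqP; rewrite eq_le nu0 andbT -mu00.
    by rewrite mu00 subrr !oppr0 powRr0 mulr1.
  by rewrite (@powR0 _ (- mu)) ?oppr_eq0// mulr0 powR_ge0.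
by rewrite -powRD ?yn ?implybT// opprB.
Qed.

(** The algebra of the next bound, with X = |x|^nu, Z = |x-y|^nu, Y = |y|^nu, M = |y|^{-mu}, W =
    |y|^{-(mu-nu)}, E the Gaussian and E2 the wider Gaussian left after Z has been absorbed. *)
Lemma split_kernel_le (R : realDomainType) (k X Z Y M W E E2 c : R) :
  0 <= k -> 0 <= M -> 0 <= E -> 0 <= W -> X <= k * (Z + Y) -> Z * E <= c * E2 -> Y * M <= W -> E <= E2 ->
  X * M * E <= k * ((c * M + W) * E2).
Proof.
move=> k0 M0 E0 W0 h1 h2 h3 h4.
apply: (@le_trans _ _ (k * (M * (Z * E) + Y * M * E))).
  have -> : k * (M * (Z * E) + Y * M * E) = k * (Z + Y) * M * E by ring.
  by rewrite !ler_wpM2r.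
rewrite ler_wpM2l//.
have -> : (c * M + W) * E2 = M * (c * E2) + W * E2 by ring.
apply: lerD; first exact: ler_wpM2l.
by apply: (@le_trans _ _ (W * E)); [exact: ler_wpM2r|exact: ler_wpM2l].
Qed.

(* |x|^nu is split as C (|x-y|^nu + |y|^nu): the first part is absorbed by the
   Gaussian, the second lowers the singularity at y = 0 to |y|^{-(mu-nu)}. *)
Lemma kernel_weighted_bound (R : realType) n (nu mu rho theta : R) : (0 < n)%N ->
  0 <= nu -> nu <= mu -> 0 < rho -> mu * rho < n%:R -> 0 < theta ->
  exists2 C : R, 0 < C & forall (d : R) (x : n.-tuple R), 0 < d ->
   (\int[lebesgueRn R n]_y
      ((enorm x `^ nu * enorm y `^ (- mu) * expR (- (theta / d ^+ 2 * enorm (esub x y) ^+ 2))) `^ rho)%:E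
     <= (C * d `^ ((nu - mu) * rho + n%:R))%:E)%E.
Proof.
move=> n0 nu0 numu rho0 mrn t0.
have mu0 : 0 <= mu := le_trans nu0 numu.
have [C1 C10 hC1] := powR_gauss_le nu0 t0.
have s1 : 0 <= mu * rho < n%:R by rewrite mrn mulr_ge0// ltW.
have s2 : 0 <= (mu - nu) * rho < n%:R.
  rewrite mulr_ge0 ?subr_ge0//=; last exact: ltW.
  by apply: le_lt_trans mrn; rewrite ler_pM2r// gerBl.
have c0 : 0 < rho * (theta / 2) by rewrite !mulr_gt0.
have [D1 D10 hD1] := weighted_gauss_bound n0 s1 c0.
have [D2 D20 hD2] := weighted_gauss_bound n0 s2 c0.
exists (2 `^ rho * (2 `^ nu) `^ rho * ((C1 `^ rho) * D1 + D2)).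
  by rewrite !mulr_gt0 ?powR_gt0// addr_gt0// mulr_gt0 ?powR_gt0.
move=> d x d0.
pose e y := expR (- (rho * (theta / 2) / d ^+ 2 * enorm (esub y x) ^+ 2)).
pose K := 2 `^ rho * (2 `^ nu) `^ rho : R.
have K0 : 0 < K by rewrite mulr_gt0 ?powR_gt0.
pose f1 (y : n.-tuple R) := K * (C1 * d `^ nu) `^ rho * (enorm y `^ (- (mu * rho)) * e y).
pose f2 (y : n.-tuple R) := K * (enorm y `^ (- ((mu - nu) * rho)) * e y).
have me : measurable_fun setT e.
  exact: (measurableT_comp (@measurable_gauss_esub R n _) (pair2_measurable x)).
have mp p : measurable_fun setT (fun y : n.-tuple R => enorm y `^ p).
  by apply: (measurableT_comp (measurable_powR _)); exact: measurable_enorm.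
have e0 y : 0 <= e y by exact: expR_ge0.
have mf1 : measurable_fun setT (fun y => enorm y `^ (- (mu * rho)) * e y) by exact: measurable_funM.
have mf2 : measurable_fun setT (fun y => enorm y `^ (- ((mu - nu) * rho)) * e y) by exact: measurable_funM.
have K1 : 0 <= K * (C1 * d `^ nu) `^ rho by rewrite mulr_ge0 ?powR_ge0// ltW.
apply: (@le_trans _ _ (\int[lebesgueRn R n]_y (f1 y + f2 y)%:E)%E).
  apply: ge0_le_integral_EFin => //.
  - apply: (measurableT_comp (measurable_powR _)).
    apply: measurable_funM; first by apply: measurable_funM.
    exact: (measurableT_comp (@measurable_gauss_esub R n _) (pair1_measurable x)).
  - by move=> y _; rewrite powR_ge0.
  - by apply: measurable_funD; apply: measurable_funM.
  move=> y _.
  pose ey := expR (- (theta / 2 / d ^+ 2 * enorm (esub x y) ^+ 2)).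
  have ey0 : 0 <= ey by exact: expR_ge0.
  have eye : ey `^ rho = e y.
    rewrite /e /ey powR_expR ?expR_gt0// expRK enorm_esubC; congr expR.
    by field; rewrite gt_eqF.
  have c1 : 0 <= C1 * d `^ nu by rewrite mulr_ge0 ?powR_ge0// ltW.
  have b1 : 0 <= C1 * d `^ nu * enorm y `^ (- mu) by rewrite mulr_ge0 ?powR_ge0.
  have b2 : 0 <= enorm y `^ (- (mu - nu)) by exact: powR_ge0.
  have rho0' := ltW rho0.
  apply: (@le_trans _ _ ((2 `^ nu * ((C1 * d `^ nu * enorm y `^ (- mu) + enorm y `^ (- (mu - nu))) * ey)) `^ rho)).
    rewrite ge0_ler_powR// ?nnegrE.
    - by rewrite !mulr_ge0 ?powR_ge0 ?expR_ge0.
    - by rewrite !mulr_ge0 ?powR_ge0 ?addr_ge0.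
    apply: (@split_kernel_le _ _ _ (enorm (esub x y) `^ nu) (enorm y `^ nu)); rewrite ?powR_ge0 ?expR_ge0//.
    - exact: enorm_powR_le.
    - by apply: hC1 => //; exact: enorm_ge0.
    - by apply: powR_subexp_le => //; exact: enorm_ge0.
    rewrite ler_expR lerN2 ler_wpM2r ?sqr_ge0// ler_wpM2r ?invr_ge0 ?sqr_ge0//.
    by rewrite ler_pdivrMr// ler_peMr ?ler1n ?ltW.
  rewrite !powRM ?powR_ge0 ?mulr_ge0 ?addr_ge0//.
  rewrite eye /f1 /f2 /K.
  have := powR_add_le b1 b2 rho0'; rewrite (powRM _ c1) ?powR_ge0//.
  rewrite -!powRrM !mulNr; set u := (_ + _) `^ rho => h.
  have := ler_wpM2l (powR_ge0 2 (nu * rho)) (ler_wpM2r (e0 y) h).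
  move=> {}h; apply: (le_trans h); rewrite le_eqVlt; apply/orP; left; apply/eqP; ring.
have g1 y : 0 <= enorm y `^ (- (mu * rho)) * e y by rewrite mulr_ge0 ?powR_ge0.
have g2 y : 0 <= enorm y `^ (- ((mu - nu) * rho)) * e y by rewrite mulr_ge0 ?powR_ge0.
rewrite ge0_integralD_EFin//; first last.
- by move=> y _; rewrite mulr_ge0 ?(ltW K0).
- by apply: measurable_funM.
- by move=> y _; rewrite mulr_ge0.
- by apply: measurable_funM.
rewrite !ge0_integralZ_EFin ?(ltW K0)//.
apply: (@le_trans _ _ ((K * (C1 * d `^ nu) `^ rho)%:E * (D1 * d `^ (n%:R - mu * rho))%:E + K%:E * (D2 * d `^ (n%:R - (mu - nu) * rho))%:E)%E).
  by apply: leeD; apply: lee_wpmul2l; rewrite ?lee_fin ?(ltW K0)//; [exact: hD1|exact: hD2].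
rewrite -!EFinM -EFinD lee_fin le_eqVlt; apply/orP; left; apply/eqP.
rewrite /K powRM ?(ltW C10) ?powR_ge0// -[(d `^ nu) `^ rho]powRrM.
have -> : (nu - mu) * rho + n%:R = nu * rho + (n%:R - mu * rho) by ring.
have -> : n%:R - (mu - nu) * rho = nu * rho + (n%:R - mu * rho) by ring.
rewrite !powRD ?(gt_eqF d0) ?implybT//.
ring.
Qed.

(** * Heat estimates in weighted Lebesgue spaces *)

Lemma le_poweR (R : realType) (x y : \bar R) (r : R) : (0 <= r)%R -> (0 <= x)%E -> (x <= y)%E ->
  (x `^ r <= y `^ r)%E.
Proof.
move=> r0 x0 xy; apply: gt0_ler_poweR => //; rewrite in_itv/= leey andbT//.
exact: le_trans xy.
Qed.

Lemma ge0_Lnorm_EFin d (T : measurableType d) (R : realType)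
    (m : {measure set T -> \bar R}) (f : T -> R) (p : R) : (forall x, 0 <= f x) -> 0 < p ->
  'N[m]_p%:E[EFin \o f]%E = ((\int[m]_x (f x `^ p)%:E) `^ p^-1)%E.
Proof.
move=> f0 p0; rewrite unlock; congr (_ `^ _)%E.
by apply: eq_integral => x _; rewrite /= ger0_norm.
Qed.

Lemma hoelder_bound d (T : measurableType d) (R : realType)
    (m : {measure set T -> \bar R}) (f g : T -> R) (p q A B : R) :
  measurable_fun setT f -> measurable_fun setT g ->
  (forall x, 0 <= f x) -> (forall x, 0 <= g x) -> 0 < p -> 0 < q -> p^-1 + q^-1 = 1 ->
  0 <= A -> 0 <= B ->
  (\int[m]_x (f x `^ p)%:E <= A%:E)%E -> (\int[m]_x (g x `^ q)%:E <= B%:E)%E ->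
  (\int[m]_x (f x * g x)%:E <= (A `^ p^-1 * B `^ q^-1)%:E)%E.
Proof.
move=> mf mg f0 g0 p0 q0 pq A0 B0 hA hB.
have := hoelder m mf mg p0 q0 pq.
rewrite Lnorm1 !ge0_Lnorm_EFin// => h.
apply: (@le_trans _ _ (\int[m]_x `|(EFin \o (f \* g)%R) x|)%E).
  by rewrite le_eqVlt; apply/orP; left; apply/eqP/eq_integral => x _; rewrite /= ger0_norm ?mulr_ge0.
apply: (le_trans h); rewrite EFinM -!poweR_EFin; apply: lee_pmul.
- exact: poweR_ge0.
- exact: poweR_ge0.
- apply: le_poweR => //; first by rewrite invr_ge0 ltW.
  by apply: integral_ge0 => x _; rewrite lee_fin powR_ge0.
- apply: le_poweR => //; first by rewrite invr_ge0 ltW.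
  by apply: integral_ge0 => x _; rewrite lee_fin powR_ge0.
Qed.

Lemma Lnorm_le_integral d (T : measurableType d) (R : realType)
    (m : {measure set T -> \bar R}) (f : T -> R) (p b : R) : (forall x, 0 <= f x) -> 0 < p -> 0 <= b ->
  ('N[m]_p%:E[EFin \o f] <= b%:E)%E <-> (\int[m]_x (f x `^ p)%:E <= (b `^ p)%:E)%E.
Proof.
move=> f0 p0 b0; rewrite ge0_Lnorm_EFin//.
set I := (\int[m]_x _)%E.
have I0 : (0 <= I)%E by apply: integral_ge0 => x _; rewrite lee_fin powR_ge0.
have pn0 : p != 0 by rewrite gt_eqF.
split => h.
  rewrite -[I]poweRe1// -(mulVf pn0) poweRrM -poweR_EFin.
  by apply: le_poweR => //; rewrite ?(ltW p0)// poweR_ge0.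
rewrite -[X in X%:E](powRr1 b0) -(mulfV pn0) powRrM -poweR_EFin.
by apply: le_poweR => //; rewrite ?invr_ge0 ?(ltW p0).
Qed.

Lemma Lnorm_oo_le d (T : measurableType d) (R : realType)
    (m : {measure set T -> \bar R}) (f : T -> R) (b : R) : (forall x, 0 <= f x) -> 0 <= b ->
  ('N[m]_+oo[EFin \o f] <= b%:E)%E <-> {ae m, forall x, f x <= b}.
Proof.
move=> f0 b0; rewrite unlock; case: ifPn => m0; split.
- move/ess_supP; apply: filterS => x; rewrite /= ger0_norm//.
- by move=> h; apply/ess_supP; apply: filterS h => x; rewrite /= ger0_norm// lee_fin.
(* When the whole space has measure 0 the norm is 0 by definition, and the exceptional null set may
   be the whole space. *)
- move=> _; exists setT; split => //.
  by apply/eqP; rewrite eq_le measure_ge0 andbT leNgt.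
- by rewrite lee_fin.
Qed.

(** Time is written d^2 so that every bound is a power of the length d. In Hoelder's inequality one
    Gaussian factor goes with the weights and the other stays with the function, where it later
    permits an integration in x. *)
Lemma heat_kernel_split (R : realType) n (d : R) (z : n.-tuple R) : 0 < d ->
  heat_kernel (d ^+ 2) z = (4 * pi) `^ (- (n%:R / 2)) * d `^ (- n%:R) *
    (expR (- (8^-1 / d ^+ 2 * enorm z ^+ 2)) * expR (- (8^-1 / d ^+ 2 * enorm z ^+ 2))).
Proof.
move=> d0; have p0 := @pi_gt0 R.
rewrite heat_kernelE; congr (_ * _).
  have q0 : 0 <= 4 * pi :> R by rewrite mulr_ge0 ?(ltW p0).
  rewrite (powRM _ q0) ?sqr_ge0//; congr (_ * _).
  rewrite -powR_mulrn ?(ltW d0)// -powRrM; congr (_ `^ _).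
  by rewrite mulrN mulrCA mulfV ?mulr1.
by rewrite -expRD; congr expR; field; rewrite gt_eqF.
Qed.

Lemma measurable_heat_kernel (R : realType) n (t : R) :
  measurable_fun setT (fun p : n.-tuple R * n.-tuple R => heat_kernel t (esub p.1 p.2)).
Proof.
apply: (eq_measurable_fun (fun p : n.-tuple R * n.-tuple R =>
  (4 * pi * t) `^ (- (n%:R / 2)) * expR (- ((4 * t)^-1 * enorm (esub p.1 p.2) ^+ 2)))).
  by move=> p _; rewrite heat_kernelE.
by apply: measurable_funM => //; exact: measurable_gauss_esub.
Qed.

Lemma measurable_enorm_powR (R : realType) n (p : R) :
  measurable_fun setT (fun y : n.-tuple R => enorm y `^ p).
Proof. exact: (measurableT_comp (measurable_powR p) (@measurable_enorm R n)). Qed.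

(** Hoelder in y with exponents p and rho = (1 - 1/p)^{-1}; the assumption on mu says exactly mu rho
    < n, so |y|^{-mu} is locally in L^rho. The hypothesis keeps a Gaussian beside h, so that A may
    depend on x. *)
Lemma weighted_heat_Lp (R : realType) n (nu mu p : R) : (0 < n)%N ->
  0 <= nu -> nu <= mu -> 1 < p -> mu < n%:R * (1 - p^-1) ->
  exists2 C : R, 0 < C & forall (d A : R) (x : n.-tuple R) (h : n.-tuple R -> R), 0 < d ->
    measurable_fun setT h -> (forall y, 0 <= h y) -> 0 <= A ->
    (\int[lebesgueRn R n]_y
       ((expR (- (8^-1 / d ^+ 2 * enorm (esub x y) ^+ 2)) * h y) `^ p)%:E <= A%:E)%E ->
    (\int[lebesgueRn R n]_y
       (enorm x `^ nu * (heat_kernel (d ^+ 2) (esub x y) * (enorm y `^ (- mu) * h y)))%:E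
     <= (C * d `^ (nu - mu - n%:R / p) * A `^ p^-1)%:E)%E.
Proof.
move=> n0 nu0 numu p1 mun.
have p0 : 0 < p by apply: lt_trans p1.
have ip : 0 < 1 - p^-1 by rewrite subr_gt0 invf_lt1.
pose rho := (1 - p^-1)^-1.
have rho0 : 0 < rho by rewrite invr_gt0.
have mr : mu * rho < n%:R by rewrite ltr_pdivrMr.
have e80 : 0 < 8^-1 :> R by rewrite invr_gt0.
have [C C0 hC] := kernel_weighted_bound n0 nu0 numu rho0 mr e80.
pose k : R := (4 * pi) `^ (- (n%:R / 2)).
have k0 : 0 < k by rewrite powR_gt0// mulr_gt0// pi_gt0.
exists (k * C `^ (1 - p^-1)); first by apply: mulr_gt0 => //; exact: powR_gt0.
move=> d A x h d0 mh h0 A0 hA.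
pose E y := expR (- (8^-1 / d ^+ 2 * enorm (esub x y) ^+ 2)).
have mE : measurable_fun setT E.
  exact: (measurableT_comp (@measurable_gauss_esub R n _) (pair1_measurable x)).
pose f y := enorm x `^ nu * enorm y `^ (- mu) * E y.
have mf : measurable_fun setT f.
  by apply: measurable_funM => //; apply: measurable_funM => //; exact: measurable_enorm_powR.
have mg : measurable_fun setT (fun y => E y * h y) by exact: measurable_funM.
have f0 y : 0 <= f y by rewrite !mulr_ge0 ?powR_ge0 ?expR_ge0.
have g0 y : 0 <= E y * h y by rewrite mulr_ge0 ?expR_ge0.
have kd0 : 0 <= k * d `^ (- n%:R) by rewrite mulr_ge0 ?powR_ge0// ltW.
have -> : (\int[lebesgueRn R n]_y
     (enorm x `^ nu * (heat_kernel (d ^+ 2) (esub x y) * (enorm y `^ (- mu) * h y)))%:E =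
   \int[lebesgueRn R n]_y (k * d `^ (- n%:R) * (f y * (E y * h y)))%:E)%E.
  by apply: eq_integral => y _; congr EFin; rewrite heat_kernel_split// -/k /f /E; ring.
rewrite ge0_integralZ_EFin//; last 2 first.
- exact: measurable_funM.
- by move=> y _; rewrite mulr_ge0.
have Cd0 : 0 <= C * d `^ ((nu - mu) * rho + n%:R) by rewrite mulr_ge0 ?powR_ge0// ltW.
have pq : rho^-1 + p^-1 = 1 by rewrite /rho invrK subrK.
have := hoelder_bound mf mg f0 g0 rho0 p0 pq Cd0 A0 (hC d x d0) hA.
move=> /(lee_wpmul2l (x := (k * d `^ (- n%:R))%:E)); rewrite lee_fin => /(_ kd0) /le_trans; apply.
rewrite -EFinM lee_fin le_eqVlt; apply/orP; left; apply/eqP.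
have ew : ((nu - mu) * rho + n%:R) * (1 - p^-1) = nu - mu + n%:R * (1 - p^-1).
  by rewrite mulrDl /rho mulfVK// gt_eqF.
rewrite {2}/rho invrK powRM ?powR_ge0 ?(ltW C0)// -powRrM ew.
have -> : nu - mu - n%:R / p = - n%:R + (nu - mu + n%:R * (1 - p^-1)) by ring.
rewrite (@powRD _ d (- n%:R)) ?(gt_eqF d0) ?implybT//; ring.
Qed.

Lemma weighted_heat_Loo (R : realType) n (nu mu : R) : (0 < n)%N ->
  0 <= nu -> nu <= mu -> mu < n%:R ->
  exists2 C : R, 0 < C & forall (d M : R) (x : n.-tuple R) (h : n.-tuple R -> R), 0 < d ->
    measurable_fun setT h -> (forall y, 0 <= h y) -> 0 <= M ->
    {ae lebesgueRn R n, forall y, h y <= M} ->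
    (\int[lebesgueRn R n]_y
       (enorm x `^ nu * (heat_kernel (d ^+ 2) (esub x y) * (enorm y `^ (- mu) * h y)))%:E
     <= (C * d `^ (nu - mu) * M)%:E)%E.
Proof.
move=> n0 nu0 numu mun.
have mr : mu * 1 < n%:R by rewrite mulr1.
have e80 : 0 < 4^-1 :> R by rewrite invr_gt0.
have [C C0 hC] := kernel_weighted_bound n0 nu0 numu ltr01 mr e80.
pose k : R := (4 * pi) `^ (- (n%:R / 2)).
have k0 : 0 < k by rewrite powR_gt0// mulr_gt0// pi_gt0.
exists (k * C); first by rewrite mulr_gt0.
move=> d M x h d0 mh h0 M0 hM.
pose E y := expR (- (4^-1 / d ^+ 2 * enorm (esub x y) ^+ 2)).
have mE : measurable_fun setT E.
  exact: (measurableT_comp (@measurable_gauss_esub R n _) (pair1_measurable x)).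
pose f y := enorm x `^ nu * enorm y `^ (- mu) * E y.
have mf : measurable_fun setT f.
  by apply: measurable_funM => //; apply: measurable_funM => //; exact: measurable_enorm_powR.
have f0 y : 0 <= f y by rewrite !mulr_ge0 ?powR_ge0 ?expR_ge0.
have kd0 : 0 <= k * d `^ (- n%:R) * M by rewrite !mulr_ge0 ?powR_ge0// ltW.
have hk y : heat_kernel (d ^+ 2) (esub x y) = k * d `^ (- n%:R) * E y.
  by rewrite heat_kernel_split// -/k -expRD; congr (_ * expR _); field; rewrite gt_eqF.
apply: (@le_trans _ _ (\int[lebesgueRn R n]_y (k * d `^ (- n%:R) * M * f y)%:E)%E).
  apply: ae_ge0_le_integral => //.
  - by move=> y _; rewrite lee_fin !mulr_ge0 ?powR_ge0 ?heat_kernel_ge0.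
  - apply/measurable_EFinP; apply: measurable_funM => //; apply: measurable_funM.
      exact: (measurableT_comp (@measurable_heat_kernel R n _) (pair1_measurable x)).
    by apply: measurable_funM => //; exact: measurable_enorm_powR.
  - by move=> y _; rewrite lee_fin mulr_ge0.
  - by apply/measurable_EFinP; exact: measurable_funM.
  apply: filterS hM => y hy _; rewrite lee_fin hk.
  have -> : enorm x `^ nu * (k * d `^ (- n%:R) * E y * (enorm y `^ (- mu) * h y)) =
    k * d `^ (- n%:R) * f y * h y by rewrite /f; ring.
  rewrite [leRHS]mulrAC; apply: ler_wpM2l => //.
  by rewrite mulr_ge0// mulr_ge0 ?powR_ge0// ltW.
rewrite ge0_integralZ_EFin//.
have hf : (\int[lebesgueRn R n]_y (f y)%:E <= (C * d `^ ((nu - mu) * 1 + n%:R))%:E)%E.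
  apply: le_trans (hC d x d0); rewrite le_eqVlt; apply/orP; left; apply/eqP/eq_integral => y _.
  by rewrite (powRr1 (f0 y)).
move: hf =>  /(lee_wpmul2l (x := (k * d `^ (- n%:R) * M)%:E)); rewrite lee_fin => /(_ kd0) /le_trans; apply.
rewrite -EFinM lee_fin mulr1 le_eqVlt; apply/orP; left; apply/eqP.
have -> : d `^ (nu - mu + n%:R) = d `^ (nu - mu) * d `^ n%:R.
  by rewrite powRD// (gt_eqF d0) implybT.
have dd : d `^ (- n%:R) * d `^ n%:R = 1 by rewrite powRN mulVf// gt_eqF// powR_gt0.
by rewrite -[RHS]mulr1 -[X in _ = _ * X]dd; ring.
Qed.

Definition wabs (R : realType) n (gamma : R) (f : n.-tuple R -> R) (y : n.-tuple R) : R :=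
  enorm y `^ gamma * `|f y|.

Lemma wabs_ge0 (R : realType) n (gamma : R) (f : n.-tuple R -> R) y : 0 <= wabs gamma f y.
Proof. by rewrite mulr_ge0 ?powR_ge0. Qed.

Lemma measurable_wabs (R : realType) n (gamma : R) (f : n.-tuple R -> R) :
  measurable_fun setT f -> measurable_fun setT (wabs gamma f).
Proof.
move=> mf; apply: measurable_funM; first exact: measurable_enorm_powR.
exact: measurableT_comp.
Qed.

Lemma Lwnorm_wabs (R : realType) n (q : \bar R) (gamma : R) (f : n.-tuple R -> R) :
  Lwnorm q gamma f = 'N[lebesgueRn R n]_q[EFin \o wabs gamma f]%E.
Proof.
rewrite /Lwnorm -[LHS]Lnorm_abse; congr Lnorm; apply/funext => y /=.
by rewrite /wabs normrM ger0_norm ?powR_ge0.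
Qed.

Lemma Lw_measurable (R : realType) n (q : \bar R) (gamma : R) (f : n.-tuple R -> R) :
  Lw q gamma f -> measurable_fun setT f.
Proof. by case. Qed.

Lemma Lw_norm_lty (R : realType) n (q : \bar R) (gamma : R) (f : n.-tuple R -> R) :
  Lw q gamma f -> (Lwnorm q gamma f < +oo)%E.
Proof. by case=> _; rewrite inE => /andP[_]; rewrite inE. Qed.

Lemma Lwnorm_fin (R : realType) n (q : \bar R) (gamma : R) (f : n.-tuple R -> R) :
  Lw q gamma f -> exists2 M : R, 0 <= M & ('N[lebesgueRn R n]_q[EFin \o wabs gamma f] <= M%:E)%E.
Proof.
move=> /Lw_norm_lty; rewrite Lwnorm_wabs => h.
exists (fine 'N[lebesgueRn R n]_q[EFin \o wabs gamma f]%E); first by rewrite fine_ge0// Lnorm_ge0.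
by rewrite fineK// ge0_fin_numE// Lnorm_ge0.
Qed.

Lemma wabsK (R : realType) n (gamma : R) (f : n.-tuple R -> R) y : 0 < enorm y ->
  enorm y `^ (- gamma) * wabs gamma f y = `|f y|.
Proof.
move=> y0; rewrite /wabs mulrA -powRD; first by rewrite addNr powRr0 mul1r.
by rewrite (gt_eqF y0) implybT.
Qed.

(** The condition q > n/(n - gamma) means gamma < n (1 - 1/q): |y|^{-gamma} times a Gaussian lies in
    the dual of L^q. The lemma gives finiteness both for the initial data and for the tested mass at
    time T/2. *)
Lemma heat_Lw_lty (R : realType) n (q : \bar R) (gamma tau : R) (f : n.-tuple R -> R) (x : n.-tuple R) :
  (0 < n)%N -> 0 <= gamma < n%:R -> ((n%:R / (n%:R - gamma))%:E < q)%E -> 0 < tau ->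
  Lw q gamma f ->
  (\int[lebesgueRn R n]_y (heat_kernel tau (esub x y) * `|f y|)%:E < +oo)%E.
Proof.
move=> n0 /andP[g0 gn] hq t0 Lf.
have mf := Lw_measurable Lf.
have [M M0 hM] := Lwnorm_fin Lf.
have ng : 0 < n%:R - gamma by rewrite subr_gt0.
have d0 : 0 < Num.sqrt tau by rewrite sqrtr_gt0.
have dt : (Num.sqrt tau) ^+ 2 = tau by rewrite sqr_sqrtr// ltW.
have mw := measurable_wabs gamma mf.
have mk : measurable_fun setT (fun y => heat_kernel tau (esub x y)).
  exact: (measurableT_comp (@measurable_heat_kernel R n _) (pair1_measurable x)).
suff [B hB] : exists B, (\int[lebesgueRn R n]_y (enorm x `^ 0 * (heat_kernel tau (esub x y) *
    (enorm y `^ (- gamma) * wabs gamma f y)))%:E <= B%:E)%E.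
  apply: le_lt_trans (ltry B); apply: le_trans hB.
  apply: ae_ge0_le_integral => //.
  - by move=> y _; rewrite lee_fin mulr_ge0 ?heat_kernel_ge0.
  - by apply/measurable_EFinP; apply: measurable_funM => //; exact: measurableT_comp.
  - by move=> y _; rewrite lee_fin powRr0 mul1r !mulr_ge0 ?heat_kernel_ge0 ?powR_ge0.
  - apply/measurable_EFinP; apply: measurable_funM => //; apply: measurable_funM => //.
    by apply: measurable_funM => //; exact: measurable_enorm_powR.
  apply: filterS (@ae_enorm_gt0 R n n0) => y y0 _.
  by rewrite lee_fin powRr0 mul1r wabsK.
rewrite -dt; case: q hq Lf hM => [q|_ Lf|//].
- rewrite lte_fin => hq Lf hM.
  have n1 : 1 <= n%:R / (n%:R - gamma) by rewrite ler_pdivlMr// mul1r gerBl.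
  have q1 : 1 < q := le_lt_trans n1 hq.
  have q0 : 0 < q := lt_trans ltr01 q1.
  have gq : gamma < n%:R * (1 - q^-1).
    move: hq; rewrite ltr_pdivrMr// => hq.
    rewrite mulrBr mulr1 ltrBrDr -ltrBrDl.
    by rewrite ltr_pdivrMr// mulrC.
  have [C C0 hC] := weighted_heat_Lp n0 (lexx 0) g0 q1 gq.
  exists (C * Num.sqrt tau `^ (0 - gamma - n%:R / q) * (M `^ q) `^ q^-1).
  apply: hC => //; first by move=> y; exact: wabs_ge0.
    exact: powR_ge0.
  have mE : measurable_fun setT (fun y : n.-tuple R =>
      expR (- (8^-1 / Num.sqrt tau ^+ 2 * enorm (esub x y) ^+ 2))).
    exact: (measurableT_comp (@measurable_gauss_esub R n _) (pair1_measurable x)).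
  have wg0 y : 0 <= wabs gamma f y by exact: wabs_ge0.
  have E0 y : 0 <= expR (- (8^-1 / Num.sqrt tau ^+ 2 * enorm (esub x y) ^+ 2)) by exact: expR_ge0.
  move: hM => /(Lnorm_le_integral _ wg0 q0 M0); apply: le_trans.
  apply: ge0_le_integral_EFin => //.
  - apply: (measurableT_comp (measurable_powR _)); exact: measurable_funM.
  - by move=> y _; exact: powR_ge0.
  - exact: (measurableT_comp (measurable_powR _) mw).
  move=> y _; apply: ge0_ler_powR; rewrite ?nnegrE.
  - exact: ltW.
  - exact: (mulr_ge0 (E0 y) (wg0 y)).
  - exact: wg0.
  rewrite ler_piMl// -expR0 ler_expR oppr_le0 mulr_ge0 ?sqr_ge0// divr_ge0 ?sqr_ge0//.
move=> /(Lnorm_oo_le _ (fun y => wabs_ge0 _ _ y) M0) hM.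
have [C C0 hC] := weighted_heat_Loo n0 (lexx 0) g0 gn.
exists (C * Num.sqrt tau `^ (0 - gamma) * M).
by apply: hC => //; move=> y; exact: wabs_ge0.
Qed.

(** * The Volterra inequality in L^r_nu *)

Lemma measurable_invr (R : realType) : measurable_fun setT (fun x : R => x^-1).
Proof.
apply: (eq_measurable_fun (fun x : R => if x < 0 then - ((- x) `^ (-1)) else x `^ (-1))).
  move=> x _; case: ifPn => x0; first by rewrite powR_inv1 ?oppr_ge0 ?(ltW x0)// invrN opprK.
  by rewrite powR_inv1// leNgt.
apply: measurable_fun_ifT.
- exact: measurable_fun_ltr.
- apply: measurableT_comp => //.
  by apply: (measurableT_comp (measurable_powR _)).
- exact: measurable_powR.
Qed.

Lemma measurable_fun_esub d (T : measurableType d) (R : realType) n (f g : T -> n.-tuple R) :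
  measurable_fun setT f -> measurable_fun setT g -> measurable_fun setT (fun p => esub (f p) (g p)).
Proof.
move=> mf mg; apply/measurable_fun_tnthP => i.
rewrite (_ : _ \o _ = (fun p => tnth (f p) i - tnth (g p) i)).
  by apply: measurable_funB; apply: (measurableT_comp (measurable_tnth i)).
by apply/funext => x /=; rewrite tnth_mktuple.
Qed.

Lemma measurable_heat_kernel_time (R : realType) n (t : R) :
  measurable_fun setT (fun p : (measurableTypeR R * n.-tuple R) * n.-tuple R =>
    heat_kernel (t - p.1.1) (esub p.1.2 p.2)).
Proof.
have m1 : measurable_fun setT (fun p : (measurableTypeR R * n.-tuple R) * n.-tuple R => t - p.1.1 : R).
  apply: measurable_funB => //.
  exact: (measurableT_comp measurable_fst measurable_fst).
have m2 : measurable_fun setT (fun p : (measurableTypeR R * n.-tuple R) * n.-tuple R =>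
    esub p.1.2 p.2).
  apply: measurable_fun_esub.
    exact: (measurableT_comp measurable_snd measurable_fst).
  exact: measurable_snd.
apply: measurable_funM.
  apply: (measurableT_comp (measurable_powR _)); exact: measurable_funM.
apply: (measurableT_comp (@measurable_expR R)); apply: measurableT_comp => //.
apply: measurable_funM.
  by apply: measurable_funX; exact: (measurableT_comp (@measurable_enorm R n)).
by apply: (measurableT_comp (@measurable_invr R)); exact: measurable_funM.
Qed.

(** A form of Minkowski's integral inequality. With q conjugate to r, Hoelder in s applied to e =
    k^{1/q} (e k^{-1/q}) gives h^r <= J^{r-1} \int e^r k^{-(r-1)} ds. Tonelli and the bound (D k)^r
    on \int e^r dx leave D^r J^{r-1} \int k ds. The factor k^{1/q} k^{-1/q} may be inserted because
    e vanishes where k does. *)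
Lemma minkowski_time d (T : measurableType d) (R : realType)
    (m : {sigma_finite_measure set T -> \bar R}) (e : measurableTypeR R * T -> R)
    (k : R -> R) (h : T -> R) (r D J : R) :
  1 < r -> 0 < J -> 0 <= D ->
  measurable_fun setT e -> (forall p, 0 <= e p) ->
  measurable_fun setT k -> (forall s, 0 <= k s) -> (forall s x, k s = 0 -> e (s, x) = 0) ->
  measurable_fun setT h -> (forall x, 0 <= h x) ->
  (\int[lebesgue_measure]_(s in [set: measurableTypeR R]) (k s)%:E <= J%:E)%E ->
  (forall s, (\int[m]_x (e (s, x) `^ r)%:E <= ((D * k s) `^ r)%:E)%E) ->
  {ae m, forall x, ((h x)%:E <= \int[lebesgue_measure]_(s in [set: measurableTypeR R]) (e (s, x))%:E)%E} ->
  (\int[m]_x (h x `^ r)%:E <= ((D * J) `^ r)%:E)%E.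
Proof.
move=> r1 J0 D0 me e0 mk k0 ke mh h0 hJ he hh.
have r0 : 0 < r := lt_trans ltr01 r1.
pose q := (1 - r^-1)^-1.
have ir : 0 < 1 - r^-1 by rewrite subr_gt0 invf_lt1.
have q0 : 0 < q by rewrite invr_gt0.
have qr : q^-1 + r^-1 = 1 by rewrite invrK subrK.
have mk' : measurable_fun setT (k : measurableTypeR R -> R) by exact: mk.
have meg : measurable_fun setT (fun p : measurableTypeR R * T => e p * k p.1 `^ (- q^-1)).
  apply: measurable_funM => //; apply: (measurableT_comp (measurable_powR _)).
  exact: (measurableT_comp mk' measurable_fst).
pose G x := (\int[lebesgue_measure]_(s in [set: measurableTypeR R]) ((e (s, x) * k s `^ (- q^-1)) `^ r)%:E)%E.
have megr : measurable_fun setT (fun p : T * measurableTypeR R => ((e (p.2, p.1) * k p.2 `^ (- q^-1)) `^ r)%:E).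
  apply/measurable_EFinP; apply: (measurableT_comp (measurable_powR _)).
  apply: (measurableT_comp meg (g := fun p : T * measurableTypeR R => (p.2, p.1))).
  exact: measurable_swap.
have G0 x : (0 <= G x)%E by apply: integral_ge0 => s _; rewrite lee_fin powR_ge0.
have mG : measurable_fun setT G.
  by apply: (@measurable_integral_param _ _ T (measurableTypeR R) R lebesgue_measure _ megr) => p;
    rewrite lee_fin powR_ge0.
have kpow s : k s `^ q^-1 * (k s `^ (- q^-1)) = 1 \/ k s = 0.
  have [->|ks] := eqVneq (k s) 0; [by right|left].
  by rewrite powRN mulfV// gt_eqF// powR_gt0// lt_neqAle eq_sym ks k0.
have key : {ae m, forall x, ((h x `^ r)%:E <= (J `^ (r - 1))%:E * G x)%E}.
  apply: filterS hh => x hx.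
  have Jr0 : 0 < J `^ (r - 1) by rewrite powR_gt0.
  have [Goo|Gfin] := eqVneq (G x) +oo%E.
    by rewrite Goo gt0_muley ?leey// lte_fin.
  have Gf : G x \is a fin_num by rewrite ge0_fin_numE// lt_neqAle leey andbT.
  have := @hoelder_bound _ (measurableTypeR R) R lebesgue_measure (fun s => k s `^ q^-1)
    (fun s => e (s, x) * k s `^ (- q^-1)) q r J (fine (G x)).
  have mkq p : measurable_fun setT (fun s : measurableTypeR R => k s `^ p).
    exact: (measurableT_comp (measurable_powR _) mk').
  have mex : measurable_fun setT (fun s : measurableTypeR R => e (s, x)).
    exact: (measurableT_comp me (pair2_measurable x)).
  move=> /(_ (mkq _) (measurable_funM mex (mkq _)) (fun s => powR_ge0 _ _)).
  move=> /(_ (fun s => mulr_ge0 (e0 _) (powR_ge0 _ _)) q0 r0 qr (ltW J0) (fine_ge0 (G0 x))).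
  rewrite fineK//.
  have -> : (\int[lebesgue_measure]_x0 ((k x0 `^ q^-1) `^ q)%:E =
      \int[lebesgue_measure]_(s in [set: measurableTypeR R]) (k s)%:E)%E.
    by apply: eq_integral => s _; rewrite -powRrM mulVf ?gt_eqF// powRr1.
  move=> /(_ hJ (lexx _)).
  have -> : (\int[lebesgue_measure]_x0 (k x0 `^ q^-1 * (e (x0, x) * k x0 `^ (- q^-1)))%:E =
     \int[lebesgue_measure]_(s in [set: measurableTypeR R]) (e (s, x))%:E)%E.
    apply: eq_integral => s _; rewrite mulrCA.
    by have [->|ks] := kpow s; [rewrite mulr1|rewrite (ke s x ks) mul0r].
  move=> /(le_trans hx); rewrite lee_fin => {}hx.
  rewrite -[G x]fineK// -EFinM lee_fin.
  apply: le_trans (ge0_ler_powR (ltW r0) _ _ hx) _; rewrite ?nnegrE ?h0// ?mulr_ge0 ?powR_ge0//.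
  rewrite powRM ?powR_ge0// -!powRrM mulVf ?gt_eqF// (powRr1 (fine_ge0 (G0 x))).
  by rewrite /q invrK mulrBl mul1r mulVf ?gt_eqF.
apply: (@le_trans _ _ (\int[m]_x ((J `^ (r - 1))%:E * G x))%E).
  apply: ae_ge0_le_integral => //.
  - by move=> x _; rewrite lee_fin powR_ge0.
  - by apply/measurable_EFinP; exact: (measurableT_comp (measurable_powR _) mh).
  - by move=> x _; rewrite mule_ge0// lee_fin powR_ge0.
  - by apply: emeasurable_funM.
  by apply: filterS key => x + _; exact.
rewrite ge0_integralZl ?lee_fin ?powR_ge0//.
have -> : (\int[m]_x G x = \int[lebesgue_measure]_(s in [set: measurableTypeR R])
   \int[m]_x ((e (s, x) * k s `^ (- q^-1)) `^ r)%:E)%E.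
  apply: (@fubini_tonelli _ _ T (measurableTypeR R) R m lebesgue_measure _ megr) => p.
  by rewrite lee_fin powR_ge0.
apply: (@le_trans _ _ ((J `^ (r - 1))%:E * \int[lebesgue_measure]_(s in [set: measurableTypeR R]) (D `^ r * k s)%:E)%E).
  apply: lee_wpmul2l; first by rewrite lee_fin powR_ge0.
  apply: ge0_le_integral => //.
  - by move=> s _; apply: integral_ge0 => x _; rewrite lee_fin powR_ge0.
  - apply: (@measurable_integral_param _ _ (measurableTypeR R) T R m (fun p : measurableTypeR R * T =>
       ((e p * k p.1 `^ (- q^-1)) `^ r)%:E)).
      by apply/measurable_EFinP; exact: (measurableT_comp (measurable_powR _) meg).
    by move=> p; rewrite lee_fin powR_ge0.
  - by apply/measurable_EFinP; apply: measurable_funM.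
  move=> s _.
  have mes : measurable_fun setT (fun x => e (s, x)) by exact: (measurableT_comp me (pair1_measurable s)).
  under eq_integral do rewrite powRM ?powR_ge0// mulrC.
  rewrite ge0_integralZ_EFin//; [|exact: (measurableT_comp (measurable_powR _) mes)|by move=> x _; exact: powR_ge0|exact: powR_ge0].
  apply: le_trans (lee_wpmul2l _ (he s)) _; first by rewrite lee_fin powR_ge0.
  rewrite -EFinM lee_fin powRM// -powRrM.
  have [ks|ks] := eqVneq (k s) 0.
    by rewrite ks (@powR0 _ r) ?gt_eqF// !mulr0.
  rewrite mulrCA ler_wpM2l ?powR_ge0// -powRD ?ks ?implybT//.
  by rewrite /q invrK mulNr mulrBl mul1r mulVf ?gt_eqF// opprB addrC addrCA subrr addr0 powRr1.
rewrite ge0_integralZ_EFin ?powR_ge0//.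
apply: (@le_trans _ _ ((J `^ (r - 1))%:E * ((D `^ r)%:E * J%:E))%E).
  by rewrite !lee_wpmul2l ?lee_fin ?powR_ge0.
rewrite -!EFinM lee_fin powRM ?(ltW J0)// mulrCA [_ * J]mulrC.
by rewrite mulr_powRB1 ?(ltW J0).
Qed.

(* With mu = nu (alpha+1) - l and g = |.|^nu u, this is
   |x|^nu e^{tau Delta}(|.|^l u^{alpha+1})(x). *)
Definition wheat (R : realType) n (nu mu alpha tau : R) (g : n.-tuple R -> R) (x : n.-tuple R) : \bar R :=
  (\int[lebesgueRn R n]_y (enorm x `^ nu * (heat_kernel tau (esub x y) *
     (enorm y `^ (- mu) * g y `^ (alpha + 1))))%:E)%E.

Lemma wheat_ge0 (R : realType) n (nu mu alpha tau : R) (g : n.-tuple R -> R) (x : n.-tuple R) :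
  (0 <= wheat nu mu alpha tau g x)%E.
Proof. by apply: integral_ge0 => y _; rewrite lee_fin !mulr_ge0 ?powR_ge0 ?heat_kernel_ge0. Qed.

Lemma measurable_wheat_integrand (R : realType) n (nu mu alpha tau : R) (g : n.-tuple R -> R) :
  measurable_fun setT g ->
  measurable_fun setT (fun p : n.-tuple R * n.-tuple R => enorm p.1 `^ nu * (heat_kernel tau (esub p.1 p.2) *
     (enorm p.2 `^ (- mu) * g p.2 `^ (alpha + 1)))).
Proof.
move=> mg; apply: measurable_funM.
  exact: (measurableT_comp (measurable_enorm_powR _) measurable_fst).
apply: measurable_funM; first exact: measurable_heat_kernel.
apply: measurable_funM.
  exact: (measurableT_comp (measurable_enorm_powR _) measurable_snd).
apply: (measurableT_comp (measurable_powR _)).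
exact: (measurableT_comp mg measurable_snd).
Qed.

Lemma measurable_wheat (R : realType) n (nu mu alpha tau : R) (g : n.-tuple R -> R) :
  measurable_fun setT g -> measurable_fun setT (wheat nu mu alpha tau g).
Proof.
move=> mg; apply: (@measurable_integral_param _ _ (n.-tuple R) (n.-tuple R) R (lebesgueRn R n)
  (fun p => (enorm p.1 `^ nu * (heat_kernel tau (esub p.1 p.2) *
     (enorm p.2 `^ (- mu) * g p.2 `^ (alpha + 1))))%:E)).
  by apply/measurable_EFinP; exact: measurable_wheat_integrand.
by move=> p; rewrite lee_fin !mulr_ge0 ?powR_ge0 ?heat_kernel_ge0.
Qed.

Lemma integral_gauss_convolution (R : realType) n (c : R) (f : n.-tuple R -> R) : 0 < c ->
  measurable_fun setT f -> (forall y, 0 <= f y) ->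
  (\int[lebesgueRn R n]_x \int[lebesgueRn R n]_y (expR (- (c * enorm (esub x y) ^+ 2)) * f y)%:E =
   ((pi / c) `^ (n%:R / 2))%:E * \int[lebesgueRn R n]_y (f y)%:E)%E.
Proof.
move=> c0 mf f0.
rewrite (@fubini_tonelli _ _ _ _ _ (lebesgueRn R n) (lebesgueRn R n)
  (fun p => (expR (- (c * enorm (esub p.1 p.2) ^+ 2)) * f p.2)%:E))/=; last 2 first.
- apply/measurable_EFinP; apply: measurable_funM; first exact: measurable_gauss_esub.
  exact: (measurableT_comp mf measurable_snd).
- by move=> p; rewrite lee_fin mulr_ge0 ?expR_ge0.
rewrite -ge0_integralZl//; last 3 first.
- exact/measurable_EFinP.
- by move=> y _; rewrite lee_fin.
- by rewrite lee_fin powR_ge0.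
apply: eq_integral => y _.
under eq_integral do rewrite mulrC.
rewrite ge0_integralZ_EFin//; first by rewrite integral_gauss_Rn// muleC.
  exact: (measurableT_comp (@measurable_gauss_esub R n _) (pair2_measurable y)).
Qed.

(* Hoelder in y leaves a factor Q(x) = \int exp(-c|x-y|^2/d^2) g(y)^r dy, which is at
   most M^r pointwise and whose integral in x is d^n M^r up to a constant. *)
Lemma wheat_Lr (R : realType) n (nu mu alpha r : R) : (0 < n)%N -> 0 < alpha ->
  0 <= nu -> nu <= mu -> alpha + 1 < r -> mu < n%:R * (1 - (alpha + 1) / r) ->
  exists2 C : R, 0 < C & forall (d M : R) (g : n.-tuple R -> R), 0 < d -> 0 <= M ->
    measurable_fun setT g -> (forall y, 0 <= g y) ->
    (\int[lebesgueRn R n]_y (g y `^ r)%:E <= (M `^ r)%:E)%E ->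
    (forall x, wheat nu mu alpha (d ^+ 2) g x < +oo)%E /\
    (\int[lebesgueRn R n]_x (fine (wheat nu mu alpha (d ^+ 2) g x) `^ r)%:E <=
      ((C * d `^ (nu - mu - n%:R * alpha / r) * M `^ (alpha + 1)) `^ r)%:E)%E.
Proof.
move=> n0 a0 nu0 numu ar mun.
have a1 : 0 < alpha + 1 by rewrite addr_gt0.
have r0 : 0 < r := lt_trans a1 ar.
pose p := r / (alpha + 1).
have p1 : 1 < p by rewrite ltr_pdivlMr// mul1r.
have p0 : 0 < p := lt_trans ltr01 p1.
have pV : p^-1 = (alpha + 1) / r by rewrite invf_div.
have mup : mu < n%:R * (1 - p^-1) by rewrite pV.
have [C0 C00 hC0] := weighted_heat_Lp n0 nu0 numu p1 mup.
pose c : R := (pi * 8 / p) `^ (n%:R / 2).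
have c0 : 0 < c by rewrite powR_gt0// divr_gt0// mulr_gt0// pi_gt0.
have cE : c = (pi * 8 / p) `^ (n%:R / 2) by [].
clearbody c; exists (C0 * c `^ r^-1); first by rewrite mulr_gt0// powR_gt0.
move=> d M g d0 M0 mg g0 hM.
pose th := p * (8^-1 / d ^+ 2).
have th0 : 0 < th by rewrite mulr_gt0// divr_gt0// exprn_gt0.
pose E (x y : n.-tuple R) := expR (- (th * enorm (esub x y) ^+ 2)).
have E0 x y : 0 <= E x y by exact: expR_ge0.
have E1 x y : E x y <= 1.
  by rewrite -expR0 ler_expR oppr_le0 mulr_ge0 ?sqr_ge0// ltW.
have mgr : measurable_fun setT (fun y => g y `^ r) by exact: (measurableT_comp (measurable_powR _) mg).
have mE : measurable_fun setT (fun q : n.-tuple R * n.-tuple R => E q.1 q.2).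
  exact: measurable_gauss_esub.
pose Q x := (\int[lebesgueRn R n]_y (E x y * g y `^ r)%:E)%E.
have Q0 x : (0 <= Q x)%E by apply: integral_ge0 => y _; rewrite lee_fin mulr_ge0 ?powR_ge0.
have QM x : (Q x <= (M `^ r)%:E)%E.
  apply: le_trans hM; apply: ge0_le_integral_EFin => //.
  - by apply: measurable_funM => //; exact: (measurableT_comp mE (pair1_measurable x)).
  - by move=> y _; rewrite mulr_ge0 ?powR_ge0.
  - by move=> y _; rewrite ler_piMl ?powR_ge0.
have Qf x : Q x \is a fin_num by rewrite ge0_fin_numE//; exact: le_lt_trans (QM x) (ltry _).
have fQ0 x : 0 <= fine (Q x) by exact: fine_ge0.
have fQM x : fine (Q x) <= M `^ r by rewrite -lee_fin fineK.
have mQ : measurable_fun setT Q.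
  apply: (@measurable_integral_param _ _ (n.-tuple R) (n.-tuple R) R (lebesgueRn R n)
    (fun q => (E q.1 q.2 * g q.2 `^ r)%:E)).
    apply/measurable_EFinP; apply: measurable_funM => //.
    exact: (measurableT_comp mgr measurable_snd).
  by move=> q; rewrite lee_fin mulr_ge0 ?powR_ge0.
have W x : (wheat nu mu alpha (d ^+ 2) g x <= (C0 * d `^ (nu - mu - n%:R / p) * fine (Q x) `^ p^-1)%:E)%E.
  apply: hC0 => //.
  - exact: (measurableT_comp (measurable_powR _) mg).
  - by move=> y; exact: powR_ge0.
  rewrite fineK// le_eqVlt; apply/orP; left; apply/eqP/eq_integral => y _.
  congr EFin; rewrite powRM ?powR_ge0 ?expR_ge0// powR_expR ?expR_gt0// expRK -powRrM.
  congr (expR _ * _ `^ _); first by rewrite /th; ring.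
  by rewrite /p mulrCA mulfV ?mulr1// gt_eqF.
have Wf x : (wheat nu mu alpha (d ^+ 2) g x < +oo)%E := le_lt_trans (W x) (ltry _).
split=> //.
(* As r/p = alpha + 1, the r-th power of the bound [W] contains Q^{alpha+1}. Estimating Q^alpha by
   (M^r)^alpha leaves a single power of Q, which can be integrated in x. *)
pose K := (C0 * d `^ (nu - mu - n%:R / p)) `^ r * (M `^ r) `^ alpha.
have K0 : 0 <= K by rewrite mulr_ge0 ?powR_ge0.
have Cd0 : 0 <= C0 * d `^ (nu - mu - n%:R / p) by rewrite mulr_ge0 ?powR_ge0// ltW.
apply: (@le_trans _ _ (\int[lebesgueRn R n]_x (K%:E * Q x))%E).
  apply: ge0_le_integral => //.
  - by move=> x _; rewrite lee_fin powR_ge0.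
  - apply/measurable_EFinP; apply: (measurableT_comp (measurable_powR _)).
    by apply: measurableT_comp => //; exact: measurable_wheat.
  - exact: emeasurable_funM.
  move=> x _; rewrite -[Q x]fineK// -EFinM lee_fin.
  have Wx : fine (wheat nu mu alpha (d ^+ 2) g x) <= C0 * d `^ (nu - mu - n%:R / p) * fine (Q x) `^ p^-1.
    by rewrite -lee_fin fineK ?W// ge0_fin_numE ?wheat_ge0.
  apply: le_trans (ge0_ler_powR (ltW r0) _ _ Wx) _; rewrite ?nnegrE ?fine_ge0 ?wheat_ge0//.
    by rewrite mulr_ge0 ?powR_ge0.
  rewrite powRM ?powR_ge0// /K -mulrA ler_wpM2l ?powR_ge0// -powRrM pV divfK ?gt_eqF//.
  have [q0|q0] := eqVneq (fine (Q x)) 0.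
    by rewrite q0 mulr0 powR0// gt_eqF.
  rewrite powRD; last by rewrite q0 implybT.
  rewrite powRr1// ler_wpM2r// ge0_ler_powR ?nnegrE ?powR_ge0// ltW//.
rewrite ge0_integralZl//.
rewrite integral_gauss_convolution//; last by move=> y; exact: powR_ge0.
apply: (@le_trans _ _ (K%:E * (((pi / th) `^ (n%:R / 2))%:E * (M `^ r)%:E))%E).
  by rewrite !lee_wpmul2l ?lee_fin ?powR_ge0.
rewrite -!EFinM lee_fin le_eqVlt; apply/orP; left; apply/eqP.
have -> : pi / th = pi * 8 / p * d ^+ 2.
  by rewrite /th; field; rewrite !gt_eqF.
have p80 : 0 <= pi * 8 / p by rewrite !mulr_ge0 ?invr_ge0 ?(ltW p0)// ltW// pi_gt0.
rewrite (powRM _ p80) ?sqr_ge0// -cE.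
have e1 : K = C0 `^ r * d `^ ((nu - mu - n%:R / p) * r) * M `^ (r * alpha).
  by rewrite /K (powRM _ (ltW C00)) ?powR_ge0// -!powRrM.
have h1 : 0 <= C0 * c `^ r^-1 by rewrite mulr_ge0 ?powR_ge0// ltW.
have h2 : 0 <= C0 * c `^ r^-1 * d `^ (nu - mu - n%:R * alpha / r) by rewrite mulr_ge0 ?powR_ge0.
have e2 : (C0 * c `^ r^-1 * d `^ (nu - mu - n%:R * alpha / r) * M `^ (alpha + 1)) `^ r =
    C0 `^ r * c * d `^ ((nu - mu - n%:R * alpha / r) * r) * M `^ ((alpha + 1) * r).
  rewrite (powRM _ h2) ?powR_ge0// (powRM _ h1) ?powR_ge0// (powRM _ (ltW C00)) ?powR_ge0// -!powRrM.
  by rewrite mulVf ?gt_eqF// (powRr1 (ltW c0)).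
rewrite e1 e2 -[d ^+ 2]powR_mulrn ?(ltW d0)// -[(d `^ 2%:R) `^ _]powRrM.
have dd : d `^ ((nu - mu - n%:R * alpha / r) * r) = d `^ ((nu - mu - n%:R / p) * r) * d `^ (2 * (n%:R / 2)).
  rewrite -powRD; last by rewrite (gt_eqF d0) implybT.
  congr (_ `^ _); rewrite pV; field; rewrite gt_eqF//.
rewrite dd.
have [->|Mn] := eqVneq M 0; first last.
  have -> : M `^ ((alpha + 1) * r) = M `^ (r * alpha) * M `^ r.
    by rewrite -powRD ?Mn ?implybT//; congr (_ `^ _); ring.
  ring.
by rewrite (@powR0 _ r) ?gt_eqF// (@powR0 _ ((alpha + 1) * r)) ?mulf_neq0 ?gt_eqF// !mulr0.
Qed.

Lemma wheat_Loo (R : realType) n (nu mu alpha : R) : (0 < n)%N -> 0 < alpha ->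
  0 <= nu -> nu <= mu -> mu < n%:R ->
  exists2 C : R, 0 < C & forall (d M : R) (g : n.-tuple R -> R), 0 < d -> 0 <= M ->
    measurable_fun setT g -> (forall y, 0 <= g y) ->
    {ae lebesgueRn R n, forall y, g y <= M} ->
    (forall x, wheat nu mu alpha (d ^+ 2) g x <= (C * d `^ (nu - mu) * M `^ (alpha + 1))%:E)%E.
Proof.
move=> n0 a0 nu0 numu mun.
have [C C0 hC] := weighted_heat_Loo n0 nu0 numu mun.
exists C => // d M g d0 M0 mg g0 hM x; apply: hC => //; rewrite ?powR_ge0//.
- exact: (measurableT_comp (measurable_powR _) mg).
- by move=> y; exact: powR_ge0.
apply: filterS hM => y gM; by rewrite ge0_ler_powR ?nnegrE// addr_ge0// ltW.
Qed.

Lemma measurable_itv_test (R : realType) (a b : R) :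
  measurable_fun setT (fun s : R => a < s < b).
Proof. by apply: measurable_and; exact: measurable_fun_ltr. Qed.

(** The factor (t - s)^{-a} is the smoothing rate of the weighted heat semigroup, and s^{-b} comes
    from raising a bound s^{-beta} to the power alpha + 1. The lower limit t0 lets the Volterra
    argument restart from a later time. *)
Definition time_kernel (R : realType) (a b t0 t : R) (s : R) : R :=
  if t0 < s < t then (t - s) `^ (- a) * s `^ (- b) else 0.

Lemma time_kernel_ge0 (R : realType) (a b t0 t s : R) : 0 <= time_kernel a b t0 t s.
Proof. by rewrite /time_kernel; case: ifP => // _; rewrite mulr_ge0 ?powR_ge0. Qed.

Lemma measurable_time_kernel (R : realType) (a b t0 t : R) :
  measurable_fun setT (time_kernel a b t0 t).
Proof.
apply: measurable_fun_ifT => //; first exact: measurable_itv_test.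
apply: measurable_funM; last exact: measurable_powR.
by apply: (measurableT_comp (measurable_powR _)); exact: measurable_funB.
Qed.

Lemma measurable_wheat_time (R : realType) n (nu mu alpha t : R) (g : measurableTypeR R * n.-tuple R -> R) :
  measurable_fun setT g ->
  measurable_fun setT (fun p : measurableTypeR R * n.-tuple R =>
    wheat nu mu alpha (t - p.1) (fun y => g (p.1, y)) p.2).
Proof.
move=> mg.
apply: (@measurable_integral_param _ _ (measurableTypeR R * n.-tuple R)%type (n.-tuple R) R (lebesgueRn R n)
  (fun q => (enorm q.1.2 `^ nu * (heat_kernel (t - q.1.1) (esub q.1.2 q.2) *
     (enorm q.2 `^ (- mu) * g (q.1.1, q.2) `^ (alpha + 1))))%:E)); last first.
  by move=> p; rewrite lee_fin !mulr_ge0 ?powR_ge0 ?heat_kernel_ge0.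
apply/measurable_EFinP; apply: measurable_funM.
  apply: (measurableT_comp (measurable_enorm_powR _)).
  exact: (measurableT_comp measurable_snd measurable_fst).
apply: measurable_funM; first exact: measurable_heat_kernel_time.
apply: measurable_funM.
  exact: (measurableT_comp (measurable_enorm_powR _) measurable_snd).
apply: (measurableT_comp (measurable_powR _)); apply: (measurableT_comp mg).
apply/measurable_fun_pairP; split.
  exact: (measurableT_comp measurable_fst measurable_fst).
exact: measurable_snd.
Qed.

(** For d = sqrt(t - s) the bound d^{nu - mu - n alpha/r} on [wheat] is (t - s)^{-a} with a = (mu -
    nu)/2 + n alpha/(2r). For r infinite it is integrated pointwise in x; for finite r it goes
    through [minkowski_time]. The constant is independent of t0 and t. *)
Lemma duhamel_Lr (R : realType) n (nu mu alpha beta : R) (r : \bar R) : (0 < n)%N -> 0 < alpha ->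
  0 <= nu -> nu <= mu -> ((alpha + 1)%:E < r)%E -> mu < n%:R * (1 - (alpha + 1) * fine (r^-1)%E) ->
  exists2 C : R, 0 < C & forall (t0 t B J : R) (g : measurableTypeR R * n.-tuple R -> R)
      (h : n.-tuple R -> R),
    0 <= t0 -> 0 <= B -> 0 < J ->
    measurable_fun setT g -> (forall p, 0 <= g p) ->
    measurable_fun setT h -> (forall x, 0 <= h x) ->
    (forall s, t0 < s < t ->
       ('N[lebesgueRn R n]_r[EFin \o (fun y => g (s, y))] <= (B * s `^ (- beta))%:E)%E) ->
    (\int[lebesgue_measure]_(s in [set: measurableTypeR R])
       (time_kernel ((mu - nu) / 2 + n%:R * alpha / 2 * fine (r^-1)%E) (beta * (alpha + 1)) t0 t s)%:E
       <= J%:E)%E ->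
    {ae lebesgueRn R n, forall x, ((h x)%:E <= \int[lebesgue_measure]_(s in [set: measurableTypeR R])
       (if (t0 < s < t)%R then wheat nu mu alpha (t - s)%R (fun y => g (s, y)) x else 0))%E} ->
    ('N[lebesgueRn R n]_r[EFin \o h] <= (C * B `^ (alpha + 1) * J)%:E)%E.
Proof.
move=> n0 a0 nu0 numu; case: r => [r||//]; last first.
  rewrite invey/= mulr0 subr0 mulr1 => _ mun.
  have [C C0 hC] := wheat_Loo n0 a0 nu0 numu mun.
  exists C => // t0 t B J g h t00 B0 J0 mg g0 mh h0 hg; rewrite mulr0 addr0 => hJ hh.
  have CB0 : 0 <= C * B `^ (alpha + 1) by rewrite mulr_ge0 ?powR_ge0// ltW.
  apply/Lnorm_oo_le => //; first by rewrite mulr_ge0// ltW.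
  apply: filterS hh => x hx; rewrite -lee_fin; apply: le_trans hx _.
  rewrite EFinM; apply: le_trans (lee_wpmul2l _ hJ); last by rewrite lee_fin.
  rewrite -ge0_integralZ_EFin//; last 2 first.
  - exact: measurable_time_kernel.
  - by move=> s _; exact: time_kernel_ge0.
  have mw := measurable_wheat_time nu mu alpha t mg.
  apply: ge0_le_integral => //.
  - by move=> s _; case: ifP => // _; exact: wheat_ge0.
  - apply: measurable_fun_ifT => //; first exact: measurable_itv_test.
    exact: (measurableT_comp mw (pair2_measurable x)).
  - by apply/measurable_EFinP; apply: measurable_funM => //; exact: measurable_time_kernel.
  move=> s _; rewrite /time_kernel; case: ifPn => [/andP[s0 st]|_]; last by rewrite mulr0.
  have ts0 : 0 < t - s by rewrite subr_gt0.
  have s00 : 0 < s := le_lt_trans t00 s0.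
  have := hC (Num.sqrt (t - s)) (B * s `^ (- beta)) (fun y => g (s, y)).
  rewrite sqr_sqrtr ?(ltW ts0)// sqrtr_gt0 => /(_ ts0).
  rewrite mulr_ge0 ?powR_ge0// => /(_ isT (measurableT_comp mg (pair1_measurable s)) (fun y => g0 _)).
  have gn : {ae lebesgueRn R n, forall y, g (s, y) <= B * s `^ (- beta)}.
    apply/Lnorm_oo_le => //; first by rewrite mulr_ge0 ?powR_ge0.
    by apply: hg; rewrite s0.
  move=> /(_ gn x) /le_trans; apply; rewrite lee_fin le_eqVlt; apply/orP; left; apply/eqP.
  rewrite -powR12_sqrt ?(ltW ts0)// powRM ?powR_ge0// -!powRrM.
  have -> : 2^-1 * (nu - mu) = - ((mu - nu) / 2) by field.
  rewrite mulNr; ring.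
rewrite lte_fin => ar; have a1 : 0 < alpha + 1 by rewrite addr_gt0.
have r0 : 0 < r := lt_trans a1 ar.
rewrite inver (gt_eqF r0)/= => mun.
have r1 : 1 < r by apply: lt_trans ar; rewrite ltrDr.
have [C C0 hC] := wheat_Lr n0 a0 nu0 numu ar mun.
exists C => // t0 t B J g h t00 B0 J0 mg g0 mh h0 hg hJ hh.
have CB0 : 0 <= C * B `^ (alpha + 1) by rewrite mulr_ge0 ?powR_ge0// ltW.
apply/Lnorm_le_integral => //; first by rewrite mulr_ge0// ltW.
have mw := measurable_wheat_time nu mu alpha t mg.
set k := time_kernel _ _ _ _ in hJ.
have step s : t0 < s < t -> (forall x, wheat nu mu alpha (t - s) (fun y => g (s, y)) x < +oo)%E /\
   (\int[lebesgueRn R n]_x (fine (wheat nu mu alpha (t - s) (fun y => g (s, y)) x) `^ r)%:E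
     <= ((C * B `^ (alpha + 1) * k s) `^ r)%:E)%E.
  move=> /[dup] st /andP[s0 s1].
  have ts0 : 0 < t - s by rewrite subr_gt0.
  have s00 : 0 < s := le_lt_trans t00 s0.
  have := hC (Num.sqrt (t - s)) (B * s `^ (- beta)) (fun y => g (s, y)).
  rewrite sqr_sqrtr ?(ltW ts0)// sqrtr_gt0 => /(_ ts0).
  rewrite mulr_ge0 ?powR_ge0// => /(_ isT (measurableT_comp mg (pair1_measurable s)) (fun y => g0 _)).
  have gn : (\int[lebesgueRn R n]_y (g (s, y) `^ r)%:E <= ((B * s `^ (- beta)) `^ r)%:E)%E.
    apply/Lnorm_le_integral => //; first by rewrite mulr_ge0 ?powR_ge0.
    exact: hg.
  move=> /(_ gn)[h1 h2]; split => //; apply: (le_trans h2).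
  rewrite lee_fin le_eqVlt; apply/orP; left; apply/eqP; congr (_ `^ r).
  rewrite /k /time_kernel st -powR12_sqrt ?(ltW ts0)// powRM ?powR_ge0// -!powRrM.
  have -> : 2^-1 * (nu - mu - n%:R * alpha / r) = - ((mu - nu) / 2 + n%:R * alpha / 2 * r^-1) by field; rewrite gt_eqF.
  rewrite mulNr; ring.
pose e (p : measurableTypeR R * n.-tuple R) : R := if t0 < p.1 < t then
  fine (wheat nu mu alpha (t - p.1) (fun y => g (p.1, y)) p.2) else 0.
apply: (@minkowski_time _ _ _ (lebesgueRn R n) e k h r (C * B `^ (alpha + 1)) J) => //.
- apply: measurable_fun_ifT => //.
    exact: (measurableT_comp (measurable_itv_test t0 t) measurable_fst).
  exact: measurableT_comp.
- by move=> p; rewrite /e; case: ifP => // _; rewrite fine_ge0 ?wheat_ge0.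
- exact: measurable_time_kernel.
- by move=> s; exact: time_kernel_ge0.
- move=> s x; rewrite /k /time_kernel /e/=; case: ifP => // /andP[s0 s1] /eqP.
  rewrite mulf_eq0 !powR_eq0 subr_eq0 (gt_eqF s1)/= (gt_eqF (le_lt_trans t00 s0))//.
- move=> s; have [st|st] := boolP (t0 < s < t).
    have [_ h2] := step s st; rewrite /e/= st//.
  rewrite /e /k /time_kernel/= (negbTE st) mulr0 powR0 ?gt_eqF// integral0_eq//.
apply: filterS hh => x /le_trans; apply.
rewrite le_eqVlt; apply/orP; left; apply/eqP/eq_integral => s _; rewrite /e/=.
by case: ifPn => // st; rewrite fineK// ge0_fin_numE ?wheat_ge0// (step s st).1.
Qed.

(** Split at s = t/2: whichever of s and t - s is at least t/2 is frozen there. In the second case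
    s^{-b} is further replaced by (s - t0)^{-b}, so both singularities sit at an endpoint of
    [t0, t]. *)
Lemma time_kernel_le (R : realType) (a b t0 t s : R) : 0 <= a -> 0 <= b -> 0 <= t0 ->
  time_kernel a b t0 t s <=
  2 `^ b * t `^ (- b) * (`|s - t| `^ (- a) * \1_`[t0, t] s) +
  2 `^ a * t `^ (- a) * (`|s - t0| `^ (- b) * \1_`[t0, t] s).
Proof.
move=> a0 b0 t00; rewrite /time_kernel; case: ifPn => [/andP[s0 st]|_]; last first.
  by rewrite addr_ge0 ?mulr_ge0 ?powR_ge0.
have t1 : 0 < t := le_lt_trans t00 (lt_trans s0 st).
rewrite indicE mem_set/=; last by rewrite in_itv/= !ltW.
rewrite !mulr1.
have half c : (t / 2) `^ (- c) = 2 `^ c * t `^ (- c).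
  by rewrite powRM ?(ltW t1)// -powR_inv1// -powRrM mulrNN mul1r mulrC.
have [ts|ts] := leP (t / 2) s.
  rewrite distrC ger0_norm ?subr_ge0 ?(ltW st)// -[leLHS]addr0 lerD ?mulr_ge0 ?powR_ge0//.
  by rewrite mulrC ler_wpM2r ?powR_ge0// -half ger_powRN// divr_gt0.
rewrite -[leLHS]add0r lerD ?mulr_ge0 ?powR_ge0//.
rewrite ler_pM ?powR_ge0// -?half ?ger_powRN ?divr_gt0//; first by lra.
- by rewrite normr_gt0 subr_eq0 gt_eqF.
- by rewrite ger0_norm ?subr_ge0 ?(ltW s0)// gerBl.
Qed.

(** The point is uniformity in t0, including t near 0. With L = t - t0 <= t, the first term is
    t^{-alpha beta} L^{1-a} <= L^{1 - a - alpha beta}. The second is t^{beta-a} L^{1-b}, bounded by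
    the same power of L if beta <= a and by T^{beta-a} L^{1-b} otherwise. Both exponents of L are
    positive by hypothesis. *)
Lemma time_kernel_small (R : realType) (a alpha beta T eta : R) :
  0 < a -> a < 1 -> 0 < alpha -> 0 < beta -> beta * (alpha + 1) < 1 -> a + alpha * beta < 1 ->
  0 < T -> 0 < eta ->
  exists2 delta : R, 0 < delta & forall t0 t : R, 0 <= t0 -> t0 < t -> t <= T -> t <= t0 + delta ->
    exists J : R, [/\ 0 < J, (\int[lebesgue_measure]_(s in [set: measurableTypeR R])
       (time_kernel a (beta * (alpha + 1)) t0 t s)%:E <= J%:E)%E & t `^ beta * J <= eta].
Proof.
move=> a0 a1 al0 be0; set b := beta * (alpha + 1) => b1 ab1 T0 eta0.
have b0 : 0 < b by rewrite mulr_gt0// addr_gt0.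
have [Ca Ca0 hCa] := @integral_powR_near R a (introT andP (conj (ltW a0) a1)).
have [Cb Cb0 hCb] := @integral_powR_near R b (introT andP (conj (ltW b0) b1)).
pose th1 := 1 - a - alpha * beta; pose th2 := 1 - b.
have th10 : 0 < th1 by rewrite /th1; lra.
have th20 : 0 < th2 by rewrite /th2 subr_gt0.
pose th := Num.min th1 th2.
have th0 : 0 < th by rewrite lt_min th10.
pose K := 2 `^ b * Ca + 2 `^ a * Cb + 2 `^ a * Cb * T `^ (beta - a).
have K0 : 0 < K by rewrite !addr_gt0// !mulr_gt0 ?powR_gt0.
(* The bound 1 allows every exponent of L to be lowered to [th]; the other term gives K L^th <=
   eta. *)
exists (Num.min 1 ((eta / K) `^ th^-1)); first by rewrite lt_min ltr01 powR_gt0// divr_gt0.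
set delta := Num.min _ _ => t0 t t00 t0t tT td.
have t1 : 0 < t := le_lt_trans t00 t0t.
pose L := t - t0.
have L0 : 0 < L by rewrite subr_gt0.
have Lt : L <= t by rewrite gerBl.
have Ld : L <= delta by rewrite lerBlDr addrC.
have L1 : L <= 1 by apply: le_trans Ld _; rewrite ge_min lexx.
have LK : L `^ th <= eta / K.
  have -> : eta / K = ((eta / K) `^ th^-1) `^ th.
    by rewrite -powRrM mulVf ?gt_eqF// powRr1// ltW// divr_gt0.
  rewrite ge0_ler_powR ?nnegrE ?powR_ge0 ?(ltW L0) ?(ltW th0)//.
  by apply: le_trans Ld _; rewrite ge_min lexx orbT.
have Lth c : th <= c -> L `^ c <= L `^ th by move=> h; apply: ger_powR; rewrite ?L0.
exists (2 `^ b * t `^ (- b) * (Ca * L `^ (1 - a)) + 2 `^ a * t `^ (- a) * (Cb * L `^ (1 - b))).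
split.
- by rewrite addr_gt0// !mulr_gt0 ?powR_gt0.
- have mI : measurable (`[t0, t] : set R) by exact: measurable_itv.
  have mn c p : measurable_fun setT (fun s : R => `|s - c| `^ p).
    apply: (measurableT_comp (measurable_powR _)); apply: measurableT_comp => //.
    exact: measurable_funB.
  have mf c p : measurable_fun setT (fun s : R => `|s - c| `^ p * \1_`[t0, t] s).
    by apply: measurable_funM.
  have f0 c p (s : R) : 0 <= `|s - c| `^ p * \1_`[t0, t] s by rewrite mulr_ge0 ?powR_ge0.
  apply: (@le_trans _ _ (\int[lebesgue_measure]_(s in [set: measurableTypeR R])
     (2 `^ b * t `^ (- b) * (`|s - t| `^ (- a) * \1_`[t0, t] s) +
      2 `^ a * t `^ (- a) * (`|s - t0| `^ (- b) * \1_`[t0, t] s))%:E)%E).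
    apply: ge0_le_integral_EFin => //.
    - exact: measurable_time_kernel.
    - by move=> s _; exact: time_kernel_ge0.
    - by apply: measurable_funD; apply: measurable_funM => //; exact: mf.
    - by move=> s _; apply: time_kernel_le => //; exact: ltW.
  have nn c : 0 <= 2 `^ c * t `^ (- c) by rewrite mulr_ge0 ?powR_ge0.
  rewrite ge0_integralD_EFin//; last 4 first.
  - by apply: measurable_funM => //; exact: mf.
  - by move=> s _; exact: mulr_ge0.
  - by apply: measurable_funM => //; exact: mf.
  - by move=> s _; exact: mulr_ge0.
  rewrite !ge0_integralZ_EFin//; [|exact: mf|exact: mf].
  have near c p C (hC : forall c t : R, 0 < t -> (\int[lebesgue_measure]_(s in `[(c - t)%R, (c + t)%R]) (`|s - c| `^ (- p))%:E <= (C * t `^ (1 - p))%:E)%E) :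
     c - L <= t0 -> t <= c + L ->
     (\int[lebesgue_measure]_(s in [set: measurableTypeR R]) (`|s - c| `^ (- p) * \1_`[t0, t] s)%:E <= (C * L `^ (1 - p))%:E)%E.
    move=> h1 h2; apply: le_trans (hC c L L0); rewrite [leRHS]integral_mkcond.
    apply: ge0_le_integral => //.
    - by apply/measurable_EFinP; exact: mf.
    - have mI2 : measurable (`[c - L, c + L]%classic : set (measurableTypeR R)).
        exact: measurable_itv.
      apply/(measurable_restrictT _ mI2).
      by apply/measurable_EFinP; apply: measurable_funTS; exact: mn.
    move=> s _; rewrite patchE indicE; case: ifPn => [_|sn].
      by rewrite lee_fin ler_piMr ?powR_ge0//; case: (_ \in _).
    rewrite memNset ?mulr0//= in_itv/= => /andP[s1 s2]; move: sn.
    rewrite notin_setE/= in_itv/= => /negP; rewrite negb_and -!ltNge => /orP[|]; lra.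
  apply: (@le_trans _ _ ((2 `^ b * t `^ (- b))%:E * (Ca * L `^ (1 - a))%:E +
      (2 `^ a * t `^ (- a))%:E * (Cb * L `^ (1 - b))%:E)%E).
    by apply: leeD; apply: lee_wpmul2l; rewrite ?lee_fin//; apply: near => //; rewrite /L; lra.
  by rewrite -!EFinM -EFinD.
rewrite mulrDr.
have tpow c c' : t `^ (c + c') = t `^ c * t `^ c' by rewrite powRD// (gt_eqF t1) implybT.
have Lpow c c' : L `^ (c + c') = L `^ c * L `^ c' by rewrite powRD// (gt_eqF L0) implybT.
have e1 : t `^ beta * (2 `^ b * t `^ (- b) * (Ca * L `^ (1 - a))) <= 2 `^ b * Ca * L `^ th.
  have -> : t `^ beta * (2 `^ b * t `^ (- b) * (Ca * L `^ (1 - a))) =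
     2 `^ b * Ca * (t `^ (- (alpha * beta)) * L `^ (1 - a)).
    have -> : - (alpha * beta) = beta + - b by rewrite /b; ring.
    by rewrite tpow; ring.
  rewrite ler_wpM2l ?mulr_ge0 ?powR_ge0 ?(ltW Ca0)//.
  apply: le_trans (Lth th1 _); last by rewrite ge_min lexx.
  have -> : th1 = - (alpha * beta) + (1 - a) by rewrite /th1; ring.
  have ab0 : 0 <= alpha * beta by apply: mulr_ge0; exact: ltW.
  by rewrite (Lpow (- (alpha * beta))) ler_wpM2r ?powR_ge0// ger_powRN.
have e2 : t `^ beta * (2 `^ a * t `^ (- a) * (Cb * L `^ (1 - b))) <=
    (2 `^ a * Cb + 2 `^ a * Cb * T `^ (beta - a)) * L `^ th.
  have -> : t `^ beta * (2 `^ a * t `^ (- a) * (Cb * L `^ (1 - b))) =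
     2 `^ a * Cb * (t `^ (beta - a) * L `^ (1 - b)) by rewrite tpow; ring.
  have -> : (2 `^ a * Cb + 2 `^ a * Cb * T `^ (beta - a)) * L `^ th =
     2 `^ a * Cb * (L `^ th + T `^ (beta - a) * L `^ th) by ring.
  rewrite ler_wpM2l ?mulr_ge0 ?powR_ge0 ?(ltW Cb0)//.
  have [ba|ba] := leP beta a.
    rewrite -[leLHS]addr0 lerD ?mulr_ge0 ?powR_ge0//.
    apply: le_trans (Lth th1 _); last by rewrite ge_min lexx.
    have -> : th1 = (beta - a) + (1 - b) by rewrite /th1 /b; ring.
    rewrite (Lpow (beta - a)) ler_wpM2r ?powR_ge0//.
    by rewrite -[beta - a]opprB ger_powRN// subr_ge0.
  rewrite -[leLHS]add0r lerD ?powR_ge0// ler_pM ?powR_ge0//.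
    by rewrite ge0_ler_powR ?nnegrE ?subr_ge0 ?(ltW ba) ?(ltW t1) ?(ltW T0).
  by apply: (Lth th2); rewrite ge_min lexx orbT.
apply: (le_trans (lerD e1 e2)).
have -> : 2 `^ b * Ca * L `^ th + (2 `^ a * Cb + 2 `^ a * Cb * T `^ (beta - a)) * L `^ th = L `^ th * K.
  by rewrite /K; ring.
by rewrite -ler_pdivlMr.
Qed.

Lemma wheat_eq0 (R : realType) n (nu mu alpha tau : R) (g : n.-tuple R -> R) (x : n.-tuple R) :
  0 < alpha -> measurable_fun setT g -> {ae lebesgueRn R n, forall y, g y = 0} ->
  wheat nu mu alpha tau g x = 0%E.
Proof.
move=> a0 mg g0; rewrite /wheat.
rewrite (ge0_ae_eq_integral (g := cst 0%E))//.
- by rewrite integral0.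
- apply/measurable_EFinP.
  exact: (measurableT_comp (measurable_wheat_integrand nu mu alpha tau mg) (pair1_measurable x)).
- by move=> y _; rewrite lee_fin !mulr_ge0 ?powR_ge0 ?heat_kernel_ge0.
apply: filterS g0 => y -> _; rewrite powR0 ?mulr0//.
by rewrite gt_eqF// addr_gt0.
Qed.

Lemma ereal_le_geometric_eq0 (R : realType) (u : \bar R) (c : R) : (0 <= u)%E ->
  (forall k : nat, (u <= (c * 2^-1 ^+ k)%:E)%E) -> u = 0%E.
Proof.
move=> u0 hu; apply/eqP; rewrite eq_le u0 andbT.
have uf : u \is a fin_num by rewrite ge0_fin_numE// (le_lt_trans (hu 0%N))// ltry.
rewrite -(fineK uf) lee_fin leNgt; apply/negP => f0.
have c0 : fine u <= c by have := hu 0%N; rewrite expr0 mulr1 -{1}(fineK uf) lee_fin.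
have [k /andP[hk _]] := @dyadic_bracket R (fine u) c (introT andP (conj f0 c0)).
by have := hu k.+1; rewrite -(fineK uf) lee_fin leNgt mulrC hk.
Qed.

(* Time steps of length delta: once g = 0 up to k delta, the Duhamel estimate on
   the next step halves the constant B in |g(t)|_r <= B t^{-beta}, starting from M. *)
Lemma volterra_zero (R : realType) n (nu mu alpha beta M T : R) (r : \bar R)
    (g : measurableTypeR R * n.-tuple R -> R) :
  (0 < n)%N -> 0 < alpha -> 0 <= nu -> nu < mu -> ((alpha + 1)%:E < r)%E ->
  mu < n%:R * (1 - (alpha + 1) * fine (r^-1)%E) ->
  0 < beta -> beta * (alpha + 1) < 1 ->
  (mu - nu) / 2 + n%:R * alpha / 2 * fine (r^-1)%E + alpha * beta < 1 ->
  0 < T -> 0 <= M -> measurable_fun setT g -> (forall p, 0 <= g p) ->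
  (forall s, 0 < s <= T ->
     ('N[lebesgueRn R n]_r[EFin \o (fun y => g (s, y))] <= (M * s `^ (- beta))%:E)%E) ->
  (forall t, 0 < t <= T -> {ae lebesgueRn R n, forall x,
     ((g (t, x))%:E <= \int[lebesgue_measure]_(s in [set: measurableTypeR R])
       (if (0 < s < t)%R then wheat nu mu alpha (t - s)%R (fun y => g (s, y)) x else 0))%E}) ->
  forall t, 0 < t <= T -> {ae lebesgueRn R n, forall x, g (t, x) = 0}.
Proof.
move=> n0 a0 nu0 numu ar mun be0 be1; set a := (mu - nu) / 2 + n%:R * alpha / 2 * fine (r^-1)%E => ab1 T0 M0 mg g0 H1 H2.
have [C C0 hC] := duhamel_Lr beta n0 a0 nu0 (ltW numu) ar mun.
have a1 : 0 < alpha + 1 by rewrite addr_gt0.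
have r0 : (0 < r)%E by apply: lt_trans ar; rewrite lte_fin.
have rV0 : 0 <= fine (r^-1)%E by rewrite fine_ge0// inve_ge0 ltW.
have aa0 : 0 < a.
  by rewrite /a ltr_wpDr ?mulr_ge0 ?(ltW a0)// divr_gt0// subr_gt0.
have aa1 : a < 1 by apply: le_lt_trans ab1; rewrite lerDl mulr_ge0// ltW.
(* Chosen so that C (M^alpha + 1) eta = 1/2; adding 1 keeps the denominator positive when M = 0. *)
pose eta := (2 * (C * (M `^ alpha + 1)))^-1.
have MM0 : 0 < M `^ alpha + 1 by rewrite ltr_wpDl ?powR_ge0.
have eta0 : 0 < eta by rewrite invr_gt0 !mulr_gt0.
have [delta d0 hd] := time_kernel_small aa0 aa1 a0 be0 be1 ab1 T0 eta0.
have mgs s : measurable_fun setT (fun y => g (s, y)) by exact: (measurableT_comp mg (pair1_measurable s)).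
have ae0 s : 'N[lebesgueRn R n]_r[EFin \o (fun y => g (s, y))]%E = 0%E ->
    {ae lebesgueRn R n, forall x, g (s, x) = 0}.
  move=> /(Lnorm_eq0_eq0 _ r0) h.
  have := h (proj2 (measurable_EFinP _ _) (mgs s)).
  by apply: filterS => x /(_ I) [].
suff P k : forall t, 0 < t <= T -> t <= k%:R * delta ->
    'N[lebesgueRn R n]_r[EFin \o (fun y => g (t, y))]%E = 0%E.
  move=> t tT; apply: ae0.
  have [k _ hk] : exists2 k : nat, True & t <= k%:R * delta.
    exists (Num.bound (t / delta)) => //.
    have /andP[t0 _] := tT.
    rewrite -ler_pdivrMr//; apply: ltW; apply: archi_boundP.
    by rewrite divr_ge0 ?ltW.
  exact: P tT hk.
elim: k => [|k IHk] t.
  by rewrite mul0r => /andP[t0 _]; rewrite leNgt t0.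
suff Q j : forall t, 0 < t <= T -> t <= k.+1%:R * delta ->
    ('N[lebesgueRn R n]_r[EFin \o (fun y => g (t, y))] <= (M * 2^-1 ^+ j * t `^ (- beta))%:E)%E.
  move=> tT tk; apply: (@ereal_le_geometric_eq0 _ _ (M * t `^ (- beta))); first exact: Lnorm_ge0.
  by move=> j; rewrite mulrAC; exact: Q.
elim: j => [|j IHj] {}t tT tk; first by rewrite expr0 mulr1; exact: H1.
have h0 j' : 0 <= M * 2^-1 ^+ j' by rewrite mulr_ge0// exprn_ge0.
have [tkd|tkd] := leP t (k%:R * delta).
  by rewrite IHk// lee_fin mulr_ge0 ?powR_ge0.
have /andP[t0 t1] := tT.
have kd0 : 0 <= k%:R * delta by rewrite mulr_ge0// ltW.
have tkd' : t <= k%:R * delta + delta by rewrite -[X in _ + X]mul1r -mulrDl natr1.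
have [J [J0 hJ Jeta]] := hd _ _ kd0 tkd t1 tkd'.
have := hC (k%:R * delta) t (M * 2^-1 ^+ j) J g (fun x => g (t, x)) kd0 (h0 j) J0 mg g0 (mgs t) (fun x => g0 _).
move=> /(_ _ hJ _)/le_trans; apply.
- move=> s /andP[s0 st].
  have s00 : 0 < s := le_lt_trans kd0 s0.
  by apply: IHj; rewrite ?s00 ?(le_trans (ltW st))//.
- apply: filterS (H2 t tT) => x /le_trans; apply.
  have mw := measurable_wheat_time nu mu alpha t mg.
  have mite (u : R) : measurable_fun setT (fun s : measurableTypeR R =>
     if (u < s < t)%R then wheat nu mu alpha (t - s)%R (fun y => g (s, y)) x else 0%E).
    apply: measurable_fun_ifT => //; first exact: measurable_itv_test.
    exact: (measurableT_comp mw (pair2_measurable x)).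
  apply: ge0_le_integral => //.
  + by move=> s _; case: ifP => // _; exact: wheat_ge0.
  move=> s _; case: ifPn => [/andP[s0 st]|_]; last by case: ifP => // _; exact: wheat_ge0.
  (* Times s <= k delta contribute nothing, because g(s) vanishes almost everywhere by the induction
     on k; the integral may start at k delta. *)
  rewrite st andbT; case: ltP => // sk.
  rewrite wheat_eq0//; apply: ae0; apply: IHk => //.
  by rewrite s0 (le_trans (ltW st)).
rewrite lee_fin; set B := M * 2^-1 ^+ j.
have BM : B <= M by rewrite ler_piMr// exprn_ile1// invf_le1// ler1n.
have B0 : 0 <= B := h0 j.
rewrite exprSr mulrA -/B powRN ler_pdivlMr ?powR_gt0//.
have [->|Bn0] := eqVneq B 0; first by rewrite (@powR0 _ (alpha + 1)) ?gt_eqF// mulr0 !mul0r.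
rewrite powRD; last by rewrite Bn0 implybT.
rewrite (powRr1 B0).
have -> : C * (B `^ alpha * B) * J * t `^ beta = B * (C * B `^ alpha * (t `^ beta * J)) by ring.
rewrite ler_wpM2l//.
apply: (@le_trans _ _ (C * (M `^ alpha + 1) * eta)).
  apply: ler_pM => //; first by rewrite mulr_ge0 ?powR_ge0// ltW.
  - by rewrite mulr_ge0 ?powR_ge0// ltW.
  rewrite ler_pM2l//; apply: (@le_trans _ _ (M `^ alpha)); last by rewrite lerDl.
  by rewrite ge0_ler_powR ?nnegrE// ltW.
rewrite /eta invfM mulrCA mulfV ?mulr1// gt_eqF// mulr_gt0//.
Qed.

(** * Positivity of solutions *)

(** Choosing the least index whose set contains s turns the countable family into a measurable
    partition in time. On each piece the glued function does not depend on time, which makes it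
    jointly measurable. *)
Lemma glue_countable d (T : measurableType d) (R : realType) (I : Type) (J : nat -> set R)
    (f : I -> T -> R) (tau : nat -> I) :
  (forall k, measurable (J k)) -> (forall i, measurable_fun setT (f i)) ->
  exists U : measurableTypeR R * T -> R, measurable_fun setT U /\
    forall s, (exists k, J k s) -> exists2 k, J k s & forall x, U (s, x) = f (tau k) x.
Proof.
move=> mJ mf.
have mJ' k : measurable (J k : set (measurableTypeR R)) by exact: mJ.
have mall : measurable (\bigcup_k J k : set (measurableTypeR R)) by exact: bigcup_measurable.
pose J' k : set (measurableTypeR R) := J k `|` ~` \bigcup_k J k.
have mJ'' k : measurable (J' k) by apply: measurableU => //; exact: measurableC.
have cov s : exists k, J' k s.
  have [[k _ Jk]|nJ] := pselect ((\bigcup_k J k) s); first by exists k; left.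
  by exists 0%N; right.
pose Q s : pred nat := fun k => `[< J' k s >].
have exQ s : exists k, Q s k by have [k Jk] := cov s; exists k; apply/asboolP.
pose kk s := ex_minn (exQ s).
have kkP s k : seqDU J' k s <-> kk s = k.
  rewrite /kk; case: ex_minnP => m /asboolP Jm mmin; split.
    move=> [Jk]; rewrite -bigcup_mkord => nJ.
    apply/eqP; rewrite eqn_leq mmin ?andbT; last exact/asboolP.
    rewrite leqNgt; apply/negP => km.
    by apply: nJ; exists m.
  move=> <-; split => //; rewrite -bigcup_mkord => -[j /= jm Jj].
  by have := mmin j (introT (asboolP _) Jj); rewrite leqNgt jm.
pose U (p : measurableTypeR R * T) := f (tau (kk p.1)) p.2.
exists U; split; last first.
  move=> s [k Jk]; exists (kk s) => //.
  have := (kkP s (kk s)).2 erefl => -[+ _] => -[//|]; case; by exists k.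
have mD k : measurable (seqDU J' k `*` [set: T]).
  by apply: measurableX => //; exact: seqDU_measurable.
rewrite (_ : setT = \bigcup_k (seqDU J' k `*` [set: T])); last first.
  by apply/esym; rewrite -subTset => -[s x] _; exists (kk s) => //; split => //=; exact/kkP.
apply/measurable_fun_bigcup => // k.
apply: (eq_measurable_fun (fun p : measurableTypeR R * T => f (tau k) p.2)).
  by move=> -[s x]; rewrite inE => -[/= /kkP <- _].
apply: measurable_funTS; exact: (measurableT_comp (mf _) measurable_snd).
Qed.

(** Borel-Cantelli: the sets where f n > 2^{-n} have summable measures, so almost every point lies
    in only finitely many of them. *)
Lemma ae_cvg_of_summable d (T : measurableType d) (R : realType)
    (m : {measure set T -> \bar R}) (f : nat -> T -> R) :
  (forall n, measurable_fun setT (f n)) ->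
  (forall n, (m [set x | (2^-1 ^+ n < f n x)%R] <= (2^-1 ^+ n)%:E)%E) ->
  {ae m, forall x, exists N, forall n, (N <= n)%N -> f n x <= 2^-1 ^+ n}.
Proof.
move=> mf hf; pose A n := [set x | 2^-1 ^+ n < f n x].
have mA n : measurable (A n).
  have := @measurable_fun_ltr _ _ _ setT (cst (2^-1 ^+ n)) (f n) (measurable_cst _) (mf n).
  move=> /(_ measurableT [set true] I); rewrite setTI; congr measurable.
have hs : (\sum_(n <oo) m (A n) < +oo)%E.
  apply: (@le_lt_trans _ _ 2%:E); last exact: ltry.
  apply: lime_le; first by apply: is_cvg_nneseries.
  apply: nearW => n; apply: (@le_trans _ _ (\sum_(0 <= k < n) (2^-1 ^+ k)%:E)%E).
    by apply: lee_sum => k _; exact: hf.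
  rewrite sumEFin lee_fin big_mkord.
  apply: le_trans (@sum_geometric_le R 2^-1 n _) _.
    by rewrite invr_ge0 ler0n invf_lt1// ltr1n.
  by have -> : (1 - 2^-1)^-1 = 2 :> R by field.
exists (lim_sup_set A); split.
- apply: bigcap_measurable => // k _; exact: bigcup_measurable.
- exact: lim_sup_set_cvg0.
move=> x /= /forallNP nx n _.
have := nx n => /existsNP[j] /not_implyP[nj /negP]; rewrite -ltNge => h.
by exists j.
Qed.

(** Markov's inequality, arranged so that the threshold e does not depend on f. For q infinite, e =
    a already makes the exceptional set null. *)
Lemma markov_Lnorm d (T : measurableType d) (R : realType)
    (m : {measure set T -> \bar R}) (q : \bar R) (a b : R) : (0 < q)%E -> 0 < a -> 0 < b ->
  exists2 e : R, 0 < e & forall f : T -> R, measurable_fun setT f -> (forall x, 0 <= f x) ->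
    ('N[m]_q[EFin \o f] <= e%:E)%E -> (m [set x | (a < f x)%R] <= b%:E)%E.
Proof.
move=> q0 a0 b0; case: q q0 => [q||//]; last first.
  move=> _; exists a => // f mf f0 /(Lnorm_oo_le _ f0 (ltW a0)) [N [mN N0 hN]].
  apply: (@le_trans _ _ (m N)); last by rewrite N0 lee_fin ltW.
  apply: le_measure; rewrite ?inE//; last first.
    by move=> x /= ax; apply: hN => /=; apply/negP; rewrite -ltNge.
  have := @measurable_fun_ltr _ _ _ setT (cst a) f (measurable_cst _) mf.
  by move=> /(_ measurableT [set true] I); rewrite setTI; congr measurable.
(* Then e^q = a^q b, and Markov's inequality bounds the measure by e^q / a^q = b. *)
rewrite lte_fin => q0; exists (a * b `^ q^-1); first by rewrite mulr_gt0 ?powR_gt0.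
move=> f mf f0 /(Lnorm_le_integral _ f0 q0 (mulr_ge0 (ltW a0) (powR_ge0 _ _))) h.
have mA : measurable [set x | a < f x].
  have := @measurable_fun_ltr _ _ _ setT (cst a) f (measurable_cst _) mf.
  by move=> /(_ measurableT [set true] I); rewrite setTI; congr measurable.
have aq0 : 0 < a `^ q by rewrite powR_gt0.
have : ((a `^ q)%:E * m [set x | (a < f x)%R] <= ((a * b `^ q^-1) `^ q)%:E)%E.
  apply: le_trans h; rewrite -integral_cst// [leLHS]integral_mkcond.
  apply: ge0_le_integral => //.
  - by move=> x _; rewrite patchE; case: ifP => // _; rewrite lee_fin ltW.
  - by apply/(measurable_restrictT _ mA); exact: measurable_cst.
  - by apply/measurable_EFinP; exact: (measurableT_comp (measurable_powR _) mf).
  move=> x _; rewrite patchE; case: ifPn => [|_]; last by rewrite lee_fin powR_ge0.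
  rewrite inE/= => ax; rewrite lee_fin ge0_ler_powR ?nnegrE ?(ltW q0) ?(ltW a0)//; exact: ltW.
rewrite powRM ?(ltW a0) ?powR_ge0// -powRrM mulVf ?gt_eqF// (powRr1 (ltW b0)).
by rewrite EFinM lee_pmul2l.
Qed.

(* The integral equation is stated without joint measurability in (t, x), which
   Tonelli's theorem requires.  Step functions in time approximate u at rate 2^-m;
   they converge for a.e. x at every fixed time by Borel-Cantelli. *)
Lemma joint_version (R : realType) n (q : \bar R) (gamma T : R) (u : R -> n.-tuple R -> R) :
  (0 < n)%N -> (0 < q)%E ->
  (forall t, 0 < t <= T -> measurable_fun setT (u t)) ->
  (forall t, 0 < t <= T -> forall e : R, 0 < e -> exists2 delta : R, 0 < delta &
     forall s, 0 < s <= T -> `|s - t| < delta -> (Lwnorm q gamma (u s \- u t)%R <= e%:E)%E) ->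
  exists v : measurableTypeR R * n.-tuple R -> R, measurable_fun setT v /\
    forall s, 0 < s <= T -> {ae lebesgueRn R n, forall x, v (s, x) = u s x}.
Proof.
move=> n0 q0 mu_ cu.
have h0 m : 0 < 2^-1 ^+ m :> R by rewrite exprn_gt0.
have [e e0] : exists2 e : nat -> R, (forall m, 0 < e m) & forall m (f : n.-tuple R -> R), measurable_fun setT f -> (forall x, 0 <= f x) ->
    ('N[lebesgueRn R n]_q[EFin \o f] <= (e m)%:E)%E -> (lebesgueRn R n [set x | (2^-1 ^+ m < f x)%R] <= (2^-1 ^+ m)%:E)%E.
  have H m := cid2 (markov_Lnorm (lebesgueRn R n) q0 (h0 m) (h0 m)).
  by exists (fun m => s2val (H m)) => m; [exact: (s2valP (H m))|exact: (s2valP' (H m))].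
move=> he.
pose f (t : R) (x : n.-tuple R) := if 0 < t <= T then u t x else 0.
have mf t : measurable_fun setT (f t).
  by rewrite /f; have [h|] := boolP (0 < t <= T); [exact: mu_|move=> _; exact: measurable_cst].
(* An interval with rational endpoints on which u stays within [e m] of its value at one time t.
   There are countably many, continuity makes them cover ]0, T], and [tau] picks a suitable t in
   each case. *)
pose good m (ab : rat * rat) (t : R) := 0 < t <= T /\
  forall s, 0 < s <= T -> ratr ab.1 < s < ratr ab.2 -> (Lwnorm q gamma (u s \- u t)%R <= (e m)%:E)%E.
pose J m k : set R := [set s | exists2 ab : rat * rat, unpickle k = Some ab &
   (exists t, good m ab t) /\ ratr ab.1 < s < ratr ab.2].
pose tau m k : R := match unpickle k with Some ab => xget 0 (good m ab) | None => 0 end.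
have mJ m k : measurable (J m k).
  case E : (unpickle k : option (rat * rat)) => [ab|].
    have [G|G] := pselect (exists t, good m ab t).
      rewrite (_ : J m k = `]ratr ab.1, ratr ab.2[%classic); first exact: measurable_itv.
      apply/seteqP; split => s /=; rewrite in_itv/=.
        by case=> ab'; rewrite E => -[<-] [].
      by move=> h; exists ab.
    rewrite (_ : J m k = set0); first exact: measurable0.
    by rewrite -subset0 => s [ab']; rewrite E => -[<-] [].
  rewrite (_ : J m k = set0); first exact: measurable0.
  by rewrite -subset0 => s [ab']; rewrite E.
have cov m s : 0 < s <= T -> exists k, J m k s.
  move=> sT; have [d d0 hd] := cu s sT (e m) (e0 m).
  have [a] := @rat_in_itvoo R (s - d) s (ltac:(by rewrite gtrBl)).
  rewrite in_itv/= => /andP[a1 a2].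
  have [b] := @rat_in_itvoo R s (s + d) (ltac:(by rewrite ltrDl)).
  rewrite in_itv/= => /andP[b1 b2].
  exists (pickle (a, b)); exists (a, b); first by rewrite pickleK.
  split; last by rewrite /= a2 b1.
  exists s; split => // s' s'T /= /andP[as' s'b]; apply: hd => //.
  by rewrite ltr_norml; apply/andP; split; lra.
have HU m := cid (glue_countable (tau m) (mJ m) mf).
pose U m := sval (HU m).
have mU m : measurable_fun setT (U m) := (svalP (HU m)).1.
have Ue m s : 0 < s <= T -> (Lwnorm q gamma (u s \- (fun x => U m (s, x)))%R <= (e m)%:E)%E.
  move=> sT; have [k Jk Uk] := (svalP (HU m)).2 s (cov m s sT).
  have [ab E [[t gt] sab]] := Jk.
  have gtau : good m ab (tau m k) by rewrite /tau E; exact: (xgetI 0 gt).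
  rewrite (_ : (fun x => U m (s, x)) = u (tau m k)); first by case: gtau => _; apply.
  by apply/funext => x; rewrite /U Uk /f gtau.1.
have mUs m s : measurable_fun setT (fun x => U m (s, x)).
  exact: (measurableT_comp (mU m) (pair1_measurable s)).
(* The upper limit is measurable whether or not the approximations converge, and equals the limit
   where they do. *)
exists (fun p => fine (limn_esup (fun m => (U m p)%:E))); split.
  apply: measurableT_comp => //; apply: measurable_fun_limn_esup => m.
  by apply/measurable_EFinP.
move=> s sT.
have := @ae_cvg_of_summable _ _ _ (lebesgueRn R n) (fun m => wabs gamma (u s \- (fun x => U m (s, x)))%R).
have mdiff m : measurable_fun setT (u s \- (fun x => U m (s, x)))%R.
  by apply: measurable_funB => //; exact: mu_.
move=> /(_ (fun m => measurable_wabs gamma (mdiff m))) /(_ _)/filterS2; apply; last first.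
- exact: (@ae_enorm_gt0 R n n0).
- move=> m; apply: he; [exact: measurable_wabs|exact: wabs_ge0|].
  by rewrite -Lwnorm_wabs; exact: Ue.
move=> x [N hN] x0.
have cv : (U m (s, x))%:E @[m --> \oo] --> (u s x)%:E.
  apply: cvg_EFin; first by near=> m.
  apply/cvgrPdist_le => ep ep0 /=.
  have c0 : 0 < enorm x `^ gamma by rewrite powR_gt0.
  have := @cvg_expr R 2^-1; rewrite ger0_norm// invf_lt1// ltr1n => /(_ isT).
  move/cvgrPdist_le => /(_ _ (mulr_gt0 ep0 c0)) [M _ hM].
  exists (maxn N M) => // m /=; rewrite geq_max => /andP[Nm Mm].
  have := hN m Nm; rewrite /wabs => h.
  have := hM m Mm; rewrite /= sub0r normrN ger0_norm ?(ltW (h0 m))// => h2.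
  by rewrite -(ler_pM2r c0) mulrC; apply: le_trans h _.
by rewrite (is_cvg_limn_esupE (cvgP _ cv)) (cvg_lim _ cv).
Unshelve. all: by end_near.
Qed.

Lemma Lnorm_le_ae d (T : measurableType d) (R : realType)
    (m : {measure set T -> \bar R}) (f g : T -> R) (r : \bar R) : (0 < r)%E ->
  measurable_fun setT f -> measurable_fun setT g ->
  (forall x, 0 <= f x) -> (forall x, 0 <= g x) -> {ae m, forall x, f x <= g x} ->
  ('N[m]_r[EFin \o f] <= 'N[m]_r[EFin \o g])%E.
Proof.
case: r => [r||//] r0 mf mg f0 g0 fg; last first.
  rewrite unlock; case: ifPn => // _; apply: le_ess_sup.
  by apply: filterS fg => x fgx; rewrite /= !ger0_norm.
rewrite !ge0_Lnorm_EFin//; apply: le_poweR.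
- by rewrite invr_ge0 ltW.
- by apply: integral_ge0 => x _; rewrite lee_fin powR_ge0.
apply: ae_ge0_le_integral => //.
- by move=> x _; rewrite lee_fin powR_ge0.
- by apply/measurable_EFinP; exact: (measurableT_comp (measurable_powR _) mf).
- by move=> x _; rewrite lee_fin powR_ge0.
- by apply/measurable_EFinP; exact: (measurableT_comp (measurable_powR _) mg).
by apply: filterS fg => x fgx _; rewrite lee_fin ge0_ler_powR ?nnegrE// ltW.
Qed.

(* If the positive part has infinite integral, [fine] returns 0, which is harmless for this lower bound. *)
Lemma fine_integral_ge d (T : measurableType d) (R : realType)
    (m : {measure set T -> \bar R}) (D : set T) (f : T -> R) (E : T -> \bar R) : measurable D ->
  measurable_fun D f -> measurable_fun D E -> (forall x, D x -> 0 <= E x)%E ->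
  {ae m, forall x, D x -> ((- f x)%:E <= E x)%E} ->
  (- (\int[m]_(x in D) E x) <= (fine (\int[m]_(x in D) (f x)%:E))%:E)%E.
Proof.
move=> mD mf mE E0 fE; rewrite [X in fine X]integralE.
set I := (\int[m]_(x in D) E x)%E.
set P := (\int[m]_(x in D) (_^\+)%E _)%E; set N := (\int[m]_(x in D) (_^\-)%E _)%E.
have mF : measurable_fun D (fun x => (f x)%:E) by exact/measurable_EFinP.
have P0 : (0 <= P)%E by exact: integral_ge0.
have N0 : (0 <= N)%E by exact: integral_ge0.
have NI : (N <= I)%E.
  apply: ae_ge0_le_integral => //; first exact: measurable_funeneg.
  apply: filterS fE => x h Dx; rewrite funenegE ge_max E0// andbT -EFinN.
  exact: h.
have I0 : (0 <= I)%E := le_trans N0 NI.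
clearbody P N.
have [Poo|Pf] := eqVneq P +oo%E.
  rewrite Poo; case: N N0 NI => [N||//] _ _.
  - by rewrite /= leeNl oppe0.
  - by rewrite /= leeNl oppe0.
have Pfin : P \is a fin_num by rewrite ge0_fin_numE// lt_neqAle Pf leey.
have [Noo|Nf] := eqVneq N +oo%E.
  have -> : I = +oo%E by apply/eqP; rewrite -leye_eq -Noo.
  by rewrite leNye.
have Nfin : N \is a fin_num by rewrite ge0_fin_numE// lt_neqAle Nf leey.
rewrite fineK ?fin_numB ?Pfin ?Nfin//.
apply: (@le_trans _ _ (- N)%E); first by rewrite leeN2.
by rewrite leeDr.
Qed.

Lemma fine_integral_ge0 d (T : measurableType d) (R : realType)
    (m : {measure set T -> \bar R}) (f : T -> R) : measurable_fun setT f ->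
  {ae m, forall x, 0 <= f x} -> 0 <= fine (\int[m]_x (f x)%:E)%E.
Proof.
move=> mf f0; rewrite -lee_fin -[leLHS]oppe0 -(integral0 m setT).
apply: fine_integral_ge => //.
by apply: filterS f0 => x fx _; rewrite lee_fin oppr_le0.
Qed.

Lemma wheat_nu (R : realType) n (nu mu alpha tau : R) (g : n.-tuple R -> R) (x : n.-tuple R) :
  measurable_fun setT g ->
  wheat nu mu alpha tau g x = ((enorm x `^ nu)%:E * wheat 0 mu alpha tau g x)%E.
Proof.
move=> mg; rewrite /wheat -ge0_integralZ_EFin ?powR_ge0//.
- by apply: eq_integral => y _; rewrite powRr0 mul1r.
- exact: (measurableT_comp (measurable_wheat_integrand 0 mu alpha tau mg) (pair1_measurable x)).
- by move=> y _; rewrite !mulr_ge0 ?powR_ge0 ?heat_kernel_ge0.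
Qed.

Lemma measurable_nonlin (R : realType) n (l alpha : R) (f : n.-tuple R -> R) :
  measurable_fun setT f -> measurable_fun setT (nonlin l alpha f).
Proof.
move=> mf; apply: measurable_funM; first exact: measurable_enorm_powR.
apply: measurable_funM => //; apply: (measurableT_comp (measurable_powR _)).
exact: measurableT_comp.
Qed.

Lemma measurable_heat_integrand (R : realType) n (tau : R) (f : n.-tuple R -> R) (x : n.-tuple R) :
  measurable_fun setT f -> measurable_fun setT (fun y => heat_kernel tau (esub x y) * f y).
Proof.
move=> mf; apply: measurable_funM => //.
exact: (measurableT_comp (@measurable_heat_kernel R n _) (pair1_measurable x)).
Qed.

Lemma wheat0_nonlin (R : realType) n (l alpha nu : R) (z : R) (y : n.-tuple R) : 0 < alpha -> 0 < enorm y -> 0 <= z ->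
  enorm y `^ (- (nu * (alpha + 1) - l)) * (enorm y `^ nu * z) `^ (alpha + 1) = enorm y `^ l * (z `^ alpha * z).
Proof.
move=> a0 y0 z0; rewrite powRM ?powR_ge0// -powRrM mulrA -powRD; last by rewrite (gt_eqF y0) implybT.
congr (_ `^ _ * _); first by ring.
have [->|zn] := eqVneq z 0; first by rewrite powR0 ?mulr0// gt_eqF// addr_gt0.
by rewrite powRD ?zn ?implybT// powRr1.
Qed.

(** Since -|u|^alpha u <= (u^-)^{alpha+1} and the heat flow of u0 is nonnegative, the integral
    equation bounds u^- by the Duhamel integral of |y|^l (u^-)^{alpha+1}. With g = |y|^nu u^- this
    is the inequality of [volterra_zero]. The jointly measurable [v] stands for u there. *)
Lemma solution_nonneg (R : realType) n (l alpha nu T : R) (r : \bar R)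
    (u0 : n.-tuple R -> R) (u : R -> n.-tuple R -> R) (v : measurableTypeR R * n.-tuple R -> R) (M beta : R) :
  (0 < n)%N -> 0 < alpha -> 0 <= nu -> nu < nu * (alpha + 1) - l -> ((alpha + 1)%:E < r)%E ->
  nu * (alpha + 1) - l < n%:R * (1 - (alpha + 1) * fine (r^-1)%E) ->
  0 < beta -> beta * (alpha + 1) < 1 ->
  (nu * (alpha + 1) - l - nu) / 2 + n%:R * alpha / 2 * fine (r^-1)%E + alpha * beta < 1 ->
  0 < T ->
  measurable_fun setT u0 -> {ae lebesgueRn R n, forall x, 0 <= u0 x} ->
  measurable_fun setT v ->
  (forall s, 0 < s <= T -> measurable_fun setT (u s)) ->
  (forall s, 0 < s <= T -> {ae lebesgueRn R n, forall x, v (s, x) = u s x}) ->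
  (forall t, 0 < t <= T -> ((t `^ beta)%:E * Lwnorm r nu (u t) <= M%:E)%E) ->
  (forall t, 0 < t <= T -> {ae lebesgueRn R n, forall x,
     lebesgue_measure.-integrable `[0, t] (fun s => (heat (t - s) (nonlin l alpha (u s)) x)%:E) /\
     u t x = heat t u0 x + \int[lebesgue_measure]_(s in `[0, t]) heat (t - s) (nonlin l alpha (u s)) x}) ->
  forall t, 0 < t <= T -> {ae lebesgueRn R n, forall x, 0 <= u t x}.
Proof.
move=> n0 a0 nu0 numu ar mun be0 be1 ab1 T0 mu0 u00 mv mu_ vu hM heq.
have r0 : (0 < r)%E by apply: lt_trans ar; rewrite lte_fin addr_gt0.
pose g (p : measurableTypeR R * n.-tuple R) : R := enorm p.2 `^ nu * Num.max (- v p) 0.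
have mxx0 (z : R) : 0 <= Num.max (- z) 0 by rewrite le_max lexx orbT.
have g0 p : 0 <= g p by rewrite mulr_ge0 ?powR_ge0.
have mg : measurable_fun setT g.
  apply: measurable_funM; first exact: (measurableT_comp (measurable_enorm_powR _) measurable_snd).
  by apply: measurable_maxr => //; exact: measurableT_comp.
have mgs s : measurable_fun setT (fun y => g (s, y)) by exact: (measurableT_comp mg (pair1_measurable s)).
have M0 : 0 <= M.
  have := hM T; rewrite T0 lexx => /(_ isT); rewrite -lee_fin; apply: le_trans.
  by rewrite mule_ge0 ?lee_fin ?powR_ge0// /Lwnorm Lnorm_ge0.
set mu := nu * (alpha + 1) - l in numu mun ab1.
have key : forall t, 0 < t <= T -> {ae lebesgueRn R n, forall x, g (t, x) = 0}.
  apply: (@volterra_zero R n nu mu alpha beta M T r g) => //.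
    move=> s /[dup] sT /andP[s0 _].
    apply: (@le_trans _ _ (Lwnorm r nu (u s))).
      rewrite Lwnorm_wabs; apply: Lnorm_le_ae => //.
      - by apply: measurable_wabs; exact: mu_.
      - exact: wabs_ge0.
      apply: filterS (vu s sT) => x vux; rewrite /g /wabs/= vux ler_wpM2l ?powR_ge0//.
      by rewrite ge_max normr_ge0 andbT -normrN ler_norm.
    have sb : 0 < s `^ beta by rewrite powR_gt0.
    have := hM s sT; rewrite powRN EFinM muleC -lee_pdivlMr//.
  move=> t /[dup] tT /andP[t0 _].
  have h1 := heq t tT; have h2 := vu t tT.
  apply: filterS2 h1 h2 => x [hint ut] vut.
  have mw0 := measurable_wheat_time 0 mu alpha t mg.
  pose E (s : measurableTypeR R) := if (0 < s < t)%R then wheat 0 mu alpha (t - s)%R (fun y => g (s, y)) x else 0%E.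
  have E0 s : (0 <= E s)%E by rewrite /E; case: ifP => // _; exact: wheat_ge0.
  have mE : measurable_fun setT E.
    apply: measurable_fun_ifT => //; first exact: measurable_itv_test.
    exact: (measurableT_comp mw0 (pair2_measurable x)).
  have mI : measurable (`[0, t]%classic : set (measurableTypeR R)) by exact: measurable_itv.
  have Hs s : 0 < s < t -> ((- heat (t - s) (nonlin l alpha (u s)) x)%:E <= E s)%E.
    move=> /[dup] st /andP[s0 s1]; rewrite /E st.
    have ts : 0 < t - s by rewrite subr_gt0.
    have sT : 0 < s <= T by rewrite s0; have /andP[_] := tT; apply: le_trans; exact: ltW.
    rewrite /heat ts EFinN leeNl; apply: fine_integral_ge => //.
    - by apply: measurable_heat_integrand; apply: measurable_nonlin; exact: mu_.
    - apply/measurable_EFinP.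
      exact: (measurableT_comp (measurable_wheat_integrand 0 mu alpha (t - s) (mgs s)) (pair1_measurable x)).
    - by move=> y _; rewrite lee_fin !mulr_ge0 ?powR_ge0 ?heat_kernel_ge0.
    apply: filterS2 (vu s sT) (@ae_enorm_gt0 R n n0) => y vy y0 _.
    rewrite lee_fin powRr0 mul1r -mulrN ler_wpM2l ?heat_kernel_ge0//.
    rewrite /g/= wheat0_nonlin// vy /nonlin -mulrN ler_wpM2l ?powR_ge0//.
    have [uy|uy] := leP 0 (u s y).
      rewrite (@le_trans _ _ 0)//; first by rewrite oppr_le0 mulr_ge0 ?powR_ge0.
      by rewrite mulr_ge0 ?powR_ge0.
    by rewrite (max_idPl _) ?oppr_ge0 ?(ltW uy)// ltr0_norm// mulrN.
  have ge1 : (- (\int[lebesgue_measure]_(s in `[0%R, t]) E s) <=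
      (\int[lebesgue_measure]_(s in `[0, t]) heat (t - s) (nonlin l alpha (u s)) x)%:E)%E.
    apply: fine_integral_ge => //.
    - by apply/measurable_EFinP; case/integrableP : hint.
    - by apply: measurable_funTS.
    (* The endpoints are discarded: at s = t [heat] is the identity by definition, and at s = 0 [v]
       is not linked to u. *)
    have ne c : {ae (lebesgue_measure : {measure set (measurableTypeR R) -> \bar R}), forall s, s != c}.
      exists [set c]; split => //; first exact: lebesgue_measure_set1.
      by move=> s /= /negP; rewrite negbK => /eqP.
    apply: filterS2 (ne 0) (ne t) => s s0 st; rewrite /= in_itv/= => /andP[h3 h4].
    by apply: Hs; rewrite !lt_neqAle eq_sym s0 st h3.
  have ge2 : 0 <= heat t u0 x.
    rewrite /heat t0; apply: fine_integral_ge0; first exact: measurable_heat_integrand.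
    by apply: filterS u00 => y uy; rewrite mulr_ge0 ?heat_kernel_ge0.
  have -> : (\int[lebesgue_measure]_(s in [set: measurableTypeR R])
     (if (0 < s < t)%R then wheat nu mu alpha (t - s)%R (fun y => g (s, y)) x else 0) =
     (enorm x `^ nu)%:E * \int[lebesgue_measure]_(s in [set: measurableTypeR R]) E s)%E.
    rewrite -ge0_integralZl ?lee_fin ?powR_ge0//.
    by apply: eq_integral => s _; rewrite /E; case: ifP => _; rewrite ?mule0// wheat_nu.
  rewrite /g/= EFinM lee_wpmul2l ?lee_fin ?powR_ge0// vut.
  have [uy|uy] := leP 0 (u t x).
    by rewrite (max_idPr _) ?oppr_le0//; apply: integral_ge0.
  rewrite (max_idPl _) ?oppr_ge0 ?(ltW uy)// EFinN leeNl.
  apply: (@le_trans _ _ (- (\int[lebesgue_measure]_(s in `[0%R, t]) E s))%E).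
    by rewrite leeN2; apply: ge0_subset_integral.
  by apply: (le_trans ge1); rewrite lee_fin ut lerDr.
move=> t tT; apply: filterS3 (key t tT) (vu t tT) (@ae_enorm_gt0 R n n0) => x.
rewrite /g/= => /eqP; rewrite mulf_eq0 powR_eq0 => + <- x0; rewrite (gt_eqF x0)/=.
by rewrite eq_le ge_max lexx andbT oppr_le0 => /andP[].
Qed.

(** * The mass bound *)

(* Y >= 2^k Y0 from time T (1 - 2^{-alpha k}) on: the interval between two
   consecutive such times is just long enough for Y to double again. *)
Lemma blowup_iteration (R : realType) (alpha T kappa Y0 : R) (Y Z : R -> \bar R) :
  0 < alpha -> 0 < T -> 0 < kappa -> 0 <= Y0 ->
  measurable_fun setT Z -> (forall s, 0 <= Z s)%E ->
  (forall t, 0 < t <= T -> (Y0%:E <= Y t)%E) ->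
  (forall t, 0 < t <= T -> (\int[lebesgue_measure]_(s in [set: measurableTypeR R])
      (if (0 < s < t)%R then Z s else 0) <= Y t)%E) ->
  (forall t c, 0 < t <= T -> 0 <= c -> (c%:E <= Y t)%E -> ((kappa * c `^ (alpha + 1))%:E <= Z t)%E) ->
  (Y T < +oo)%E ->
  kappa * T * (1 - 2 `^ (- alpha)) * Y0 `^ alpha <= 2.
Proof.
move=> a0 T0 k0 Y00 mZ Z0 hY0 hY hZ YT.
rewrite leNgt; apply/negP => big.
pose th : R := 2 `^ (- alpha).
have th0 : 0 < th by rewrite powR_gt0.
have th1 : th < 1.
  rewrite /th powRN invf_lt1 ?powR_gt0//.
  have := gt0_ltr_powR a0 (x := 1) (y := 2); rewrite !nnegrE powR1; apply => //.
  by rewrite ltr1n.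
have Y0p : 0 < Y0.
  rewrite lt_neqAle Y00 andbT eq_sym; apply: contraTneq big => ->.
  by rewrite powR0 ?gt_eqF// mulr0 -leNgt.
pose tk k := T * (1 - th ^+ k).
have thk k : 0 < th ^+ k <= 1 by rewrite exprn_gt0//= exprn_ile1 ?(ltW th0) ?(ltW th1).
have claim k : forall t, 0 < t <= T -> tk k <= t -> ((2 ^+ k * Y0)%:E <= Y t)%E.
  elim: k => [|k IHk] t tT tkt; first by rewrite expr0 mul1r; exact: hY0.
  apply: le_trans (hY t tT).
  pose c := kappa * (2 ^+ k * Y0) `^ (alpha + 1).
  have c0 : 0 <= c by rewrite mulr_ge0 ?powR_ge0// ltW.
  have tk0 : 0 <= tk k by rewrite mulr_ge0 ?(ltW T0)// subr_ge0; have /andP[] := thk k.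
  have tkk : tk k < tk k.+1.
    by rewrite /tk ltr_pM2l// ltrD2l ltrN2 exprS gtr_pMl//; have /andP[] := thk k.
  have mI : measurable (`]tk k, tk k.+1[%classic : set (measurableTypeR R)) by exact: measurable_itv.
  apply: (@le_trans _ _ (\int[lebesgue_measure]_(s in `]tk k, tk k.+1[) c%:E)%E).
    have lm : lebesgue_measure `]tk k, tk k.+1[%classic = (tk k.+1 - tk k)%:E.
      by rewrite lebesgue_measure_itv/= lte_fin tkk -EFinD.
    rewrite integral_cst// -[X in (_ * X)%E]/(lebesgue_measure _) lm -EFinM lee_fin.
    have -> : tk k.+1 - tk k = T * (1 - th) * th ^+ k by rewrite /tk exprS; ring.
    (* The ratio th = 2^{-alpha} is the one for which the growth 2^{k(alpha+1)} of the integrand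
       times the length factor th^k is 2^k. Step k then gains the factor kappa T (1 - th) Y0^alpha,
       which exceeds 2 by [big]. *)
    have p2 : (2 ^+ k) `^ (alpha + 1) * th ^+ k = 2 ^+ k :> R.
      rewrite -!powR_mulrn ?(ltW th0)// /th -!powRrM -powRD ?pnatr_eq0 ?implybT//.
      by congr (_ `^ _); ring.
    have -> : c * (T * (1 - th) * th ^+ k) = kappa * T * (1 - th) * Y0 `^ alpha * (2 ^+ k * Y0).
      rewrite /c powRM ?exprn_ge0// (powRD (x := Y0)) ?(gt_eqF Y0p) ?implybT// powRr1//.
      by rewrite -[in RHS]p2; ring.
    by rewrite exprS -mulrA ler_wpM2r ?mulr_ge0 ?exprn_ge0// ltW.
  rewrite [leLHS]integral_mkcond; apply: ge0_le_integral => //.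
  - by move=> s _; rewrite patchE; case: ifP => // _; rewrite lee_fin.
  - by apply/(measurable_restrictT _ mI); exact: measurable_cst.
  - by apply: measurable_fun_ifT => //; exact: measurable_itv_test.
  move=> s _; rewrite patchE; case: ifPn => [|_]; last by case: ifP.
  rewrite inE/= in_itv/= => /andP[s1 s2].
  have s0 : 0 < s := le_lt_trans tk0 s1.
  have st : s < t := lt_le_trans s2 tkt.
  rewrite s0 st/=; apply: hZ.
  - by rewrite s0; have /andP[_] := tT; apply: le_trans; exact: ltW.
  - by rewrite mulr_ge0 ?exprn_ge0.
  apply: IHk; last exact: ltW.
  by rewrite s0; have /andP[_] := tT; apply: le_trans; exact: ltW.
have YT0 : (0 <= Y T)%E by apply: le_trans (hY0 T _); rewrite ?lee_fin// T0 lexx.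
have Yf : Y T \is a fin_num by rewrite ge0_fin_numE.
have h k : 2 ^+ k * Y0 <= fine (Y T).
  rewrite -lee_fin fineK//; apply: claim; first by rewrite T0 lexx.
  by rewrite /tk ler_piMr ?(ltW T0)// gerBl; have /andP[/ltW] := thk k.
pose m := Num.bound (fine (Y T) / Y0).
have : fine (Y T) / Y0 < m%:R.
  by apply: archi_boundP; rewrite divr_ge0 ?(ltW Y0p)// fine_ge0.
rewrite ltr_pdivrMr// => hm.
have := le_lt_trans (h m) hm; rewrite ltr_pM2r// ltNge => /negP; apply.
by rewrite -natrX ler_nat ltnW// ltn_expl.
Qed.

(** The power of tau is the one dictated by scaling. The lemma is applied with sigma = l/alpha, of
    either sign: a singular weight is covered by the weighted L^infinity bound for the constant 1,
    while a growing weight is absorbed by half of the Gaussian. *)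
Lemma heat_kernel_moment (R : realType) n (sigma : R) : (0 < n)%N -> sigma < n%:R ->
  exists2 C : R, 0 < C & forall tau : R, 0 < tau -> forall x0 : n.-tuple R, enorm x0 = 0 ->
    (\int[lebesgueRn R n]_y (heat_kernel tau (esub x0 y) * enorm y `^ (- sigma))%:E
      <= (C * tau `^ (- (sigma / 2)))%:E)%E.
Proof.
move=> n0 sn; have [s0|s0] := leP 0 sigma.
  have [C C0 hC] := weighted_heat_Loo n0 (lexx 0) s0 sn.
  exists C => // tau t0 x0 x00.
  have := hC (Num.sqrt tau) 1 x0 (cst 1); rewrite sqr_sqrtr ?(ltW t0)// sqrtr_gt0 => /(_ t0).
  move=> /(_ (measurable_cst _) (fun _ => ler01) ler01 (aeW _ (fun _ => lexx _))).
  rewrite mulr1 -powR12_sqrt ?(ltW t0)// -powRrM.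
  have -> : 2^-1 * (0 - sigma) = - (sigma / 2) by ring.
  apply: le_trans; rewrite le_eqVlt; apply/orP; left; apply/eqP/eq_integral => y _.
  by rewrite powRr0 mul1r mulr1.
have s1 : 0 <= - sigma by rewrite oppr_ge0 ltW.
have p0 := @pi_gt0 R.
have [C C0 hC] := powR_gauss_le s1 (ltac:(by []) : 0 < 4^-1 :> R).
pose k : R := (4 * pi) `^ (- (n%:R / 2)).
have k0 : 0 < k by rewrite powR_gt0// mulr_gt0.
pose c : R := (pi * 8) `^ (n%:R / 2).
have c0 : 0 < c by rewrite powR_gt0// mulr_gt0.
exists (k * C * c); first by rewrite !mulr_gt0.
move=> tau t0 x0 x00; pose d := Num.sqrt tau.
have d0 : 0 < d by rewrite sqrtr_gt0.
have dt : d ^+ 2 = tau by rewrite sqr_sqrtr// ltW.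
have en y : enorm (esub y x0) = enorm y.
  apply/eqP; rewrite -(@eqrXn2 _ 2) ?enorm_ge0//; apply/eqP.
  rewrite enorm_esub_sqr enorm_sqr; apply: eq_bigr => i _.
  by rewrite (enorm_eq0 x00) tnth_nseq subr0.
have dn : 0 <= k * d `^ (- n%:R) * (C * d `^ (- sigma)) by rewrite !mulr_ge0 ?powR_ge0// ltW.
apply: (@le_trans _ _ (\int[lebesgueRn R n]_y
   ((k * d `^ (- n%:R) * (C * d `^ (- sigma))) * expR (- (4^-1 / 2 / d ^+ 2 * enorm (esub y x0) ^+ 2)))%:E)%E).
  apply: ge0_le_integral_EFin => //.
  - by apply: measurable_heat_integrand; exact: measurable_enorm_powR.
  - by move=> y _; rewrite mulr_ge0 ?heat_kernel_ge0 ?powR_ge0.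
  - apply: measurable_funM => //.
    exact: (measurableT_comp (@measurable_gauss_esub R n _) (pair2_measurable x0)).
  move=> y _; rewrite -dt heat_kernel_split// enorm_esubC en -expRD -/k.
  have := hC d (enorm y) d0 (enorm_ge0 y) => h.
  have -> : expR (- (8^-1 / d ^+ 2 * enorm y ^+ 2) + - (8^-1 / d ^+ 2 * enorm y ^+ 2)) =
     expR (- (4^-1 / d ^+ 2 * enorm y ^+ 2)) by congr expR; field; rewrite gt_eqF.
  rewrite -[leLHS]mulrA -[leRHS]mulrA ler_wpM2l//; last by rewrite mulrC.
  by rewrite mulr_ge0 ?powR_ge0 ?(ltW k0).
rewrite ge0_integralZ_EFin//; last first.
  exact: (measurableT_comp (@measurable_gauss_esub R n _) (pair2_measurable x0)).
rewrite integral_gauss_Rn; last by rewrite !divr_gt0 ?exprn_gt0.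
rewrite -EFinM lee_fin le_eqVlt; apply/orP; left; apply/eqP.
have -> : pi / (4^-1 / 2 / d ^+ 2) = pi * 8 * d ^+ 2 by field; rewrite gt_eqF.
rewrite [in LHS]powRM ?sqr_ge0 ?mulr_ge0 ?(ltW p0)// -/c -[d ^+ 2]powR_mulrn ?(ltW d0)// -powRrM.
have -> : 2%:R * (n%:R / 2) = n%:R :> R by field.
have -> : tau `^ (- (sigma / 2)) = d `^ (- sigma).
  by rewrite -dt -powR_mulrn ?(ltW d0)// -powRrM; congr (_ `^ _); field.
have dd : d `^ (- n%:R) * d `^ n%:R = 1 by rewrite powRN mulVf// gt_eqF// powR_gt0.
by rewrite -[RHS]mulr1 -[X in _ = _ * X]dd; ring.
Qed.

Lemma heat_semigroup_integral (R : realType) n (a b : R) (z : n.-tuple R) (f : n.-tuple R -> R) :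
  0 < a -> 0 < b -> measurable_fun setT f -> (forall y, 0 <= f y) ->
  (\int[lebesgueRn R n]_x ((heat_kernel a (esub z x))%:E *
      \int[lebesgueRn R n]_y (heat_kernel b (esub x y) * f y)%:E) =
   \int[lebesgueRn R n]_y (heat_kernel (a + b) (esub z y) * f y)%:E)%E.
Proof.
move=> a0 b0 mf f0.
have mka : measurable_fun setT (fun x => heat_kernel a (esub z x)).
  exact: (measurableT_comp (@measurable_heat_kernel R n _) (pair1_measurable z)).
transitivity (\int[lebesgueRn R n]_x \int[lebesgueRn R n]_y
    (heat_kernel a (esub z x) * (heat_kernel b (esub x y) * f y))%:E)%E.
  apply: eq_integral => x _; rewrite -ge0_integralZ_EFin ?heat_kernel_ge0//.
  - exact: measurable_heat_integrand.
  - by move=> y _; rewrite mulr_ge0 ?heat_kernel_ge0.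
rewrite (@fubini_tonelli _ _ _ _ _ (lebesgueRn R n) (lebesgueRn R n)
  (fun p => (heat_kernel a (esub z p.1) * (heat_kernel b (esub p.1 p.2) * f p.2))%:E))/=; last 2 first.
- apply/measurable_EFinP; apply: measurable_funM; first exact: (measurableT_comp mka measurable_fst).
  apply: measurable_funM; first exact: measurable_heat_kernel.
  exact: (measurableT_comp mf measurable_snd).
- by move=> p; rewrite lee_fin mulr_ge0 ?heat_kernel_ge0// mulr_ge0 ?heat_kernel_ge0.
apply: eq_integral => y _.
rewrite -[RHS]/((heat_kernel (a + b) (esub z y) * f y)%:E) EFinM -(heat_kernel_semigroup z y a0 b0) muleC.
rewrite -ge0_integralZ_EFin//; last 2 first.
- apply: measurable_funM => //.
  exact: (measurableT_comp (@measurable_heat_kernel R n _) (pair2_measurable y)).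
- by move=> x _; rewrite mulr_ge0 ?heat_kernel_ge0.
by apply: eq_integral => x _; congr EFin; ring.
Qed.

(** With k the kernel, k f = (k |y|^{-l/alpha})^{alpha/(alpha+1)} (k |y|^l
    f^{alpha+1})^{1/(alpha+1)}. Hoelder with exponents (alpha+1)/alpha and alpha+1 bounds
    c^{alpha+1} by (C tau^{-l/(2 alpha)})^alpha times the integral to be estimated; hence the
    constant C^{-alpha} and the factor tau^{l/2}. *)
Lemma heat_moment_hoelder (R : realType) n (alpha l : R) : (0 < n)%N -> 0 < alpha -> l / alpha < n%:R ->
  exists2 C : R, 0 < C & forall (tau : R) (x0 : n.-tuple R) (f : n.-tuple R -> R) (c : R),
    0 < tau -> enorm x0 = 0 -> measurable_fun setT f -> (forall y, 0 <= f y) -> 0 <= c ->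
    (c%:E <= \int[lebesgueRn R n]_y (heat_kernel tau (esub x0 y) * f y)%:E)%E ->
    ((C * tau `^ (l / 2) * c `^ (alpha + 1))%:E <=
     \int[lebesgueRn R n]_y (heat_kernel tau (esub x0 y) * (enorm y `^ l * (f y `^ alpha * f y)))%:E)%E.
Proof.
move=> n0 a0 ln; have [C C0 hC] := heat_kernel_moment n0 ln.
have a1 : 0 < alpha + 1 by rewrite addr_gt0.
exists (C `^ (- alpha)); first by rewrite powR_gt0.
move=> tau x0 f c t0 x00 mf f0 c0 cf.
set I := (\int[lebesgueRn R n]_y (heat_kernel tau (esub x0 y) * (enorm y `^ l * (f y `^ alpha * f y)))%:E)%E.
have I0 : (0 <= I)%E by apply: integral_ge0 => y _; rewrite lee_fin !mulr_ge0 ?powR_ge0 ?heat_kernel_ge0.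
have [Ioo|If] := eqVneq I +oo%E; first by rewrite Ioo leey.
have Ifin : I \is a fin_num by rewrite ge0_fin_numE// lt_neqAle If leey.
pose k y := heat_kernel tau (esub x0 y).
have mk : measurable_fun setT k.
  exact: (measurableT_comp (@measurable_heat_kernel R n tau) (pair1_measurable x0)).
have k0 y : 0 <= k y by exact: heat_kernel_ge0.
pose F y := (k y * enorm y `^ (- (l / alpha))) `^ (alpha / (alpha + 1)).
pose G y := (k y * (enorm y `^ l * (f y `^ alpha * f y))) `^ (alpha + 1)^-1.
have mF : measurable_fun setT F.
  apply: (measurableT_comp (measurable_powR _)); apply: measurable_funM => //.
  exact: measurable_enorm_powR.
have mG0 : measurable_fun setT (fun y => k y * (enorm y `^ l * (f y `^ alpha * f y))).
  apply: measurable_funM => //; apply: measurable_funM; first exact: measurable_enorm_powR.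
  apply: measurable_funM => //; exact: (measurableT_comp (measurable_powR _) mf).
have mG : measurable_fun setT G by exact: (measurableT_comp (measurable_powR _) mG0).
have A0 : 0 <= C * tau `^ (- (l / alpha / 2)) by rewrite mulr_ge0 ?powR_ge0 ?ltW.
have pq : ((alpha + 1) / alpha)^-1 + (alpha + 1)^-1 = 1 by field; rewrite !gt_eqF.
have e1 : alpha / (alpha + 1) * ((alpha + 1) / alpha) = 1 by field; rewrite !gt_eqF.
have hF y : F y `^ ((alpha + 1) / alpha) = k y * enorm y `^ (- (l / alpha)).
  by rewrite /F -powRrM e1 powRr1// mulr_ge0 ?powR_ge0.
have hG0 y : 0 <= k y * (enorm y `^ l * (f y `^ alpha * f y)) by rewrite !mulr_ge0 ?powR_ge0.
have hG y : G y `^ (alpha + 1) = k y * (enorm y `^ l * (f y `^ alpha * f y)).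
  by rewrite /G -powRrM mulVf ?gt_eqF// powRr1.
have IF : (\int[lebesgueRn R n]_y (F y `^ ((alpha + 1) / alpha))%:E <= (C * tau `^ (- (l / alpha / 2)))%:E)%E.
  apply: le_trans (hC tau t0 x0 x00); rewrite le_eqVlt; apply/orP; left; apply/eqP.
  by apply: eq_integral => y _; rewrite hF.
have IG : (\int[lebesgueRn R n]_y (G y `^ (alpha + 1))%:E <= (fine I)%:E)%E.
  rewrite fineK// le_eqVlt; apply/orP; left; apply/eqP.
  by apply: eq_integral => y _; rewrite hG.
have h := @hoelder_bound _ _ R (lebesgueRn R n) F G ((alpha + 1) / alpha) (alpha + 1)
  (C * tau `^ (- (l / alpha / 2))) (fine I) mF mG (fun _ => powR_ge0 _ _) (fun _ => powR_ge0 _ _)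
  (divr_gt0 a1 a0) a1 pq A0 (fine_ge0 I0) IF IG.
have {cf}cf : (c%:E <= \int[lebesgueRn R n]_y (F y * G y)%:E)%E.
  apply: le_trans cf _; apply: ae_ge0_le_integral => //.
  - by move=> y _; rewrite lee_fin mulr_ge0 ?heat_kernel_ge0.
  - by apply/measurable_EFinP; exact: measurable_funM.
  - by move=> y _; rewrite lee_fin mulr_ge0 ?powR_ge0.
  - by apply/measurable_EFinP; exact: measurable_funM.
  apply: filterS (@ae_enorm_gt0 R n n0) => y y0 _; rewrite lee_fin le_eqVlt; apply/orP; left; apply/eqP.
  rewrite /F /G -/(k y); have -> : f y `^ alpha * f y = f y `^ (alpha + 1).
    have [->|fy] := eqVneq (f y) 0; first by rewrite mulr0 powR0 ?gt_eqF.
    by rewrite powRD ?fy ?implybT// powRr1.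
  rewrite (powRM _ (k0 y) (powR_ge0 _ _)) (powRM _ (k0 y) (mulr_ge0 (powR_ge0 _ _) (powR_ge0 _ _))).
  rewrite (powRM _ (powR_ge0 _ _) (powR_ge0 _ _)) -!powRrM (mulfV (lt0r_neq0 a1)) (powRr1 (f0 y)).
  have ek : k y `^ (alpha / (alpha + 1)) * k y `^ (alpha + 1)^-1 = k y.
    rewrite -powRD; last by rewrite (_ : alpha / (alpha + 1) + (alpha + 1)^-1 = 1) ?oner_eq0//; field; rewrite gt_eqF.
    by rewrite (_ : alpha / (alpha + 1) + (alpha + 1)^-1 = 1) ?powRr1//; field; rewrite gt_eqF.
  have ee : enorm y `^ (- (l / alpha) * (alpha / (alpha + 1))) * enorm y `^ (l / (alpha + 1)) = 1.
    rewrite -powRD; last by rewrite (gt_eqF y0) implybT.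
    by rewrite (_ : _ + _ = 0) ?powRr0//; field; rewrite !gt_eqF.
  rewrite -[X in X * f y]ek -[LHS]mulr1 -[X in _ * X = _]ee; ring.
have {}h : c <= (C * tau `^ (- (l / alpha / 2))) `^ ((alpha + 1) / alpha)^-1 * fine I `^ (alpha + 1)^-1.
  by rewrite -lee_fin; exact: le_trans cf h.
rewrite -[I]fineK// lee_fin.
have {}h := ge0_ler_powR (ltW a1) c0 _ h.
have {}h : c `^ (alpha + 1) <= C `^ alpha * tau `^ (- (l / 2)) * fine I.
  apply: (le_trans (h _)).
    by rewrite nnegrE mulr_ge0 ?powR_ge0.
  rewrite powRM ?powR_ge0// -!powRrM mulVf ?gt_eqF// (powRr1 (fine_ge0 I0)).
  rewrite (_ : ((alpha + 1) / alpha)^-1 * (alpha + 1) = alpha); last by field; rewrite !gt_eqF.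
  rewrite powRM ?powR_ge0 ?(ltW C0)// -powRrM (_ : - (l / alpha / 2) * alpha = - (l / 2))//.
  by field; rewrite gt_eqF.
apply: le_trans (ler_wpM2l _ h) _; first by rewrite mulr_ge0 ?powR_ge0.
rewrite !powRN; have c1 : C `^ alpha != 0 by rewrite gt_eqF// powR_gt0.
have c2 : tau `^ (l / 2) != 0 by rewrite gt_eqF// powR_gt0.
by rewrite le_eqVlt; apply/orP; left; apply/eqP; field; rewrite c1 c2.
Qed.

(** Two separate lower bounds on v suffice, by the heat flow of w and by the Duhamel term. Tested
    against the kernel at time T - t, they give Y(t) >= Y0 and Y(t) >= \int_0^t Z, the hypotheses of
    [blowup_iteration] on [0, T/2]. *)
Lemma supersolution_mass_bound (R : realType) n (alpha l : R) : (0 < n)%N -> 0 < alpha -> l / alpha < n%:R ->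
  exists2 C : R, 0 < C & forall (T Y0 : R) (x0 : n.-tuple R) (w : n.-tuple R -> R)
      (v : measurableTypeR R * n.-tuple R -> R),
    0 < T -> enorm x0 = 0 -> measurable_fun setT w -> (forall y, 0 <= w y) ->
    measurable_fun setT v -> (forall p, 0 <= v p) ->
    (forall t, 0 < t <= T / 2 -> {ae lebesgueRn R n, forall x,
       (\int[lebesgueRn R n]_y (heat_kernel t (esub x y) * w y)%:E <= (v (t, x))%:E)%E}) ->
    (forall t, 0 < t <= T / 2 -> {ae lebesgueRn R n, forall x,
       (\int[lebesgue_measure]_(s in [set: measurableTypeR R]) (if (0 < s < t)%R then
          \int[lebesgueRn R n]_y (heat_kernel (t - s) (esub x y) *
             (enorm y `^ l * (v (s, y) `^ alpha * v (s, y))))%:E else 0) <= (v (t, x))%:E)%E}) ->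
    (\int[lebesgueRn R n]_y (heat_kernel (T / 2) (esub x0 y) * v (T / 2, y))%:E < +oo)%E ->
    0 <= Y0 -> (Y0%:E <= \int[lebesgueRn R n]_y (heat_kernel T (esub x0 y) * w y)%:E)%E ->
    Y0 `^ alpha <= C * T `^ (- ((2 + l) / 2)).
Proof.
move=> n0 a0 ln; have [C C0 hC] := heat_moment_hoelder n0 a0 ln.
have th1 : 2 `^ (- alpha) < 1 :> R.
  rewrite powRN invf_lt1 ?powR_gt0//.
  have := gt0_ltr_powR a0 (x := 1) (y := 2); rewrite !nnegrE powR1; apply => //.
  by rewrite ltr1n.
have th0 : 0 < 1 - 2 `^ (- alpha) :> R by rewrite subr_gt0.
(* For T/2 <= T - t < T this gives (T - t)^{l/2} >= cl T^{l/2}: the factor 1 serves l < 0 and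
   2^{-l/2} serves l >= 0. *)
pose cl : R := Num.min 1 (2^-1 `^ (l / 2)).
have cl0 : 0 < cl by rewrite lt_min ltr01 powR_gt0.
(* The 4 is the bound 2 of the iteration times the 2 from its interval having length T/2. *)
exists (4 / (C * cl * (1 - 2 `^ (- alpha)))); first by rewrite divr_gt0// !mulr_gt0.
move=> T Y0 x0 w v T0 x00 mw w0 mv v0 H1 H2 Yfin Y00 hY0.
have T20 : 0 < T / 2 by rewrite divr_gt0.
pose F (p : measurableTypeR R * n.-tuple R) := enorm p.2 `^ l * (v p `^ alpha * v p).
have mF : measurable_fun setT F.
  apply: measurable_funM; first exact: (measurableT_comp (measurable_enorm_powR _) measurable_snd).
  by apply: measurable_funM => //; exact: (measurableT_comp (measurable_powR _) mv).
have F0 p : 0 <= F p by rewrite mulr_ge0 ?powR_ge0// mulr_ge0 ?powR_ge0.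
pose Y t := (\int[lebesgueRn R n]_y (heat_kernel (T - t) (esub x0 y) * v (t, y))%:E)%E.
have mvs s : measurable_fun setT (fun y => v (s, y)) by exact: (measurableT_comp mv (pair1_measurable s)).
have mFs s : measurable_fun setT (fun y => F (s, y)) by exact: (measurableT_comp mF (pair1_measurable s)).
have mk t : measurable_fun setT (fun y : n.-tuple R => heat_kernel t (esub x0 y)).
  exact: (measurableT_comp (@measurable_heat_kernel R n t) (pair1_measurable x0)).
have mG t : measurable_fun setT (fun p : (measurableTypeR R * n.-tuple R) * n.-tuple R =>
    (heat_kernel (t - p.1.1) (esub p.1.2 p.2) * F (p.1.1, p.2))%:E).
  apply/measurable_EFinP; apply: measurable_funM; first exact: measurable_heat_kernel_time.
  apply: (measurableT_comp mF); apply: measurable_fun_pair => //.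
  exact: (measurableT_comp measurable_fst measurable_fst).
pose G t (p : measurableTypeR R * n.-tuple R) :=
  (\int[lebesgueRn R n]_y (heat_kernel (t - p.1) (esub p.2 y) * F (p.1, y))%:E)%E.
have mGt t : measurable_fun setT (G t).
  apply: (@measurable_integral_param _ _ _ _ R (lebesgueRn R n) _ (mG t)) => p.
  by rewrite lee_fin mulr_ge0 ?heat_kernel_ge0.
have G0 t p : (0 <= G t p)%E.
  by apply: integral_ge0 => y _; rewrite lee_fin mulr_ge0 ?heat_kernel_ge0.
pose Z (s : measurableTypeR R) := G T (s, x0).
pose kappa := C * cl * T `^ (l / 2).
have kappa0 : 0 < kappa by rewrite !mulr_gt0 ?powR_gt0.
have TtT t : 0 < t <= T / 2 -> T / 2 <= T - t < T.
  by move=> /andP[t0 t2]; rewrite gtrBl t0 andbT; lra.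
have mtail t x : measurable_fun setT (fun s : measurableTypeR R => if (0 < s < t)%R then G t (s, x) else 0%E).
  apply: measurable_fun_ifT => //; first exact: measurable_itv_test.
  exact: (measurableT_comp (mGt t) (pair2_measurable x)).
have YT : (Y (T / 2)%R < +oo)%E by rewrite /Y (_ : T - T / 2 = T / 2)//; field.
have mZ : measurable_fun setT Z by exact: (measurableT_comp (mGt T) (pair2_measurable x0)).
have Z0 s : (0 <= Z s)%E by exact: G0.
have H : kappa * (T / 2) * (1 - 2 `^ (- alpha)) * Y0 `^ alpha <= 2.
  apply: (@blowup_iteration R alpha (T / 2) kappa Y0 Y Z a0 T20 kappa0 Y00 mZ Z0 _ _ _ YT).
  - move=> t tT; have /andP[Tt1 Tt2] := TtT t tT; have /andP[t0 _] := tT.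
    have Tt0 : 0 < T - t by apply: lt_le_trans Tt1.
    apply: le_trans hY0 _; rewrite -[in leLHS](subrK t T).
    rewrite -(heat_semigroup_integral x0 Tt0 t0 mw w0).
    apply: ae_ge0_le_integral => //.
    + move=> x _; rewrite mule_ge0 ?lee_fin ?heat_kernel_ge0//.
      by apply: integral_ge0 => y _; rewrite lee_fin mulr_ge0 ?heat_kernel_ge0.
    + apply: emeasurable_funM; first exact/measurable_EFinP.
      apply: (@measurable_integral_param _ _ _ _ R (lebesgueRn R n)
        (fun p => (heat_kernel t (esub p.1 p.2) * w p.2)%:E)).
        apply/measurable_EFinP; apply: measurable_funM; first exact: measurable_heat_kernel.
        exact: (measurableT_comp mw measurable_snd).
      by move=> p; rewrite lee_fin mulr_ge0 ?heat_kernel_ge0.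
    + by move=> x _; rewrite lee_fin mulr_ge0 ?heat_kernel_ge0.
    + by apply/measurable_EFinP; exact: measurable_funM.
    apply: filterS (H1 t tT) => x hx _.
    by rewrite [leRHS]EFinM lee_wpmul2l ?lee_fin ?heat_kernel_ge0.
  - move=> t tT; have /andP[Tt1 Tt2] := TtT t tT; have /andP[t0 _] := tT.
    have Tt0 : 0 < T - t by apply: lt_le_trans Tt1.
    (* Since T - s = (T - t) + (t - s), the semigroup property turns the integral of Z into the
       Duhamel term at time t tested against the kernel at time T - t. *)
    have -> : (\int[lebesgue_measure]_(s in [set: measurableTypeR R]) (if (0 < s < t)%R then Z s else 0) =
       \int[lebesgue_measure]_(s in [set: measurableTypeR R]) \int[lebesgueRn R n]_x
         ((heat_kernel (T - t) (esub x0 x))%:E * (if (0 < s < t)%R then G t (s, x) else 0)))%E.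
      apply: eq_integral => s _; case: ifPn => [/andP[s0 st]|_].
        rewrite /Z /G/= (_ : T - s = (T - t) + (t - s)); last by ring.
        by rewrite -(heat_semigroup_integral x0 Tt0 _ (mFs s) (fun y => F0 _))// subr_gt0.
      by under eq_integral do rewrite mule0; rewrite integral0.
    rewrite (@fubini_tonelli _ _ (measurableTypeR R) _ R lebesgue_measure (lebesgueRn R n)
      (fun p => (heat_kernel (T - t) (esub x0 p.2))%:E * (if (0 < p.1 < t)%R then G t p else 0))%E)/=; last 2 first.
    + apply: emeasurable_funM.
        by apply/measurable_EFinP; exact: (measurableT_comp (mk _) measurable_snd).
      apply: measurable_fun_ifT => //.
      exact: (measurableT_comp (measurable_itv_test _ _) measurable_fst).
    + by move=> p; rewrite mule_ge0 ?lee_fin ?heat_kernel_ge0//; case: ifP.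
    apply: ae_ge0_le_integral => //.
    + move=> x _; apply: integral_ge0 => s _.
      by rewrite mule_ge0 ?lee_fin ?heat_kernel_ge0//; case: ifP.
    + apply: (@measurable_integral_param _ _ _ (measurableTypeR R) R lebesgue_measure
        (fun p => (heat_kernel (T - t) (esub x0 p.1))%:E * (if (0 < p.2 < t)%R then G t (p.2, p.1) else 0))%E).
        apply: emeasurable_funM.
          by apply/measurable_EFinP; exact: (measurableT_comp (mk _) measurable_fst).
        apply: measurable_fun_ifT => //.
          exact: (measurableT_comp (measurable_itv_test _ _) measurable_snd).
        apply: (measurableT_comp (mGt t)).
        by apply: measurable_fun_pair; [exact: measurable_snd|exact: measurable_fst].
      by move=> p; rewrite mule_ge0 ?lee_fin ?heat_kernel_ge0//; case: ifP.
    + by move=> x _; rewrite lee_fin mulr_ge0 ?heat_kernel_ge0.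
    + by apply/measurable_EFinP; exact: measurable_funM.
    apply: filterS (H2 t tT) => x hx _.
    rewrite ge0_integralZl ?lee_fin ?heat_kernel_ge0//; last by move=> s _; case: ifP.
    by rewrite [leRHS]EFinM lee_wpmul2l ?lee_fin ?heat_kernel_ge0.
  move=> t c tT c0 cY; have /andP[Tt1 Tt2] := TtT t tT.
  have Tt0 : 0 < T - t by apply: lt_le_trans Tt1.
  apply: le_trans (hC (T - t) x0 (fun y => v (t, y)) c Tt0 x00 (mvs t) (fun y => v0 _) c0 cY).
  rewrite lee_fin ler_wpM2r ?powR_ge0// /kappa -mulrA ler_wpM2l ?(ltW C0)//.
  have [l0|l0] := leP 0 (l / 2).
    apply: (@le_trans _ _ ((T / 2) `^ (l / 2))).
      by rewrite powRM ?(ltW T0)// mulrC ler_wpM2l ?powR_ge0// ge_min lexx orbT.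
    by rewrite ge0_ler_powR ?nnegrE ?(ltW T20) ?(ltW Tt0).
  apply: (@le_trans _ _ (T `^ (l / 2))).
    by rewrite ler_piMl ?powR_ge0// ge_min lexx.
  have := @ger_powRN R (- (l / 2)) (T - t) T; rewrite opprK; apply => //.
  - by rewrite oppr_ge0 ltW.
  - exact: ltW.
have P0 : 0 < T `^ ((2 + l) / 2) by rewrite powR_gt0.
rewrite (powRN T) ler_pdivlMr// mulrC ler_pdivlMr; last by rewrite !mulr_gt0.
have e : kappa * T = C * cl * T `^ ((2 + l) / 2).
  rewrite /kappa -mulrA; congr (_ * _); rewrite -{2}(powRr1 (ltW T0)) -powRD; last by rewrite (gt_eqF T0) implybT.
  by congr (_ `^ _); field.
move: H; have -> : kappa * (T / 2) = kappa * T / 2 by ring.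
rewrite e; set P := T `^ _; set y := Y0 `^ _; set z := 1 - _; nra.
Qed.

Lemma wheat_lty (R : realType) n (nu mu alpha tau M : R) (r : \bar R) (g : n.-tuple R -> R) (x : n.-tuple R) :
  (0 < n)%N -> 0 < alpha -> 0 <= nu -> nu <= mu -> ((alpha + 1)%:E < r)%E ->
  mu < n%:R * (1 - (alpha + 1) * fine (r^-1)%E) -> 0 < tau -> 0 <= M ->
  measurable_fun setT g -> (forall y, 0 <= g y) ->
  ('N[lebesgueRn R n]_r[EFin \o g] <= M%:E)%E -> (wheat nu mu alpha tau g x < +oo)%E.
Proof.
move=> n0 a0 nu0 numu ar mun t0 M0 mg g0 hM.
have d0 : 0 < Num.sqrt tau by rewrite sqrtr_gt0.
rewrite -(sqr_sqrtr (ltW t0)).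
case: r ar mun hM => [r||//]; last first.
  move=> _; rewrite invey/= mulr0 subr0 mulr1 => mun /(Lnorm_oo_le _ g0 M0) hM.
  have [C C0 hC] := wheat_Loo n0 a0 nu0 numu mun.
  by apply: le_lt_trans (hC _ _ _ d0 M0 mg g0 hM x) _; rewrite ltry.
rewrite lte_fin => ar; have r0 : 0 < r by apply: lt_trans ar; rewrite addr_gt0.
rewrite inver (gt_eqF r0)/= => mun /(Lnorm_le_integral _ g0 r0 M0) hM.
have [C C0 hC] := wheat_Lr n0 a0 nu0 numu ar mun.
by have [+ _] := hC _ _ _ d0 M0 mg g0 hM; apply.
Qed.

(** Finiteness makes the [fine] inside the real-valued integral faithful. The absolute value gives
    an integrand that is nonnegative everywhere, f being so only almost everywhere. *)
Lemma heat_EFin (R : realType) n (tau : R) (f : n.-tuple R -> R) (x : n.-tuple R) : 0 < tau ->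
  measurable_fun setT f -> {ae lebesgueRn R n, forall y, 0 <= f y} ->
  (\int[lebesgueRn R n]_y (heat_kernel tau (esub x y) * `|f y|)%:E < +oo)%E ->
  (heat tau f x)%:E = (\int[lebesgueRn R n]_y (heat_kernel tau (esub x y) * `|f y|)%:E)%E.
Proof.
move=> t0 mf f0 fin; rewrite /heat t0.
have -> : \int[lebesgueRn R n]_y (heat_kernel tau (esub x y) * f y) =
    fine (\int[lebesgueRn R n]_y (heat_kernel tau (esub x y) * `|f y|)%:E)%E.
  congr fine; apply: ae_eq_integral => //.
  - by apply/measurable_EFinP; exact: measurable_heat_integrand.
  - by apply/measurable_EFinP; apply: measurable_heat_integrand; exact: measurableT_comp.
  by apply: filterS f0 => y fy _; rewrite ger0_norm.
rewrite fineK// ge0_fin_numE//; apply: integral_ge0 => y _.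
by rewrite lee_fin mulr_ge0 ?heat_kernel_ge0.
Qed.

(** Rewrites the real-valued equation, whose integrals carry default values, as an identity between
    integrals of nonnegative extended functions of the jointly measurable [v], the form in which
    Tonelli can be used. *)
Lemma nonneg_solution_duhamel (R : realType) n (l alpha nu T : R) (r : \bar R)
    (u0 : n.-tuple R -> R) (u : R -> n.-tuple R -> R) (v : measurableTypeR R * n.-tuple R -> R) :
  (0 < n)%N -> 0 < alpha -> 0 <= nu -> nu < nu * (alpha + 1) - l -> ((alpha + 1)%:E < r)%E ->
  nu * (alpha + 1) - l < n%:R * (1 - (alpha + 1) * fine (r^-1)%E) ->
  measurable_fun setT u0 -> {ae lebesgueRn R n, forall x, 0 <= u0 x} ->
  (forall t x, 0 < t -> (\int[lebesgueRn R n]_y (heat_kernel t (esub x y) * `|u0 y|)%:E < +oo)%E) ->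
  measurable_fun setT v -> (forall p, 0 <= v p) ->
  (forall s, 0 < s <= T -> measurable_fun setT (u s)) ->
  (forall s, 0 < s <= T -> {ae lebesgueRn R n, forall x, v (s, x) = u s x}) ->
  (forall t, 0 < t <= T -> (Lwnorm r nu (u t) < +oo)%E) ->
  (forall t, 0 < t <= T -> {ae lebesgueRn R n, forall x,
     lebesgue_measure.-integrable `[0, t] (fun s => (heat (t - s) (nonlin l alpha (u s)) x)%:E) /\
     u t x = heat t u0 x + \int[lebesgue_measure]_(s in `[0, t]) heat (t - s) (nonlin l alpha (u s)) x}) ->
  forall t, 0 < t <= T -> {ae lebesgueRn R n, forall x,
    (v (t, x))%:E = (\int[lebesgueRn R n]_y (heat_kernel t (esub x y) * `|u0 y|)%:E +
      \int[lebesgue_measure]_(s in [set: measurableTypeR R]) (if (0 < s < t)%R then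
          \int[lebesgueRn R n]_y (heat_kernel (t - s) (esub x y) *
             (enorm y `^ l * (v (s, y) `^ alpha * v (s, y))))%:E else 0))%E}.
Proof.
move=> n0 a0 nu0 numu ar mun mu0 u00 ufin mv v0 mu_ vu ur heq t /[dup] tT /andP[t0 tleT].
have mvs s : measurable_fun setT (fun y => v (s, y)) by exact: (measurableT_comp mv (pair1_measurable s)).
apply: filterS3 (heq t tT) (vu t tT) (@ae_enorm_gt0 R n n0) => x [hint ut] vut x0.
have mF : measurable_fun setT (fun p : measurableTypeR R * n.-tuple R => enorm p.2 `^ l * (v p `^ alpha * v p)).
  apply: measurable_funM; first exact: (measurableT_comp (measurable_enorm_powR _) measurable_snd).
  by apply: measurable_funM => //; exact: (measurableT_comp (measurable_powR _) mv).
pose G (s : measurableTypeR R) := (\int[lebesgueRn R n]_y (heat_kernel (t - s) (esub x y) *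
             (enorm y `^ l * (v (s, y) `^ alpha * v (s, y))))%:E)%E.
have mG : measurable_fun setT G.
  apply: (@measurable_integral_param _ _ (measurableTypeR R) _ R (lebesgueRn R n)
    (fun p => (heat_kernel (t - p.1) (esub x p.2) * (enorm p.2 `^ l * (v p `^ alpha * v p)))%:E)); last first.
    by move=> p; rewrite lee_fin mulr_ge0 ?heat_kernel_ge0// mulr_ge0 ?powR_ge0// mulr_ge0 ?powR_ge0.
  apply/measurable_EFinP; apply: measurable_funM => //.
  have mh : measurable_fun setT (fun p : measurableTypeR R * n.-tuple R => ((p.1, x), p.2)).
    apply: measurable_fun_pair; last exact: measurable_snd.
    by apply: measurable_fun_pair => //; exact: measurable_fst.
  exact: (measurableT_comp (@measurable_heat_kernel_time R n t) mh).
have hG s : 0 < s < t -> (heat (t - s) (nonlin l alpha (u s)) x)%:E = G s.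
  move=> /andP[s0 st].
  have sT : 0 < s <= T by rewrite s0; exact: ltW (lt_le_trans st tleT).
  have ts : 0 < t - s by rewrite subr_gt0.
  have vus := vu s sT.
  have mus := mu_ s sT.
  have eG : (\int[lebesgueRn R n]_y (heat_kernel (t - s) (esub x y) * `|nonlin l alpha (u s) y|)%:E = G s)%E.
    apply: ae_eq_integral => //.
    - apply/measurable_EFinP; apply: measurable_heat_integrand; apply: measurableT_comp => //.
      exact: measurable_nonlin.
    - apply/measurable_EFinP; apply: measurable_heat_integrand.
      exact: (measurableT_comp mF (pair1_measurable s)).
    apply: filterS vus => y vy _; rewrite /nonlin -vy (ger0_norm (v0 _)) ger0_norm//.
    by rewrite mulr_ge0 ?powR_ge0// mulr_ge0 ?powR_ge0.
  rewrite -eG; apply: heat_EFin => //; first exact: measurable_nonlin.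
    by apply: filterS vus => y vy; rewrite /nonlin -vy mulr_ge0 ?powR_ge0// mulr_ge0 ?powR_ge0.
  rewrite eG.
  pose g y := enorm y `^ nu * v (s, y).
  have mg : measurable_fun setT g by apply: measurable_funM => //; exact: measurable_enorm_powR.
  have g0 y : 0 <= g y by rewrite mulr_ge0 ?powR_ge0.
  have r0 : (0 < r)%E by apply: lt_trans ar; rewrite lte_fin addr_gt0.
  have gM : ('N[lebesgueRn R n]_r[EFin \o g] <= (fine (Lwnorm r nu (u s)))%:E)%E.
    rewrite fineK; last by rewrite ge0_fin_numE ?ur// /Lwnorm Lnorm_ge0.
    rewrite Lwnorm_wabs; apply: Lnorm_le_ae => //.
    - exact: measurable_wabs.
    - exact: wabs_ge0.
    by apply: filterS vus => y vy; rewrite /g vy /wabs ler_wpM2l ?powR_ge0 ?ler_norm.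
  (* The L^r_nu bound makes |x|^nu times the inner integral finite; the weight is then removed
     because x is not the origin. *)
  have := wheat_lty x n0 a0 nu0 (ltW numu) ar mun ts (fine_ge0 (Lnorm_ge0 _ _ _)) mg g0 gM.
  rewrite wheat_nu// => wfin.
  have -> : G s = wheat 0 (nu * (alpha + 1) - l) alpha (t - s) g x.
    apply: ae_eq_integral => //.
    - apply/measurable_EFinP; apply: measurable_heat_integrand.
      exact: (measurableT_comp mF (pair1_measurable s)).
    - apply/measurable_EFinP.
      exact: (measurableT_comp (measurable_wheat_integrand 0 (nu * (alpha + 1) - l) alpha (t - s) mg) (pair1_measurable x)).
    by apply: filterS (@ae_enorm_gt0 R n n0) => y y0 _; rewrite powRr0 mul1r /g wheat0_nonlin.
  rewrite ltey; apply/eqP => woo; move: wfin.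
  by rewrite woo gt0_muley ?lte_fin ?powR_gt0.
have mI : measurable (`[0, t]%classic : set (measurableTypeR R)) by exact: measurable_itv.
rewrite vut ut EFinD heat_EFin ?ufin//; congr (_ + _)%E.
rewrite fineK; last by apply: integrable_fin_num hint; exact: mI.
rewrite [RHS](_ : _ = \int[lebesgue_measure]_(s in `[0%R, t]) (if (0 < s < t)%R then G s else 0))%E; last first.
  rewrite [RHS]integral_mkcond; apply: eq_integral => s _; rewrite patchE mem_setE in_itv/=.
  case: ifPn => [/andP[s0 st]|_]; first by rewrite (ltW s0) (ltW st).
  by case: ifP.
apply: ae_eq_integral => //.
- by case/integrableP : hint.
- by apply: measurable_funTS; apply: measurable_fun_ifT => //; exact: measurable_itv_test.
have ne c : {ae (lebesgue_measure : {measure set (measurableTypeR R) -> \bar R}), forall s, s != c}.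
  exists [set c]; split => //; first exact: lebesgue_measure_set1.
  by move=> s /= /negP; rewrite negbK => /eqP.
apply: filterS2 (ne 0) (ne t) => s s0 st; rewrite /= in_itv/= => /andP[h3 h4].
have st' : 0 < s < t by rewrite !lt_neqAle eq_sym s0 st h3.
by rewrite st' hG.
Qed.

Lemma fine_inve_ge0 (R : realType) (q : \bar R) : (0 < q)%E -> 0 <= fine (q^-1)%E.
Proof. by move=> q0; rewrite fine_ge0// inve_ge0 ltW. Qed.

(** The lower bound on nu gives mu > gamma > nu, and the upper bound on 1/r gives the conditions on
    r. The lower bound on 1/r gives beta (alpha + 1) < (alpha (n/q + gamma) - l)/2, while the last
    expression equals (alpha (n/q + gamma) - l)/2, 1/r cancelling. Both are below 1 because n/q +
    gamma < n and alpha n < 2 + l. *)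
Lemma admissible_exponents_bounds (R : realType) n (l alpha gamma nu : R) (q r : \bar R) :
  (0 < n)%N -> 0 < alpha -> alpha * n%:R < 2 + l -> 0 < gamma < n%:R ->
  ((n%:R / (n%:R - gamma))%:E < q)%E -> admissible_exponents n l alpha q gamma r nu ->
  let mu := nu * (alpha + 1) - l in let beta := betal n q gamma r nu in
  [/\ 0 < nu, nu < mu, ((alpha + 1)%:E < r)%E, mu < n%:R * (1 - (alpha + 1) * fine (r^-1)%E) &
   [/\ 0 < beta, beta * (alpha + 1) < 1 &
     (mu - nu) / 2 + n%:R * alpha / 2 * fine (r^-1)%E + alpha * beta < 1]].
Proof.
move=> n0 a0 al /andP[g0 gn] gq [/andP[nu0 nug] /andP[h1 h2] qr /andP[h3 h4]] mu; rewrite /betal /=.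
have n0' : 0 < n%:R :> R by rewrite ltr0n.
have a1 : 0 < alpha + 1 by rewrite addr_gt0.
have ng : 0 < n%:R - gamma by rewrite subr_gt0.
have q0 : (0 < q)%E by apply: le_lt_trans gq; rewrite lee_fin divr_ge0 ?ler0n ?ltW.
have r0 : (0 < r)%E by move: qr; case: ifPn => [_ ->//|_]; exact: lt_trans.
set iq := fine (q^-1)%E in h3 *; set ir := fine (r^-1)%E in h3 h4 *.
have ir0 : 0 <= ir by exact: fine_inve_ge0.
have hiq : n%:R * iq + gamma < n%:R.
  rewrite /iq; case: (q) q0 gq => [p||//]; last by rewrite invey/= mulr0 add0r.
  rewrite !lte_fin => p0; rewrite inver (gt_eqF p0)/= ltr_pdivrMr// => hp.
  by rewrite -ltrBrDr ltr_pdivrMr// mulrC.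
have hir : ir <= iq.
  rewrite /ir /iq; move: qr; case: ifPn => [/eqP -> ->//|_].
  case: (r) r0 => [r'||//] r0; last by rewrite invey/= fine_inve_ge0.
  move: r0; case: (q) q0 => [p||//]; rewrite // !lte_fin => p0 r0 pr.
  by rewrite !inver (gt_eqF p0) (gt_eqF r0)/= lef_pV2 ?posrE// ltW.
move: h1 h2; rewrite ltr_pdivrMr// ltr_pdivlMr// => h1 h2.
have {}h4 : n%:R * (alpha + 1) * ir < n%:R - mu.
  have na : 0 < n%:R * (alpha + 1) by rewrite mulr_gt0.
  by move: h4; rewrite ltr_pdivlMr// /mu => h4; lra.
have {}h3 : n%:R * iq - (mu - gamma) < n%:R * (alpha + 1) * ir.
  have na : 0 < n%:R * (alpha + 1) by rewrite mulr_gt0.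
  move: h3; rewrite -(ltr_pM2r na) [X in X < _ -> _](_ : _ = n%:R * iq - (mu - gamma)).
    by rewrite [ir * _]mulrC.
  by rewrite /mu; field; rewrite !gt_eqF.
have numu : nu < mu by rewrite /mu; lra.
have hb : alpha * (n%:R * iq + gamma) < 2 + l.
  by apply: lt_trans al; rewrite ltr_pM2l.
split => //.
- case: (r) r0 @ir ir0 hir h3 h4 => [r'||//] r0 ir _ _ _ h4; last by rewrite ltry.
  rewrite lte_fin in r0; move: h4; rewrite /ir inver (gt_eqF r0)/= lte_fin => h4.
  have : n%:R * ((alpha + 1) / r') < n%:R * 1 by rewrite mulrA; lra.
  by rewrite ltr_pM2l// ltr_pdivrMr// mul1r.
- by lra.
split.
- have : 0 <= n%:R / 2 * (iq - ir) by rewrite !mulr_ge0 ?ler0n ?subr_ge0.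
  by lra.
- set A := n%:R * iq in h3 hb; set B := n%:R * (alpha + 1) * ir in h3.
  have -> : (n%:R / 2 * (iq - ir) + (gamma - nu) / 2) * (alpha + 1) =
     (alpha * A + A - B + (gamma - nu) * (alpha + 1)) / 2 by rewrite /A /B; field.
  rewrite ltr_pdivrMr// mul1r; move: hb h3; rewrite /mu => hb h3.
  by lra.
rewrite /mu.
have -> : (nu * (alpha + 1) - l - nu) / 2 + n%:R * alpha / 2 * ir +
    alpha * (n%:R / 2 * (iq - ir) + (gamma - nu) / 2) = (alpha * (n%:R * iq + gamma) - l) / 2 by field.
by rewrite ltr_pdivrMr// mul1r; lra.
Qed.

Lemma solution_mass_bound (R : realType) n (l alpha gamma nu : R) (q r : \bar R) :
  (0 < n)%N -> 0 < alpha -> alpha * n%:R < 2 + l -> 0 < gamma < n%:R -> l / alpha < gamma ->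
  ((n%:R / (n%:R - gamma))%:E < q)%E -> admissible_exponents n l alpha q gamma r nu ->
  exists2 C : R, 0 < C & forall (T Y0 : R) (x0 : n.-tuple R) (u0 : n.-tuple R -> R) (u : R -> n.-tuple R -> R),
    0 < T -> enorm x0 = 0 -> Lw q gamma u0 -> {ae lebesgueRn R n, forall x, 0 <= u0 x} ->
    is_solution l alpha q gamma r nu u0 T u ->
    0 <= Y0 -> (Y0%:E <= \int[lebesgueRn R n]_y (heat_kernel T (esub x0 y) * `|u0 y|)%:E)%E ->
    Y0 `^ alpha <= C * T `^ (- ((2 + l) / 2)).
Proof.
move=> n0 a0 al g0n lg gq hexp.
have [nu0 numu ar mun [be0 be1 ab1]] := admissible_exponents_bounds n0 a0 al g0n gq hexp.
have g0n' : 0 <= gamma < n%:R by case/andP: g0n => /ltW -> ->.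
have q0 : (0 < q)%E.
  by apply: le_lt_trans gq; case/andP: g0n => g0 gn; rewrite lee_fin divr_ge0 ?ler0n// subr_ge0 ltW.
have ln : l / alpha < n%:R by case/andP: g0n => _; exact: lt_trans.
have [C C0 hC] := supersolution_mass_bound n0 a0 ln; exists C => //.
move=> T Y0 x0 u0 u T0 x00 Lu0 u00 [uLw ucont _ [M uM] ueq] Y00 hY0.
have tI t : 0 < t <= T -> time_interval q T t.
  by move=> /andP[t0 tT]; rewrite /time_interval; case: ifP => _ /=; rewrite in_itv/= tT ?t0 ?(ltW t0).
have mu_ s : 0 < s <= T -> measurable_fun setT (u s) by move=> sT; have [] := uLw s (tI s sT).
have mu0 : measurable_fun setT u0 by case: Lu0.
have ueq' t (tT : 0 < t <= T) := ueq t (tI t tT).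
have cont t : 0 < t <= T -> forall e : R, 0 < e -> exists2 delta : R, 0 < delta &
     forall s, 0 < s <= T -> `|s - t| < delta -> (Lwnorm q gamma (u s \- u t)%R <= e%:E)%E.
  move=> tT e e0; have e0' : (0 < e%:E :> \bar R)%E by rewrite lte_fin.
  have := ucont t (tI t tT) _ (open_ereal_lt' e0').
  rewrite /= /nbhs/= /within => /nbhs_ballP[d /= d0 hd]; exists d => // s sT st.
  by apply/ltW/hd; [rewrite /ball/= distrC|exact: tI].
have [v' [mv' v'u]] := joint_version n0 q0 mu_ cont.
have uM' t : 0 < t <= T -> ((t `^ betal n q gamma r nu)%:E * Lwnorm r nu (u t) <= M%:E)%E.
  by move=> tT; have [] := uM t tT.
have upos := solution_nonneg n0 a0 (ltW nu0) numu ar mun be0 be1 ab1 T0 mu0 u00 mv' mu_ v'u uM' ueq'.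
(* At each time [v'] equals the nonnegative u only almost everywhere; the absolute value makes it
   nonnegative at every point. *)
pose v p := `|v' p|.
have mv : measurable_fun setT v by exact: measurableT_comp.
have v0 p : 0 <= v p by exact: normr_ge0.
have vu s : 0 < s <= T -> {ae lebesgueRn R n, forall x, v (s, x) = u s x}.
  by move=> sT; apply: filterS2 (v'u s sT) (upos s sT) => x e us; rewrite /v e ger0_norm.
have ufin t x : 0 < t -> (\int[lebesgueRn R n]_y (heat_kernel t (esub x y) * `|u0 y|)%:E < +oo)%E.
  by move=> t0; exact: heat_Lw_lty Lu0.
have ur t : 0 < t <= T -> (Lwnorm r nu (u t) < +oo)%E.
  by move=> tT; have [+ _] := uM t tT; exact: Lw_norm_lty.
have duh := nonneg_solution_duhamel n0 a0 (ltW nu0) numu ar mun mu0 u00 ufin mv v0 mu_ vu ur ueq'.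
have T2 : 0 < T / 2 <= T by rewrite divr_gt0//=; lra.
have half t : 0 < t <= T / 2 -> 0 < t <= T.
  by case/andP=> -> /=; case/andP: T2 => _ h /le_trans; apply.
have H0 t x : (0 <= \int[lebesgueRn R n]_y (heat_kernel t (esub x y) * `|u0 y|)%:E)%E.
  by apply: integral_ge0 => y _; rewrite lee_fin mulr_ge0 ?heat_kernel_ge0.
apply: (hC T Y0 x0 (fun y => `|u0 y|) v) => //.
- exact: measurableT_comp.
- move=> t tT; apply: filterS (duh t (half t tT)) => x ->; apply: leeDl.
  apply: integral_ge0 => s _; case: ifP => // _; apply: integral_ge0 => y _.
  by rewrite lee_fin mulr_ge0 ?heat_kernel_ge0// mulr_ge0 ?powR_ge0// mulr_ge0 ?powR_ge0.
- by move=> t tT; apply: filterS (duh t (half t tT)) => x ->; apply: leeDr.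
(* The tested mass at T/2 is a heat integral of u(T/2), which lies in L^q_gamma; this is why it is
   finite. *)
rewrite (_ : (\int[_]_y _)%E =
   (\int[lebesgueRn R n]_y (heat_kernel (T / 2) (esub x0 y) * `|u (T / 2) y|)%:E)%E).
  by apply: heat_Lw_lty gq _ _ => //; [case/andP: T2|exact/uLw/tI].
apply: ae_eq_integral => //.
- apply/measurable_EFinP; apply: measurable_heat_integrand.
  exact: (measurableT_comp mv (pair1_measurable _)).
- apply/measurable_EFinP; apply: measurable_heat_integrand; apply: measurableT_comp => //.
  exact: mu_.
apply: filterS2 (vu _ T2) (upos _ T2) => y -> uy _.
by rewrite ger0_norm.
Qed.

(** * Homogeneous data and the existence time *)

(** The substitution y = rho z and homogeneity give D(rho) = rho^{n-gamma} D(1). If D(1) were 0,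
    omega would vanish almost everywhere on every annulus of dyadic outer radius; these cover
    everything but the origin, so omega would vanish almost everywhere. *)
Lemma annulus_mass (R : realType) n (omega : n.-tuple R -> R) (gamma : R) : (0 < n)%N ->
  measurable_fun setT omega -> homogeneous0 omega ->
  ~ {ae lebesgueRn R n, forall x, omega x = 0} ->
  exists2 c : R, 0 < c & forall rho : R, 0 < rho ->
    ((c * rho `^ (n%:R - gamma))%:E <= \int[lebesgueRn R n]_y
       (if (rho / 2 <= enorm y <= rho)%R then `|omega y| * enorm y `^ (- gamma) else 0)%:E)%E.
Proof.
move=> n0 mo ho on0.
pose f rho (y : n.-tuple R) : R :=
  if rho / 2 <= enorm y <= rho then `|omega y| * enorm y `^ (- gamma) else 0.
have f0 rho y : 0 <= f rho y by rewrite /f; case: ifP => // _; rewrite mulr_ge0 ?powR_ge0.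
have mf rho : measurable_fun setT (f rho).
  apply: measurable_fun_ifT => //.
    apply: measurable_and.
      by apply: measurable_fun_ler => //; exact: measurable_enorm.
    by apply: measurable_fun_ler => //; exact: measurable_enorm.
  by apply: measurable_funM; [exact: measurableT_comp|exact: measurable_enorm_powR].
pose D rho := (\int[lebesgueRn R n]_y (f rho y)%:E)%E.
have D0 rho : (0 <= D rho)%E by apply: integral_ge0 => y _; rewrite lee_fin.
have scale rho : 0 < rho -> D rho = ((rho `^ (n%:R - gamma))%:E * D 1%R)%E.
  move=> r0; have ri0 : 0 < rho^-1 by rewrite invr_gt0.
  have := @ge0_integral_escale R n rho^-1 (EFin \o f 1) ri0.
  move=> /(_ _ _)/= => H.
  have -> : D rho = ((rho `^ (- gamma))%:E * \int[lebesgueRn R n]_y (f 1%R (escale rho^-1%R y))%:E)%E.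
    rewrite -ge0_integralZ_EFin ?powR_ge0//; last first.
      exact: (measurableT_comp (mf 1) (@measurable_escale R n _)).
    apply: eq_integral => y _; congr EFin; rewrite /f enorm_escale ?(ltW ri0)// ho//.
    have -> : (1 / 2 <= rho^-1 * enorm y <= 1) = (rho / 2 <= enorm y <= rho).
      by rewrite [_^-1 * enorm y]mulrC ler_pdivlMr// [X in _ && X]ler_pdivrMr// !mul1r [2^-1 * rho]mulrC.
    case: ifP => _; last by rewrite mulr0.
    rewrite powRM ?enorm_ge0 ?(ltW ri0)// -[in RHS](powR_inv1 (ltW r0)) -powRrM mulN1r opprK.
    by rewrite (powRN rho); field; rewrite gt_eqF// powR_gt0.
  rewrite H; last 2 first.
  - by apply/measurable_EFinP; exact: mf.
  - by move=> y; rewrite lee_fin.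
  rewrite muleA -EFinM; congr (_%:E * _)%E.
  rewrite exprVn invrK -powR_mulrn ?(ltW r0)// -powRD; last by rewrite (gt_eqF r0) implybT.
  by rewrite addrC.
suff D1 : (0 < D 1%R)%E.
  (* If the mass of the unit annulus is infinite, any positive constant serves. *)
  have [Doo|Df] := eqVneq (D 1%R) +oo%E.
    exists 1 => // rho r0; rewrite -[leRHS]/(D rho) scale// Doo gt0_muley ?leey//.
    by rewrite lte_fin powR_gt0.
  have Dfin : D 1%R \is a fin_num by rewrite ge0_fin_numE// lt_neqAle Df leey.
  exists (fine (D 1%R)); first by rewrite fine_gt0// D1 lt_neqAle Df leey.
  by move=> rho r0; rewrite -[leRHS]/(D rho) (scale _ r0) EFinM (fineK Dfin) muleC lexx.
rewrite lt_neqAle D0 andbT; apply/eqP => D1.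
have Dz rho : 0 < rho -> {ae lebesgueRn R n, forall y, f rho y = 0}.
  move=> r0; have : D rho = 0%E by rewrite scale// -D1 mule0.
  have -> : D rho = (\int[lebesgueRn R n]_y `|(f rho y)%:E|)%E.
    by apply: eq_integral => y _; rewrite gee0_abs// lee_fin.
  move/ae_eq_integral_abs => /(_ measurableT (ltac:(by apply/measurable_EFinP))).
  by apply: filterS => y /(_ I) [].
have Dk : {ae lebesgueRn R n, forall y, forall k m : nat, f (2^-1 ^+ k * 2 ^+ m) y = 0}.
  apply: ae_foralln => k; apply: ae_foralln => m; apply: Dz.
  by rewrite mulr_gt0 ?exprn_gt0.
apply: on0; apply: filterS2 Dk (@ae_enorm_gt0 R n n0) => y hy y0.
pose m := Num.bound (enorm y).
have ym : enorm y <= 2 ^+ m.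
  have := archi_boundP (enorm_ge0 y) => /ltW /le_trans; apply.
  by rewrite -natrX ler_nat ltnW// ltn_expl.
have [k /andP[k1 k2]] := @dyadic_bracket R (enorm y) (2 ^+ m) (ltac:(by rewrite y0 ym)).
have := hy k m; rewrite /f k2 andbT.
have -> : 2^-1 ^+ k * 2 ^+ m / 2 <= enorm y by apply: le_trans (ltW k1); rewrite exprS; lra.
by move/eqP; rewrite mulf_eq0 powR_eq0 (gt_eqF y0)/= orbF normr_eq0 => /eqP.
Qed.

(** For |y| <= rho <= sqrt(T) the Gaussian factor is at least exp(-1/4), so on the annulus the
    kernel is bounded below by a constant times T^{-n/2}. *)
Lemma heat_annulus_ge (R : realType) n (omega : n.-tuple R -> R) (gamma : R) : (0 < n)%N ->
  measurable_fun setT omega -> homogeneous0 omega -> {ae lebesgueRn R n, forall x, 0 <= omega x} ->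
  ~ {ae lebesgueRn R n, forall x, omega x = 0} ->
  exists2 c : R, 0 < c & forall (T rho lambda : R) (u0 : n.-tuple R -> R) (x0 : n.-tuple R),
    0 < T -> 0 < rho -> rho ^+ 2 <= T -> 0 <= lambda -> enorm x0 = 0 -> measurable_fun setT u0 ->
    {ae lebesgueRn R n, forall y, rho / 2 <= enorm y <= rho ->
       lambda * (omega y * enorm y `^ (- gamma)) <= u0 y} ->
    ((lambda * (c * rho `^ (n%:R - gamma)) * T `^ (- (n%:R / 2)))%:E <=
      \int[lebesgueRn R n]_y (heat_kernel T (esub x0 y) * `|u0 y|)%:E)%E.
Proof.
move=> n0 mo ho o0 on0; have [c c0 hc] := annulus_mass gamma n0 mo ho on0.
have p0 := @pi_gt0 R.
pose k : R := (4 * pi) `^ (- (n%:R / 2)) * expR (- 4^-1).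
have k0 : 0 < k by rewrite mulr_gt0 ?powR_gt0 ?expR_gt0// mulr_gt0.
exists (k * c); first by rewrite mulr_gt0.
move=> T rho lambda u0 x0 T0 r0 rT la0 x00 mu0 hu.
pose f (y : n.-tuple R) : R :=
  if rho / 2 <= enorm y <= rho then `|omega y| * enorm y `^ (- gamma) else 0.
have f0 y : 0 <= f y by rewrite /f; case: ifP => // _; rewrite mulr_ge0 ?powR_ge0.
have mf : measurable_fun setT f.
  apply: measurable_fun_ifT => //.
    apply: measurable_and.
      by apply: measurable_fun_ler => //; exact: measurable_enorm.
    by apply: measurable_fun_ler => //; exact: measurable_enorm.
  by apply: measurable_funM; [exact: measurableT_comp|exact: measurable_enorm_powR].
have kT0 : 0 <= lambda * k * T `^ (- (n%:R / 2)) by rewrite !mulr_ge0 ?powR_ge0// ltW.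
apply: (@le_trans _ _ (\int[lebesgueRn R n]_y (lambda * k * T `^ (- (n%:R / 2)) * f y)%:E)%E).
  rewrite ge0_integralZ_EFin//; apply: le_trans (lee_wpmul2l _ (hc rho r0)); last by rewrite lee_fin.
  by rewrite -EFinM lee_fin le_eqVlt; apply/orP; left; apply/eqP; ring.
apply: ae_ge0_le_integral => //.
- by move=> y _; rewrite lee_fin mulr_ge0.
- by apply/measurable_EFinP; exact: measurable_funM.
- by move=> y _; rewrite lee_fin mulr_ge0 ?heat_kernel_ge0.
- by apply/measurable_EFinP; apply: measurable_heat_integrand; exact: measurableT_comp.
apply: filterS2 hu o0 => y huy oy _; rewrite lee_fin /f.
case: ifPn => [yr|_]; last by rewrite mulr0 mulr_ge0 ?heat_kernel_ge0.
have {}huy := huy yr.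
have hk : k * T `^ (- (n%:R / 2)) <= heat_kernel T (esub x0 y).
  rewrite heat_kernelE powRM ?(ltW T0) ?mulr_ge0 ?(ltW p0)//.
  rewrite /k -!mulrA ler_wpM2l ?powR_ge0// mulrC ler_wpM2l ?powR_ge0//.
  rewrite ler_expR lerN2.
  have -> : enorm (esub x0 y) ^+ 2 = enorm y ^+ 2.
    rewrite enorm_esub_sqr enorm_sqr; apply: eq_bigr => i _.
    by rewrite (enorm_eq0 x00) tnth_nseq sub0r sqrrN.
  rewrite mulrC ler_pdivrMr ?mulr_gt0//.
  rewrite (_ : 4^-1 * (4 * T) = T); last by field.
  apply: le_trans rT; rewrite ler_pXn2r ?nnegrE ?enorm_ge0 ?(ltW r0)//.
  by case/andP: yr.
have hf : lambda * (`|omega y| * enorm y `^ (- gamma)) <= `|u0 y|.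
  by rewrite (ger0_norm oy); apply: le_trans huy (ler_norm _).
have := ler_pM _ _ hk hf; rewrite !mulr_ge0 ?powR_ge0 ?(ltW k0)//.
by move=> /(_ isT isT); apply: le_trans; rewrite le_eqVlt; apply/orP; left; apply/eqP; ring.
Qed.

(** Taking alpha-th roots leaves T^k <= C^{1/alpha} / (c lambda) with k = (2+l)/(2 alpha) - b/2. The
    lemma is used with b = gamma when rho = sqrt(T), since then rho^{N-gamma} T^{-N/2} =
    T^{-gamma/2}, and with b = N when rho is fixed. *)
Lemma existence_time_le (R : realType) (alpha l b C c : R) : 0 < alpha -> 0 < C -> 0 < c ->
  0 < (2 + l) / (2 * alpha) - b / 2 ->
  exists2 K : R, 0 < K & forall lambda T : R, 0 < lambda -> 0 < T ->
    (lambda * c * T `^ (- (b / 2))) `^ alpha <= C * T `^ (- ((2 + l) / 2)) ->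
    T <= K * lambda `^ (- ((2 + l) / (2 * alpha) - b / 2)^-1).
Proof.
move=> a0 C0 c0; set k := (_ - _) => k0.
exists ((C `^ alpha^-1 / c) `^ k^-1); first by rewrite powR_gt0// divr_gt0// powR_gt0.
move=> lambda T la0 T0 h.
have P0 : 0 < T `^ (b / 2) by rewrite powR_gt0.
have {h} : lambda * c * T `^ (- (b / 2)) <= C `^ alpha^-1 * T `^ (- ((2 + l) / (2 * alpha))).
  have ai : 0 <= alpha^-1 by rewrite invr_ge0 ltW.
  have := ge0_ler_powR ai _ _ h; rewrite !nnegrE powR_ge0 mulr_ge0 ?powR_ge0 ?(ltW C0)//.
  move=> /(_ isT isT); rewrite -powRrM mulfV ?gt_eqF// powRr1; last first.
    by rewrite !mulr_ge0 ?powR_ge0 ?ltW.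
  rewrite powRM ?powR_ge0 ?(ltW C0)// -powRrM => h1; apply: le_trans h1 _.
  by rewrite (_ : - ((2 + l) / 2) * alpha^-1 = - ((2 + l) / (2 * alpha)))//; field; rewrite gt_eqF.
have Tk : T `^ ((2 + l) / (2 * alpha)) = T `^ k * T `^ (b / 2).
  by rewrite -powRD ?subrK// (gt_eqF T0) implybT.
rewrite !powRN Tk ler_pdivlMr ?mulr_gt0 ?powR_gt0// => h.
have {}h : lambda * c * T `^ k <= C `^ alpha^-1.
  apply: le_trans h; rewrite le_eqVlt; apply/orP; left; apply/eqP; field.
  by rewrite gt_eqF.
have {}h : T `^ k <= C `^ alpha^-1 / c * lambda^-1.
  rewrite ler_pdivlMr// ler_pdivlMr//; apply: le_trans h; rewrite le_eqVlt; apply/orP; left; apply/eqP; ring.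
have ki : 0 <= k^-1 by rewrite invr_ge0 ltW.
have := ge0_ler_powR ki _ _ h; rewrite !nnegrE powR_ge0 !mulr_ge0 ?powR_ge0 ?invr_ge0 ?(ltW c0) ?(ltW la0)//.
move=> /(_ isT isT); rewrite -powRrM mulfV ?gt_eqF// powRr1 ?(ltW T0)//.
rewrite powRM ?mulr_ge0 ?powR_ge0 ?invr_ge0 ?(ltW c0) ?(ltW la0)//.
by rewrite -(powR_inv1 (ltW la0)) -powRrM mulN1r powRN.
Qed.

Lemma Lw_scale (R : realType) n (q : \bar R) (gamma lambda : R) (f : n.-tuple R -> R) : (1 <= q)%E ->
  Lw q gamma f -> Lw q gamma (fun x => lambda * f x).
Proof.
move=> q1 [mf Lf]; split; first exact: measurable_funM.
have [L0 LD] := Lfun_submod_closed (lebesgueRn R n) q1.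
rewrite (_ : weighted _ _ = lambda *: weighted gamma f + 0); first exact: LD.
by apply/funext => x; rewrite /weighted addr0 mulrCA.
Qed.

Theorem propositionC3 (R : realType) (N : nat) (alpha l : R)
    (omega : N.-tuple R -> R) (gamma eps rho : R) (q : \bar R)
    (phi : N.-tuple R -> R) (nu : R) (r : \bar R)
    (hN : (1 <= N)%N) (halpha : 0 < alpha)
    (hl : - Num.min 2 N%:R < l)
    (hlalpha : l / N%:R < alpha < (2 + l) / N%:R)
    (homegaLoo : omega \in Lfun (lebesgueRn R N) +oo%E)
    (homegahom : homogeneous0 omega)
    (homega_ge0 : {ae lebesgueRn R N, forall x, 0 <= omega x})
    (homega_neq0 : ~ {ae lebesgueRn R N, forall x, omega x = 0})
    (hgamma : 0 < gamma < N%:R) (hlgamma : l / alpha < gamma)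
    (heps : 0 < eps) (hrho : 0 < rho)
    (hq : ((N%:R / (N%:R - gamma))%:E < q)%E)
    (hphi : Lw q gamma phi)
    (hexp : admissible_exponents N l alpha q gamma r nu) :
  exists C : R, 0 < C /\
    ({ae lebesgueRn R N, forall x, phi_inner omega gamma eps x <= phi x} ->
      forall lambda : R, 1 < lambda ->
      (Tmax l alpha q gamma r nu (fun x => (lambda * phi x)%R) <=
        (C * lambda `^ (- ((2 + l) / (2 * alpha) - gamma / 2)^-1))%:E)%E) /\
    ({ae lebesgueRn R N, forall x, phi_outer omega gamma rho x <= phi x} ->
      forall lambda : R, 0 < lambda < 1 ->
      (Tmax l alpha q gamma r nu (fun x => (lambda * phi x)%R) <=
        (C * lambda `^ (- ((2 + l) / (2 * alpha) - gamma / 2)^-1))%:E)%E).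
Proof.
have N0 : 0 < N%:R :> R by rewrite ltr0n.
have [g0 gN] := andP hgamma.
have al : alpha * N%:R < 2 + l by case/andP: hlalpha => _; rewrite ltr_pdivlMr.
have mo : measurable_fun setT omega by move: homegaLoo; rewrite inE => /andP[]; rewrite inE.
have q1 : (1 <= q)%E.
  apply: le_trans (ltW hq); rewrite lee_fin ler_pdivlMr ?subr_gt0// mul1r gerBl; exact: ltW.
have [C C0 hC] := solution_mass_bound hN halpha al hgamma hlgamma hq hexp.
have [c c0 hc] := heat_annulus_ge gamma hN mo homegahom homega_ge0 homega_neq0.
(* This is alpha N < 2 + l. *)
have kN : 0 < (2 + l) / (2 * alpha) - N%:R / 2.
  rewrite subr_gt0 ltr_pdivlMr ?mulr_gt0//.
  by rewrite (_ : N%:R / 2 * (2 * alpha) = alpha * N%:R)//; field.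
have kg : (2 + l) / (2 * alpha) - N%:R / 2 < (2 + l) / (2 * alpha) - gamma / 2.
  by rewrite ltrD2l ltrN2 ltr_pM2r.
have k0 := lt_trans kN kg.
set k := (2 + l) / (2 * alpha) - gamma / 2 in kg k0 *.
have ceps : 0 < c * eps `^ (N%:R - gamma) by rewrite mulr_gt0 ?powR_gt0.
have [K1 K10 hK1] := existence_time_le halpha C0 c0 k0.
have [K2 K20 hK2] := existence_time_le halpha C0 ceps kN.
pose x0 : N.-tuple R := [tuple of nseq N 0].
have x00 : enorm x0 = 0.
  apply/eqP; rewrite -sqrf_eq0 enorm_sqr big1// => i _.
  by rewrite tnth_nseq expr0n.
have bound lambda T s u : 0 < lambda -> 0 < T -> 0 < s -> s ^+ 2 <= T ->
    {ae lebesgueRn R N, forall x, 0 <= phi x} ->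
    {ae lebesgueRn R N, forall y, s / 2 <= enorm y <= s -> omega y * enorm y `^ (- gamma) <= phi y} ->
    is_solution l alpha q gamma r nu (fun x => lambda * phi x) T u ->
    (lambda * (c * s `^ (N%:R - gamma)) * T `^ (- (N%:R / 2))) `^ alpha <= C * T `^ (- ((2 + l) / 2)).
  move=> la0 T0 s0 sT phi0 hphi' sol.
  have L := Lw_scale lambda q1 hphi.
  apply: (hC T _ x0 _ u T0 x00 L _ sol).
  - by apply: filterS phi0 => x; exact: mulr_ge0 (ltW la0).
  - by rewrite !mulr_ge0 ?powR_ge0 ?ltW.
  apply: hc => //; [exact: ltW|by case: L|].
  by apply: filterS hphi' => y h yr; rewrite ler_wpM2l ?(ltW la0)// h.
have sqrtb lambda T u : 0 < lambda -> 0 < T ->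
    {ae lebesgueRn R N, forall x, 0 <= phi x} ->
    {ae lebesgueRn R N, forall y, Num.sqrt T / 2 <= enorm y <= Num.sqrt T -> omega y * enorm y `^ (- gamma) <= phi y} ->
    is_solution l alpha q gamma r nu (fun x => lambda * phi x) T u ->
    T <= K1 * lambda `^ (- k^-1).
  move=> la0 T0 phi0 hphi' sol; apply: hK1 => //.
  have sT0 : 0 < Num.sqrt T by rewrite sqrtr_gt0.
  have := bound lambda T (Num.sqrt T) u la0 T0 sT0 _ phi0 hphi' sol.
  rewrite sqr_sqrtr ?(ltW T0)// => /(_ (lexx _)); apply: le_trans.
  rewrite -powR12_sqrt ?(ltW T0)// -powRrM -!mulrA -powRD; last by rewrite (gt_eqF T0) implybT.
  by rewrite (_ : 2^-1 * (N%:R - gamma) + _ = - (gamma / 2))//; field.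
(* One summand for each case below: annuli of radius sqrt(T), the fixed annulus of radius eps, and
   times shorter than 4 rho^2. *)
exists (K1 + K2 + 4 * rho ^+ 2); split; first by rewrite !addr_gt0// mulr_gt0 ?exprn_gt0.
have rho0 : 0 <= 4 * rho ^+ 2 by rewrite mulr_ge0 ?sqr_ge0.
split => hle lambda hla.
  have la0 : 0 < lambda by apply: lt_trans hla.
  have phi0 : {ae lebesgueRn R N, forall x, 0 <= phi x}.
    apply: filterS2 hle homega_ge0 => x h ox; apply: le_trans h.
    by rewrite /phi_inner; case: ifP => // _; rewrite mulr_ge0 ?powR_ge0.
  apply: ub_ereal_sup => _ [T [T0 [u sol]] <-]; rewrite lee_fin.
  have L0 : 0 <= lambda `^ (- k^-1) by exact: powR_ge0.
  (* For T <= eps^2 the annulus of outer radius sqrt(T) lies in the ball where the data dominate;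
     for larger T the outer radius is frozen at eps. *)
  have [Te|eT] := leP T (eps ^+ 2).
    apply: (@le_trans _ _ (K1 * lambda `^ (- k^-1))).
      apply: sqrtb sol => //; apply: filterS hle => y h /andP[_ yT].
      apply: le_trans h; rewrite /phi_inner ifT//; apply: le_trans yT _.
      by rewrite -[eps]ger0_norm ?(ltW heps)// -sqrtr_sqr ler_wsqrtr.
    by rewrite ler_wpM2r// -addrA lerDl addr_ge0// ltW.
  apply: (@le_trans _ _ (K2 * lambda `^ (- k^-1))); last first.
    by rewrite ler_wpM2r// -addrA addrCA lerDl addr_ge0// ltW.
  apply: (@le_trans _ _ (K2 * lambda `^ (- ((2 + l) / (2 * alpha) - N%:R / 2)^-1))).
    apply: hK2 => //; apply: bound sol => //; first exact: ltW.
    apply: filterS hle => y h /andP[_ ye].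
    by apply: le_trans h; rewrite /phi_inner ye.
  (* Since gamma < N, the exponent obtained with N is the larger one in absolute value; for lambda >
     1 the negative power is then the smaller. *)
  rewrite ler_wpM2l ?(ltW K20)// ler_powR ?(ltW hla)// lerN2 lef_pV2 ?posrE//.
  exact: ltW.
have [la0 la1] := andP hla.
have phi0 : {ae lebesgueRn R N, forall x, 0 <= phi x}.
  apply: filterS2 hle homega_ge0 => x h ox; apply: le_trans h.
  by rewrite /phi_outer; case: ifP => // _; rewrite mulr_ge0 ?powR_ge0.
apply: ub_ereal_sup => _ [T [T0 [u sol]] <-]; rewrite lee_fin.
have L1 : 1 <= lambda `^ (- k^-1).
  have ki : 0 <= k^-1 by rewrite invr_ge0 ltW.
  by have := ger_powRN ki la0 (ltW la1); rewrite powR1.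
(* The inner radius sqrt(T)/2 of the annulus must be at least rho, that is T >= 4 rho^2. *)
have [Tr|rT] := leP (4 * rho ^+ 2) T.
  apply: (@le_trans _ _ (K1 * lambda `^ (- k^-1))).
    apply: sqrtb sol => //; apply: filterS hle => y h /andP[yT _].
    apply: le_trans h; rewrite /phi_outer ifF//; apply/negP/negP; rewrite -leNgt.
    apply: le_trans yT; rewrite ler_pdivlMr// mulrC.
    have -> : 2 * rho = Num.sqrt (4 * rho ^+ 2).
      rewrite -[LHS]ger0_norm ?mulr_ge0 ?(ltW hrho)// -sqrtr_sqr; congr Num.sqrt; ring.
    exact: ler_wsqrtr.
  by rewrite ler_wpM2r ?powR_ge0// -addrA lerDl addr_ge0// ltW.
(* For lambda < 1 the factor lambda^{-1/k} is at least 1, so it can multiply the constant bound on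
   T. *)
apply: (@le_trans _ _ (4 * rho ^+ 2 * lambda `^ (- k^-1))).
  by apply: le_trans (ltW rT) _; rewrite ler_peMr.
by rewrite ler_wpM2r ?powR_ge0// lerDr addr_ge0// ltW.
Qed.
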